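(* Let $\mathcal{M}$ be the field of meromorphic functions in $\mathbb{C}$, let $\mathcal{N}$ be a subfield of $\mathcal{M}$, and let $f\in\mathcal{N}\setminus\ker(L)$, where $L:\mathcal{M}\to\mathcal{M}$ is a linear operator such that $$m\left(r,\frac{L(f)}{f}\right)=o(T(r,f))$$ as $r\to\infty$ outside of an exceptional set $E\subset(0,\infty)$. If $a_1,\ldots,a_q$ are $q\geq1$ different elements of $\ker(L)\cap\mathcal{S}(f)$, then $$(q-1)T(r,f)+N_{L(f)}(r,f)\leq N(r,f)+\sum_{j=1}^qN\left(r,\frac{1}{f-a_j}\right)+S(r,f),$$ where $$N_{L(f)}(r,f)=2N(r,f)-N(r,L(f))+N\left(r,\frac{1}{L(f)}\right)$$ and $$S(r,f)=o(T(r,f))$$ as $r\to\infty$ outside of $E$.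
   Context: $m(r,\cdot)$, $N(r,\cdot)$ and $T(r,\cdot)$ are the usual Nevanlinna proximity function, integrated counting function of poles (counted with multiplicity) and characteristic. For $f\in\mathcal{M}$, $\mathcal{S}(f)$ is the set of all $h\in\mathcal{M}$ such that $T(r,h)=o(T(r,f))$ as $r\to\infty$ outside a set of finite linear measure. $\ker(L)=\{h\in\mathcal{M}:L(h)\equiv0\}$.
   Formalization: As printed the claim fails (f=e^z+1, L(1)=0, L(f)=f, a_1=1); here f is nonconstant, the a_j lie in N, the estimate on m(r,L(g)/g) holds for all nonconstant g in N\ker(L) with the same E, and S(r,f)=o(T(r,f)) outside E and any set F off which the a_j are small. *)

(* Defs.v *)
From HB Require Import structures.
From mathcomp Require Export all_boot all_order all_algebra.
From mathcomp Require Export all_classical all_reals all_analysis.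
From mathcomp.real_closed Require Export complex.

Set Implicit Arguments.
Unset Strict Implicit.
Unset Printing Implicit Defensive.

Export Order.TTheory GRing.Theory Num.Theory.
Export numFieldNormedType.Exports.

Open Scope classical_set_scope.
Open Scope ring_scope.

(* Giving [R[i]] this name at type [numClosedFieldType] makes the topology that
   MathComp-Analysis puts on every numFieldType available on it. *)
Definition Cplx (R : realType) : numClosedFieldType := R[i].

Section Meromorphic.
Context {R : realType}.
Local Notation C := (Cplx R).
Implicit Types (f g h : C -> C) (z w : C).

Definition cmod (z : C) : R := Normc.normc (z : R[i]).

(* Analyticity in the sense of Weierstrass: the sum of a convergent power series. *)
Definition analytic_at g z0 : Prop :=
  exists c : nat -> C, \forall w \near (0 : C),
    series (fun k => c k * w ^+ k) n @[n --> \oo] --> g (z0 + w).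

(* Meromorphic functions are represented by total functions whose values on a
   closed discrete set (poles in particular) carry no information; two such
   functions are the same element of the field of meromorphic functions when
   they are related by [mero_eq].  The field operations are then the pointwise
   ones, with the convention 0^-1 = 0. *)
Definition meromorphic f : Prop :=
  forall z0, exists (k : nat) (g : C -> C), analytic_at g z0 /\
    \forall z \near z0^', f z = g z / (z - z0) ^+ k.

Definition mero_eq f g : Prop :=
  forall z0, \forall z \near z0^', f z = g z.

Definition nonconstant f : Prop := ~ exists c : C, mero_eq f (fun=> c).

Definition subfield (N : set (C -> C)) : Prop :=
  [/\ N `<=` meromorphic,
      (forall f g, meromorphic g -> mero_eq f g -> N f -> N g),
      N (fun=> 1),
      (forall f g, N f -> N g -> N (fun z => f z - g z)) &
      (forall f g, N f -> N g -> N (fun z => f z / g z))].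

Definition linear_operator (L : (C -> C) -> (C -> C)) : Prop :=
  [/\ (forall f, meromorphic f -> meromorphic (L f)),
      (forall f g, meromorphic f -> meromorphic g ->
         mero_eq f g -> mero_eq (L f) (L g)) &
      (forall (c : C) f g, meromorphic f -> meromorphic g ->
         mero_eq (L (fun z => c * f z + g z))
                 (fun z => c * L f z + L g z))].

Definition ker (L : (C -> C) -> (C -> C)) : set (C -> C) :=
  [set h | meromorphic h /\ mero_eq (L h) (fun=> 0)].

Definition pole_of_order f z0 (k : nat) : Prop :=
  exists g, [/\ analytic_at g z0, g z0 != 0 &
    \forall z \near z0^', f z = g z / (z - z0) ^+ k].

(* The order of the pole of [f] at [z0], and 0 if [z0] is not a pole. *)
Definition pole_order f z0 : nat := xget 0%N [set k | pole_of_order f z0 k].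

Definition n_poles (r : R) f : R :=
  \sum_(z \in [set z : C | cmod z <= r]) ((pole_order f z)%:R : R).

Definition N_poles (r : R) f : R :=
  \int[lebesgue_measure]_(t in `]0, r]) ((n_poles t f - n_poles 0 f) / t)
  + n_poles 0 f * ln r.

(* [ln 0 = 0] in the library, so this is the usual positive part of the
   logarithm also at 0. *)
Definition logp (x : R) : R := Num.max (ln x) 0.

Definition circle_point (r t : R) : C := (r * cos t +i* (r * sin t))%C.

Definition proximity (r : R) f : R :=
  (2 * pi)^-1 *
  \int[lebesgue_measure]_(t in `[0, 2 * pi]) logp (cmod (f (circle_point r t))).

Definition characteristic (r : R) f : R := proximity r f + N_poles r f.

Definition o_outside (E : set R) (u v : R -> R) : Prop :=
  forall eps : R, 0 < eps ->
    \forall r \near +oo, ~ E r -> `|u r| <= eps * `|v r|.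

Definition finite_linear_measure (F : set R) : Prop :=
  measurable F /\ (lebesgue_measure F < +oo)%E.

(* Kept separate from [small_functions] so that a theorem can name the set
   outside of which given small functions are small. *)
Definition small_outside (F : set R) f h : Prop :=
  o_outside F (characteristic ^~ h) (characteristic ^~ f).

Definition small_functions f : set (C -> C) :=
  [set h | meromorphic h /\
    exists2 F, finite_linear_measure F & small_outside F f h].

Definition N_ramification (L : (C -> C) -> (C -> C)) (r : R) f : R :=
  2 * N_poles r f - N_poles r (L f) + N_poles r (fun z => (L f z)^-1).

End Meromorphic.

(* Main.v *)
(* For holomorphic [g] without zeros, the mean of [ln |g|] over [|z| = r] is
   [ln |g 0|], because radial contraction of the circle does not change it.
   Dividing a meromorphic function by the finitely many factors [(z - a) ^ m] of
   a disc, and computing the means of [ln |z - a|] separately, gives Jensen's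
   formula, hence [T(r, 1/f) = T(r, f) + O(1)].
   Put [g_j = f - a_j].  Since [L g_j = L f], one has
   [\sum_j 1/g_j = (1/L f) * \sum_j L g_j / g_j], and away from the small set where
   two of the [g_j] nearly agree at most one [1/g_j] is large.  Therefore
   [\sum_j m(r, 1/g_j) <= m(r, 1/L f) + S(r, f)], the error being controlled by the
   [m(r, L g_j / g_j)] and the [m(r, 1/(a_i - a_j))].  The first main theorem for
   the [g_j] and for [L f], together with [m(r, L f) <= m(r, f) + m(r, L f / f)],
   turns this into the assertion. *)
Require Import Defs.
From mathcomp Require Import ring lra zify measurable_realfun.
Set Implicit Arguments.
Unset Strict Implicit.
Unset Printing Implicit Defensive.

(** * Complex differentiation along paths *)

Section ComplexTopology.
Context {R : realType}.
Local Notation C := (Cplx R).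
Implicit Types (z w : C) (r t e : R).

(** The hypothesis on [L] is applied to [f] and also to each [f - a_j]. This difference stays in [N]
    and outside [ker L], and it has to be shown nonconstant; the error it produces is small against
    [T(r, f - a_j)] and is then compared with [T(r, f)]. Two obstacles shape the analysis. Values of
    a meromorphic function mean nothing on a discrete set, so identities and inequalities on a
    circle are used only off a finite set of angles, finite by compactness. And the inequality
    concerns every radius, including those whose circle carries zeros or poles, so the mean of
    [ln |z - a|] is needed for [|a| = r] too. Cauchy's formula and the mean of [ln |g|] come from
    one principle about real integrals over [[0, 2 pi]]: such an integral does not change under a
    deformation if its derivative in the parameter integrates to zero over the circle. Power series
    then tie the Weierstrass definition of analyticity to complex differentiability in both
    directions. *)

Definition ofR (x : R) : C := (x%:C)%C.

Definition reC (z : C) : R := complex.Re (z : R[i]).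
Definition imC (z : C) : R := complex.Im (z : R[i]).

Lemma ofR0 : ofR 0 = 0. Proof. by []. Qed.
Lemma ofR1 : ofR 1 = 1. Proof. by []. Qed.
Lemma ofRD x y : ofR (x + y) = ofR x + ofR y.
Proof. exact: (raddfD (real_complex R)). Qed.
Lemma ofRN x : ofR (- x) = - ofR x.
Proof. exact: (raddfN (real_complex R)). Qed.
Lemma ofRM x y : ofR (x * y) = ofR x * ofR y.
Proof. exact: (rmorphM (real_complex R)). Qed.
Lemma ofRV x : ofR x^-1 = (ofR x)^-1.
Proof. exact: (fmorphV (real_complex R)). Qed.

Lemma normE z : `|z| = ofR (cmod z).
Proof. by []. Qed.

Lemma cmod_ge0 z : 0 <= cmod z.
Proof. by rewrite -lecR -[X in _ <= X]/(`|z|) normr_ge0. Qed.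

Lemma cmod0 : cmod (0 : C) = 0. Proof. exact: Normc.normc0. Qed.
Lemma cmod1 : cmod (1 : C) = 1. Proof. exact: Normc.normc1. Qed.
Lemma cmodM z w : cmod (z * w) = cmod z * cmod w.
Proof. exact: Normc.normcM. Qed.
Lemma cmodV z : cmod z^-1 = (cmod z)^-1.
Proof. exact: Normc.normcV. Qed.
Lemma cmodN z : cmod (- z) = cmod z.
Proof. exact: normcN. Qed.
Lemma cmodD z w : cmod (z + w) <= cmod z + cmod w.
Proof. exact: le_normcD. Qed.
Lemma cmodB z w : cmod (z - w) = cmod (w - z).
Proof. by rewrite -cmodN opprB. Qed.
Lemma cmod_eq0 z : (cmod z == 0) = (z == 0).
Proof.
apply/eqP/eqP => [|->]; last exact: cmod0.
exact: Normc.eq0_normc.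
Qed.
Lemma cmod_gt0 z : (0 < cmod z) = (z != 0).
Proof. by rewrite lt_def cmod_ge0 andbT cmod_eq0. Qed.
Lemma cmodX z n : cmod (z ^+ n) = cmod z ^+ n.
Proof. by elim: n => [|n IH]; rewrite ?expr0 ?cmod1 // !exprS cmodM IH. Qed.
Lemma cmod_ofR x : cmod (ofR x) = `|x|.
Proof. by rewrite /cmod /= expr0n /= addr0 sqrtr_sqr. Qed.
Lemma cmod_sum (I : Type) (s : seq I) (P : pred I) (F : I -> C) :
  cmod (\sum_(i <- s | P i) F i) <= \sum_(i <- s | P i) cmod (F i).
Proof.
elim/big_rec2 : _ => [|i y x _ xy]; first by rewrite cmod0.
exact: le_trans (cmodD _ _) (lerD (lexx _) xy).
Qed.

Lemma re_le_cmod z : `|reC z| <= cmod z.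
Proof. by have := normc_ge_Re (z : R[i]); rewrite -[`|z|]/(ofR (cmod z)) lecR. Qed.

Lemma cmod_sqr z : cmod z ^+ 2 = reC z ^+ 2 + imC z ^+ 2.
Proof. by case: z => a b; rewrite /cmod /= sqr_sqrtr // addr_ge0 // sqr_ge0. Qed.

Lemma im_le_cmod z : `|imC z| <= cmod z.
Proof.
rewrite -(@ler_pXn2r _ 2) ?nnegrE ?cmod_ge0 //.
by rewrite cmod_sqr real_normK ?num_real// lerDr sqr_ge0.
Qed.

Lemma cmod_le_reim z : cmod z <= `|reC z| + `|imC z|.
Proof.
rewrite -(@ler_pXn2r _ 2) ?nnegrE ?cmod_ge0 // ?addr_ge0 //.
rewrite cmod_sqr -[reC z ^+ 2]real_normK ?num_real// -[imC z ^+ 2]real_normK ?num_real//.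
by rewrite sqrrD lerD2r lerDl mulrn_wge0 // mulr_ge0.
Qed.

Lemma reD z w : reC (z + w) = reC z + reC w.
Proof. by case: z w => ? ? []. Qed.
Lemma imD z w : imC (z + w) = imC z + imC w.
Proof. by case: z w => ? ? []. Qed.
Lemma reN z : reC (- z) = - reC z.
Proof. by case: z. Qed.
Lemma imN z : imC (- z) = - imC z.
Proof. by case: z. Qed.
Lemma reM z w : reC (z * w) = reC z * reC w - imC z * imC w.
Proof. by case: z w => ? ? []. Qed.
Lemma imM z w : imC (z * w) = reC z * imC w + imC z * reC w.
Proof. by case: z w => ? ? []. Qed.
Lemma reim_eq z w : reC z = reC w -> imC z = imC w -> z = w.
Proof. by case: z w => ? ? [] ? ? /= -> ->. Qed.

(** The radius of a ball is an element of [C]. In the partial order of [R[i]] a positive element is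
    real, so its real part can serve as radius. *)
Lemma nbhs_cmodP z (P : set C) :
  nbhs z P <-> exists2 e : R, 0 < e & forall w, cmod (w - z) < e -> P w.
Proof.
split.
- move=> /nbhs_ballP [eps /= eps0 H].
  have e0 := eps0; move: eps0 H; case: eps e0 => e b e0 eps0 H.
  move: eps0; rewrite ltcE /= => /andP[/eqP b0 e1].
  exists e => // w wz; apply: H; rewrite /ball /= distrC normE ltcE /= b0 eqxx /=.
  exact: wz.
- case=> e e0 H; apply/nbhs_ballP; exists (ofR e) => /=.
    by rewrite /ofR ltcR.
  move=> w; rewrite /ball /= distrC normE /ofR ltcR; exact: H.
Qed.

Lemma near_cmod z e : 0 < e -> \forall w \near z, cmod (w - z) < e.
Proof. by move=> e0; apply/nbhs_cmodP; exists e. Qed.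

Lemma cvg_cmodP (T : Type) (F : set_system T) {FF : Filter F} (f : T -> C) z :
  f x @[x --> F] --> z <-> forall e, 0 < e -> \forall x \near F, cmod (f x - z) < e.
Proof.
split=> [fz e e0|H].
  exact: (fz _ (near_cmod z e0)).
by move=> A /nbhs_cmodP [e e0 HA]; apply: filterS (H _ e0) => x /HA.
Qed.

Lemma cvg_reim (T : Type) (F : set_system T) {FF : Filter F} (f : T -> C) z :
  reC (f x) @[x --> F] --> reC z -> imC (f x) @[x --> F] --> imC z ->
  f x @[x --> F] --> z.
Proof.
move=> hr hi; apply/cvg_cmodP => e e0; near=> x.
apply: (le_lt_trans (cmod_le_reim _)).
rewrite (splitr e) ltrD //.
- rewrite reD reN; near: x; move/cvgrPdistC_lt : hr; apply; lra.
- rewrite imD imN; near: x; move/cvgrPdistC_lt : hi; apply; lra.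
Unshelve. all: end_near. Qed.

Lemma re_continuous : continuous reC.
Proof.
move=> z; apply/(@cvgrPdistC_lt _ _ _ (nbhs z) _) => e e0; near=> w.
rewrite -reN -reD; apply: le_lt_trans (re_le_cmod _) _.
by near: w; exact: near_cmod.
Unshelve. all: end_near. Qed.

Lemma im_continuous : continuous imC.
Proof.
move=> z; apply/(@cvgrPdistC_lt _ _ _ (nbhs z) _) => e e0; near=> w.
rewrite -imN -imD; apply: le_lt_trans (im_le_cmod _) _.
by near: w; exact: near_cmod.
Unshelve. all: end_near. Qed.

Lemma ler_dist_cmod z w : `|cmod z - cmod w| <= cmod (z - w).
Proof.
rewrite ler_norml; apply/andP; split.
  by have := cmodD (w - z) z; rewrite subrK cmodB; lra.
by have := cmodD (z - w) w; rewrite subrK; lra.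
Qed.

Lemma cmod_continuous : continuous (@cmod R).
Proof.
move=> z; apply/(@cvgrPdistC_lt _ _ _ (nbhs z) _) => e e0; near=> w.
apply: le_lt_trans (ler_dist_cmod _ _) _.
by near: w; exact: near_cmod.
Unshelve. all: end_near. Qed.

Lemma compact_disc r : compact [set z : C | cmod z <= r].
Proof.
pose g (p : R * R) : C := (p.1 +i* p.2)%C.
have gc : continuous g.
  move=> [x y]; apply: cvg_reim => /=; [exact: cvg_fst|exact: cvg_snd].
have cK : compact (g @` (`[- r, r]%classic `*` `[- r, r]%classic)).
  apply: continuous_compact; first exact: continuous_subspaceT.
  by apply: compact_setX; exact: segment_compact.
apply: (subclosed_compact _ cK).
  move/continuous_closedP : cmod_continuous => /(_ [set x | x <= r]).
  by apply; exact: closed_le.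
move=> z /= zr; exists (reC z, imC z); last by case: (z).
by split => /=; rewrite in_itv /= -ler_norml;
  [exact: le_trans (re_le_cmod _) zr|exact: le_trans (im_le_cmod _) zr].
Qed.

(** Each point has a neighbourhood in which only the point itself can be exceptional; a finite
    subcover leaves at most its centres. This is used for discs in the plane and for the interval of
    angles. *)
Lemma finite_compact_exceptions (T : ptopologicalType) (K Q : set T) :
  compact K -> (forall x, K x -> \forall y \near x^', Q y) ->
  finite_set (K `\` Q).
Proof.
rewrite compact_cover => cK H.
have [||D DK KD] := cK T K (fun x => interior [set y | y != x -> Q y]).
- by move=> x Kx; exact: open_interior.
- move=> x Kx; exists x => //; exact: H.
apply: (sub_finite_set _ (finite_fset D)).
move=> y [Ky nQy]; have [x xD /interior_subset /= xy] := KD _ Ky.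
have [->//|yx] := eqVneq y x.
by case: nQy; apply: xy.
Qed.

End ComplexTopology.

Lemma near_eq_continuous (T U : topologicalType) (f g : T -> U) z :
  (\forall w \near z, f w = g w) -> {for z, continuous f} -> {for z, continuous g}.
Proof.
move=> fg fc; rewrite /prop_for /continuous_at -(nbhs_singleton fg).
by apply: cvg_trans fc; apply: near_eq_cvg; exact: fg.
Qed.

(** * Algebra of holomorphic functions *)

Section Holomorphic.
Context {K : numFieldType}.
Local Notation C := K.
Implicit Types (z w : C) (f g : C -> C).

(* Requiring the derivative to be continuous is harmless for power series and
   avoids Goursat's lemma. *)
Definition holomorphic_at f z0 : Prop :=
  \forall z \near z0, derivable f z (1 : C) /\ {for z, continuous (fun z => 'D_1 f z)}.

Lemma holomorphic_at_near f z0 :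
  holomorphic_at f z0 -> \forall z \near z0, holomorphic_at f z.
Proof. by move=> /near_join. Qed.

Lemma derivable_continuousC f z : derivable f z (1 : C) -> {for z, continuous f}.
Proof. by move=> /derivable1_diffP /differentiable_continuous. Qed.

Lemma holomorphic_of_derive f (df : C -> C) z0 :
  (\forall z \near z0, is_derive z (1 : C) f (df z) /\ {for z, continuous df}) ->
  holomorphic_at f z0.
Proof.
move=> H; have := near_join H; apply: filterS => z Hz.
have [dz cz] := nbhs_singleton Hz.
split; first by case: dz.
apply: near_eq_continuous cz; apply: filterS Hz => w [dw _].
by rewrite derive_val.
Qed.

Lemma near_eq_holomorphic f g z0 :
  (\forall z \near z0, f z = g z) -> holomorphic_at f z0 -> holomorphic_at g z0.
Proof.
move=> /near_join fg hf; apply: (@holomorphic_of_derive g (fun z => 'D_1 f z)).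
apply: filterS2 fg hf => z fg [dz cz]; split => //.
by apply: near_eq_is_derive fg _; exact: derivableP.
Qed.

Lemma holomorphic_derivable f z : holomorphic_at f z -> derivable f z (1 : C).
Proof. by rewrite /holomorphic_at => /nbhs_singleton []. Qed.

Lemma holomorphic_continuous f z : holomorphic_at f z -> {for z, continuous f}.
Proof. by move=> /holomorphic_derivable /derivable_continuousC. Qed.

Lemma holomorphic_cst (c : C) z0 : holomorphic_at (fun=> c) z0.
Proof.
apply: (@holomorphic_of_derive _ (fun=> 0)); near=> z; split.
  exact: is_derive_cst.
exact: cst_continuous.
Unshelve. all: end_near. Qed.

Lemma holomorphic_id z0 : holomorphic_at (fun z => z) z0.
Proof.
apply: (@holomorphic_of_derive _ (fun=> 1)); near=> z; split.
  exact: is_derive_id.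
exact: cst_continuous.
Unshelve. all: end_near. Qed.

Lemma holomorphicD f g z0 : holomorphic_at f z0 -> holomorphic_at g z0 ->
  holomorphic_at (fun z => f z + g z) z0.
Proof.
move=> hf hg; apply: (@holomorphic_of_derive _ (fun z => 'D_1 f z + 'D_1 g z)).
apply: filterS2 hf hg => z [fz cf] [gz cg]; split.
  by apply: is_deriveD; exact: derivableP.
exact: continuousD.
Qed.

Lemma holomorphicM f g z0 : holomorphic_at f z0 -> holomorphic_at g z0 ->
  holomorphic_at (fun z => f z * g z) z0.
Proof.
move=> hf hg.
apply: (@holomorphic_of_derive _ (fun z => f z * 'D_1 g z + g z * 'D_1 f z)).
apply: filterS2 hf hg => z [fz cf] [gz cg]; split.
  by apply: is_deriveM; exact: derivableP.
by apply: continuousD; apply: continuousM => //; exact: derivable_continuousC.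
Qed.

Lemma holomorphicN f z0 : holomorphic_at f z0 -> holomorphic_at (fun z => - f z) z0.
Proof.
move=> hf; apply: (@near_eq_holomorphic (fun z => -1 * f z)).
  by near=> z; rewrite mulN1r.
exact/holomorphicM/hf/holomorphic_cst.
Unshelve. all: end_near. Qed.

Lemma holomorphicB f g z0 : holomorphic_at f z0 -> holomorphic_at g z0 ->
  holomorphic_at (fun z => f z - g z) z0.
Proof. by move=> hf hg; exact: (holomorphicD hf (holomorphicN hg)). Qed.

Lemma holomorphicX f n z0 : holomorphic_at f z0 ->
  holomorphic_at (fun z => f z ^+ n) z0.
Proof.
move=> hf; elim: n => [|n IH]; first exact: holomorphic_cst.
by under eq_fun do rewrite exprS; exact: (holomorphicM hf IH).
Qed.

Lemma near_neq0 f z0 : {for z0, continuous f} -> f z0 != 0 ->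
  \forall z \near z0, f z != 0.
Proof.
by move=> fc f0; exact: (cvgr_neq0 (f z0) fc f0).
Qed.

Lemma holomorphicV f z0 : holomorphic_at f z0 -> f z0 != 0 ->
  holomorphic_at (fun z => (f z)^-1) z0.
Proof.
move=> hf f0.
have hn := near_neq0 (holomorphic_continuous hf) f0.
apply: (@holomorphic_of_derive _ (fun z => - ((f z)^-1 * (f z)^-1) * 'D_1 f z)).
apply: filterS2 hf hn => z [fz cf] f1; split.
  apply: DeriveDef; first exact: derivableV.
  by rewrite deriveV // expr2 invfM.
have fc := derivable_continuousC fz.
have fVc := continuousV f1 fc.
by apply: continuousM cf; apply: continuousN; exact: continuousM.
Qed.

End Holomorphic.

Section Paths.
Context {R : realType}.
Local Notation C := (Cplx R).
Implicit Types (z w : C) (r t e : R) (f g : C -> C).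

(** The derivative of a curve in a real parameter. The quotient is formed inside [C], with
    [ofR s^-1] as scalar, because [C] carries the structure of a normed space over itself. *)
Definition path_deriv (p : R -> C) t (d : C) : Prop :=
  ofR s^-1 * (p (t + s) - p t) @[s --> (0 : R)^'] --> d.

Lemma ofR_continuous : continuous (@ofR R).
Proof.
move=> x; apply: cvg_reim => /=; first exact: cvg_id.
exact: cvg_cst.
Qed.

Lemma path_deriv_cvg (p : R -> C) t d : path_deriv p t d ->
  p (t + s) @[s --> (0 : R)^'] --> p t.
Proof.
move=> pd.
have h : ofR s * (ofR s^-1 * (p (t + s) - p t)) + p t @[s --> (0 : R)^'] --> ofR 0 * d + p t.
  apply: cvgD; last exact: cvg_cst.
  have h0 : ofR s @[s --> (0 : R)^'] --> ofR 0.
    exact: cvg_trans (cvg_app _ (@nbhs_dnbhs _ (0 : R))) (@ofR_continuous 0).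
  exact: cvgM h0 pd.
rewrite mul0r add0r in h.
apply: cvg_trans h; apply: near_eq_cvg.
near=> s; rewrite mulrA -ofRM divff ?mul1r ?subrK //.
by near: s; exact: nbhs_dnbhs_neq.
Unshelve. all: end_near. Qed.

Lemma is_deriveCP f z (d : C) : is_derive z (1 : C) f d <->
  forall e, 0 < e -> \forall w \near z, cmod (f w - f z - d * (w - z)) <= e * cmod (w - z).
Proof.
split=> [[df <-] e e0|H].
- move/cvg_cmodP : df => /(_ e e0); rewrite -/(derive f z 1) near_withinE /=.
  move=> /nbhs_cmodP [dlt dlt0 H]; apply/nbhs_cmodP; exists dlt => // w wz.
  have [->|nz] := eqVneq w z; first by rewrite !subrr mulr0 subr0 cmod0 mulr0.
  have nz' : w - z != 0 by rewrite subr_eq0.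
  have := H (w - z); rewrite subr0 => /(_ wz nz').
  rewrite /= [(w - z) *: _]mulr1 subrK => /ltW h.
  have -> : f w - f z - 'D_1 f z * (w - z) =
            ((w - z)^-1 *: (f w - f z) - 'D_1 f z) * (w - z).
    by rewrite mulrBl -[_ *: _]/(_ * _) mulrAC mulVf // mul1r.
  by rewrite cmodM ler_wpM2r // cmod_ge0.
- have h : (fun h : C => h^-1 *: ((f \o shift z) (h *: (1:C)) - f z)) h @[h --> 0^'] --> d.
    apply/cvg_cmodP => e e0; rewrite near_withinE.
    have e20 : 0 < e / 2 by lra.
    move/nbhs_cmodP : (H _ e20) => [dlt dlt0 {}H].
    apply/nbhs_cmodP; exists dlt => // h; rewrite subr0 => hd h0 /=.
    have := H (h + z); rewrite addrK => /(_ hd) {}H.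
    have -> : h^-1 *: (f (h *: (1:C) + z) - f z) - d = h^-1 * (f (h + z) - f z - d * h).
      by rewrite mulrBr (mulrCA _ d) mulVf // mulr1 -[_ *: (1:C)]/(_ * _) mulr1.
    rewrite cmodM cmodV mulrC ltr_pdivrMr ?cmod_gt0 //; apply: le_lt_trans H _.
    by rewrite ltr_pM2r ?cmod_gt0 //; lra.
  apply: DeriveDef; first by apply/cvg_ex; exists d.
  exact: cvg_lim h.
Qed.

Lemma path_derivP (p : R -> C) t d : path_deriv p t d <->
  forall e, 0 < e -> \forall s \near (0:R),
     cmod (p (t + s) - p t - d * ofR s) <= e * `|s|.
Proof.
split => [/cvg_cmodP pd e e0|H].
- have := pd e e0; rewrite near_withinE; apply: filterS => s h.
  have [->|s0] := eqVneq s 0; first by rewrite addr0 ofR0 mulr0 !subrr cmod0 normr0 mulr0.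
  have os0 : ofR s != 0 by rewrite -cmod_eq0 cmod_ofR normr_eq0.
  have -> : p (t + s) - p t - d * ofR s = (ofR s^-1 * (p (t + s) - p t) - d) * ofR s.
    by rewrite mulrBl ofRV mulrAC mulVf // mul1r.
  by rewrite cmodM cmod_ofR ler_wpM2r //; exact: ltW (h s0).
- apply/cvg_cmodP => e e0; rewrite near_withinE.
  have e20 : 0 < e / 2 by lra.
  apply: filterS (H _ e20) => s h s0.
  have os0 : ofR s != 0 by rewrite -cmod_eq0 cmod_ofR normr_eq0.
  have -> : ofR s^-1 * (p (t + s) - p t) - d = (ofR s)^-1 * (p (t + s) - p t - d * ofR s).
    by rewrite ofRV; field.
  rewrite cmodM cmodV mulrC ltr_pdivrMr ?cmod_gt0 // cmod_ofR; apply: le_lt_trans h _.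
  by rewrite ltr_pM2r ?normr_gt0 //; lra.
Qed.

(* Caratheodory's slope function makes the chain rule insensitive to times at
   which the path returns to its starting point. *)
Lemma path_deriv_comp f (p : R -> C) t d : derivable f (p t) (1 : C) -> path_deriv p t d ->
  path_deriv (f \o p) t ('D_1 f (p t) * d).
Proof.
move=> df pd; set z := p t.
pose phi w := if w == z then 'D_1 f z else (f w - f z) / (w - z).
have phic : {for z, continuous phi}.
  apply/(@cvg_cmodP _ _ (nbhs z) _) => e e0.
  have e20 : 0 < e / 2 by lra.
  have /is_deriveCP /(_ _ e20) := derivableP df.
  apply: filterS => w; rewrite -/z /phi eqxx.
  case: eqVneq => [->|nz] h; first by rewrite subrr cmod0.
  have nz' : w - z != 0 by rewrite subr_eq0.
  have -> : (f w - f z) / (w - z) - 'D_1 f z = (f w - f z - 'D_1 f z * (w - z)) / (w - z).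
    by field.
  rewrite cmodM cmodV ltr_pdivrMr ?cmod_gt0 //; apply: le_lt_trans h _.
  by rewrite ltr_pM2r ?cmod_gt0 //; lra.
have h : phi (p (t + s)) * (ofR s^-1 * (p (t + s) - p t)) @[s --> (0:R)^'] --> phi z * d.
  exact: cvgM (cvg_comp _ _ (path_deriv_cvg pd) phic) pd.
rewrite {2}/phi eqxx in h.
apply: cvg_trans h; apply: near_eq_cvg; near=> s => /=.
rewrite /phi -/z; case: eqVneq => [->|nz]; first by rewrite !subrr !mulr0.
by rewrite mulrCA divfK // subr_eq0.
Unshelve. all: end_near. Qed.

Lemma path_deriv_re (p : R -> C) t d : path_deriv p t d ->
  is_derive t 1 (fun s => reC (p s)) (reC d).
Proof.
move=> pd.
have h : s^-1 *: (reC (p (s *: 1 + t)) - reC (p t)) @[s --> (0 : R)^'] --> reC d.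
  have := cvg_comp _ _ pd (@re_continuous R d).
  apply: cvg_trans; apply: near_eq_cvg; near=> s => /=.
  by rewrite reM /= mul0r subr0 reD reN [s *: 1]mulr1 (addrC s).
apply: DeriveDef; first by apply/cvg_ex; exists (reC d).
exact: cvg_lim h.
Unshelve. all: end_near. Qed.

Lemma path_deriv_im (p : R -> C) t d : path_deriv p t d ->
  is_derive t 1 (fun s => imC (p s)) (imC d).
Proof.
move=> pd.
have h : s^-1 *: (imC (p (s *: 1 + t)) - imC (p t)) @[s --> (0 : R)^'] --> imC d.
  have := cvg_comp _ _ pd (@im_continuous R d).
  apply: cvg_trans; apply: near_eq_cvg; near=> s => /=.
  by rewrite imM /= mul0r addr0 imD imN [s *: 1]mulr1 (addrC s).
apply: DeriveDef; first by apply/cvg_ex; exists (imC d).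
exact: cvg_lim h.
Unshelve. all: end_near. Qed.

Lemma path_deriv_reim (p : R -> C) t (d : C) :
  is_derive t 1 (fun s => reC (p s)) (reC d) ->
  is_derive t 1 (fun s => imC (p s)) (imC d) ->
  path_deriv p t d.
Proof.
move=> [dr er] [di ei]; apply: cvg_reim.
- rewrite -er; apply: cvg_trans dr; apply: near_eq_cvg; near=> s => /=.
  by rewrite reM /= mul0r subr0 reD reN [s *: 1]mulr1 (addrC s).
- rewrite -ei; apply: cvg_trans di; apply: near_eq_cvg; near=> s => /=.
  by rewrite imM /= mul0r addr0 imD imN [s *: 1]mulr1 (addrC s).
Unshelve. all: end_near. Qed.

Lemma path_deriv_line (a b : C) t : path_deriv (fun s => a + ofR s * b) t b.
Proof.
apply/path_derivP => e e0; near=> s.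
rewrite ofRD (mulrC b) (_ : _ - _ - _ = 0) ?cmod0 ?mulr_ge0 ?normr_ge0 ?ltW //.
by ring.
Unshelve. all: end_near. Qed.

Lemma cmod_circle_point r t : cmod (circle_point r t) = `|r|.
Proof.
apply/eqP; rewrite -(@eqrXn2 _ 2) ?cmod_ge0 // cmod_sqr /= real_normK ?num_real //.
by rewrite !exprMn -mulrDr cos2Dsin2 mulr1.
Qed.

Definition imag1 : C := (0 +i* 1)%C.

Lemma reZ (x : R) z : reC (ofR x * z) = x * reC z.
Proof. by rewrite reM /= mul0r subr0. Qed.
Lemma imZ (x : R) z : imC (ofR x * z) = x * imC z.
Proof. by rewrite imM /= mul0r addr0. Qed.
Lemma re_imag1M z : reC (imag1 * z) = - imC z.
Proof. by rewrite reM /= mul0r mul1r sub0r. Qed.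
Lemma im_imag1M z : imC (imag1 * z) = reC z.
Proof. by rewrite imM /= mul0r mul1r add0r. Qed.

Lemma path_deriv_circle r t :
  path_deriv (circle_point r) t (imag1 * circle_point r t).
Proof.
apply: path_deriv_reim.
- rewrite re_imag1M /= -mulrN.
  exact: (@is_deriveZ _ _ _ cos r t 1 (- sin t)).
- rewrite im_imag1M /=.
  exact: (@is_deriveZ _ _ _ sin r t 1 (cos t)).
Qed.

End Paths.

(** * Cauchy's formula and power series *)

Section CircleIntegrals.
Context {R : realType}.
Local Notation C := (Cplx R).
Local Notation mu := (@lebesgue_measure R).
Local Notation I2pi := (`[0, 2 * pi]%classic : set R).
Implicit Types (h : R -> R) (s t : R).

Definition cint h : R := \int[mu]_(t in I2pi) h t.
Definition cintegrable h : Prop := mu.-integrable I2pi (EFin \o h).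

Lemma twopi_gt0 : 0 < 2 * pi :> R.
Proof. by rewrite mulr_gt0 // pi_gt0. Qed.

Lemma continuous_cintegrable h : continuous h -> cintegrable h.
Proof.
move=> hc; apply: continuous_compact_integrable; first exact: segment_compact.
exact: continuous_subspaceT.
Qed.

Lemma cintD h1 h2 : cintegrable h1 -> cintegrable h2 ->
  cint (fun t => h1 t + h2 t) = cint h1 + cint h2.
Proof. by move=> *; rewrite /cint RintegralD. Qed.

Lemma cintZ (k : R) h : cintegrable h -> cint (fun t => k * h t) = k * cint h.
Proof. by move=> *; rewrite /cint RintegralZl. Qed.

Lemma cint_cst (k : R) : cint (fun=> k) = 2 * pi * k.
Proof.
rewrite /cint Rintegral_cst //= lebesgue_measure_itv /= lte_fin twopi_gt0.
by rewrite -EFinB subr0 /= mulrC.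
Qed.

Lemma cintegrableD h1 h2 : cintegrable h1 -> cintegrable h2 ->
  cintegrable (fun t => h1 t + h2 t).
Proof.
move=> i1 i2; rewrite /cintegrable.
rewrite (_ : _ \o _ = ((EFin \o h1) \+ (EFin \o h2))%E) //.
exact: integrableD.
Qed.

Lemma cintegrableZ (k : R) h : cintegrable h -> cintegrable (fun t => k * h t).
Proof.
move=> ih; rewrite /cintegrable.
rewrite (_ : _ \o _ = (fun t => k%:E * (EFin \o h) t)%E) //.
exact: integrableZl.
Qed.

Lemma cint_derive_periodic (G g : R -> R) : continuous g ->
  (forall t, is_derive t 1 G (g t)) -> G (2 * pi) = G 0 -> cint g = 0.
Proof.
move=> gc dG Gp.
have Gc : continuous G.
  by move=> t; apply/differentiable_continuous/derivable1_diffP; case: (dG t).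
rewrite /cint /Rintegral (@continuous_FTC2 _ g G) ?twopi_gt0 //.
- by rewrite Gp -EFinB subrr.
- exact: continuous_subspaceT.
- split.
  + by move=> t _; case: (dG t).
  + exact: cvg_at_right_filter (Gc _).
  + exact: cvg_at_left_filter (Gc _).
- by move=> t _; rewrite derive1E derive_val.
Qed.

(* A parameter integral over the circle is constant as soon as its formal
   derivative integrates to zero. *)
Lemma cint_homotopy (phi psi : R -> R -> R) (u v M : R) : u < 0 -> 1 < v ->
  (forall s, s \in `]u, v[ -> cintegrable (phi s)) ->
  (forall s t, s \in `]u, v[ -> is_derive s 1 (phi ^~ t) (psi s t)) ->
  (forall s t, s \in `]u, v[ -> `|psi s t| <= M) ->
  (forall s, s \in `]0, 1[ -> cint (psi s) = 0) ->
  cint (phi 1) = cint (phi 0).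
Proof.
move=> u0 v1 iphi dphi bpsi zpsi.
pose F s := cint (phi s).
have M0 : 0 <= M by apply: le_trans (bpsi 0 0 _); rewrite ?in_itv/= ?normr_ge0 //; lra.
have iM : cintegrable (fun=> M) by apply: continuous_cintegrable; exact: cst_continuous.
have dF s : s \in `]u, v[ -> is_derive s 1 F (cint (psi s)).
  move=> sI.
  have h1 : forall x y, x \in `]u, v[ -> I2pi y -> derivable (phi ^~ y) x 1.
    by move=> x y xI _; case: (dphi x y xI).
  have h2 : forall x y, x \in `]u, v[ -> I2pi y -> `|partial1of2 phi x y| <= M.
    move=> x y xI _; rewrite partial1of2E.
    by have [_ ->] := dphi x y xI; exact: bpsi.
  apply: DeriveDef.
    by apply: (@derivable_under_integral _ _ _ mu phi I2pi _ s u v _ _ _ (fun=> M)).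
  rewrite -derive1E (@differentiation_under_integral _ _ _ mu phi I2pi _ s u v _ _ _ (fun=> M)) //.
  rewrite /cint; congr fine; apply: eq_integral => t _.
  by congr EFin; rewrite partial1of2E; have [_ ->] := dphi s t sI.
have sub s : s \in `[0, 1] -> s \in `]u, v[ by rewrite !in_itv /=; lra.
have Fd (s : R) : s \in `]0, 1[ -> is_derive s 1 F (cint (psi s)).
  by move=> sI; exact/dF/sub/subset_itv_oo_cc.
have Fc : {within `[0, 1], continuous F}.
  apply: derivable_within_continuous => s sI.
  by case: (dF s (sub s sI)).
(* The mean value theorem consults the derivative only inside []0, 1[]. This is why [zpsi] is asked
   only there: for the contraction used below it is obtained after dividing by [s]. *)
have [c cI] := @MVT R F (fun s => cint (psi s)) 0 1 ltr01 Fd Fc.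
by rewrite zpsi // mul0r => /eqP; rewrite subr_eq0 => /eqP.
Qed.

End CircleIntegrals.

Section CauchyFormula.
Context {R : realType}.
Local Notation C := (Cplx R).
Implicit Types (z w : C) (r s t e : R) (f g : C -> C).

Lemma path_deriv_continuous (p : R -> C) t d : path_deriv p t d -> {for t, continuous p}.
Proof.
move=> pd; apply: cvg_reim.
- have [+ _] := path_deriv_re pd.
  by move=> /derivable1_diffP /differentiable_continuous.
- have [+ _] := path_deriv_im pd.
  by move=> /derivable1_diffP /differentiable_continuous.
Qed.

Lemma path_deriv_mulr (p : R -> C) t d k : path_deriv p t d ->
  path_deriv (fun s => p s * k) t (d * k).
Proof.
move=> pd; rewrite /path_deriv.
rewrite (_ : (fun s => _) = (fun s => ofR s^-1 * (p (t + s) - p t) * k)).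
  exact: cvgM pd (cvg_cst k).
by apply/funext => s; ring.
Qed.

Lemma circle_point_continuous r : continuous (circle_point r : R -> C).
Proof. by move=> t; exact: (path_deriv_continuous (@path_deriv_circle R r t)). Qed.

Lemma circle_point_2pi r : circle_point r (2 * pi) = circle_point r 0.
Proof. by rewrite /circle_point mulr2n mulrDl mul1r cosDpi sinDpi cospi sinpi cos0 sin0 opprK oppr0. Qed.

Lemma disc_bound f r : 0 <= r -> (forall z, cmod z <= r -> {for z, continuous f}) ->
  exists M : R, forall z, cmod z <= r -> cmod (f z) <= M.
Proof.
move=> r0 fc.
have c0 : cmod (0 : C) <= r by rewrite cmod0.
have ne : [set z : C | cmod z <= r] !=set0 by exists (0 : C); exact: c0.
have cc : {within [set z : C | cmod z <= r], continuous (cmod \o f)}.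
  apply: continuous_in_subspaceT => z; rewrite inE /= => zr.
  exact: (continuous_comp (fc z zr) (@cmod_continuous R (f z))).
have [z zr zmax] := compact_EVT_max ne (@compact_disc R r) cc.
by exists (cmod (f z)) => w wr; apply: zmax; exact: mem_set.
Qed.

(* The loops [t |-> w + s (r e^it - w)] contract the circle to [w]; along them
   the [s]-derivative of [f] times the kernel is a [t]-derivative. *)
Lemma cauchy_contraction f r r' w : 0 < r -> r < r' -> cmod w < r ->
  (forall z, cmod z < r' -> holomorphic_at f z) ->
  let k t := circle_point r t / (circle_point r t - w) in
  cint (fun t => reC (f (circle_point r t) * k t)) = cint (fun t => reC (f w * k t)).
Proof.
move=> r0 rr' wr hf k; pose z t : C := circle_point r t.
have zr t : cmod (z t) = r by rewrite cmod_circle_point gtr0_norm.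
have zw t : z t - w != 0.
  by rewrite subr_eq0; apply/eqP => e; move: wr; rewrite -e zr ltxx.
pose p s t := w + ofR s * (z t - w).
(* For [s] in [](- d), (1 + d)[] one has [|1 - s| + |s| <= 1 + 2 d], and [(1 + 2 d) r] is the
   midpoint [r''] of [r] and [r']. *)
pose d := (r' - r) / (4 * r).
have d0 : 0 < d by rewrite divr_gt0 ?subr_gt0 // mulr_gt0.
have dr : d * (4 * r) = r' - r by rewrite divfK // mulf_neq0 ?gt_eqF.
pose r'' := (r + r') / 2.
have pr s t : s \in `](- d), (1 + d)[ -> cmod (p s t) <= r''.
  rewrite in_itv /= => /andP[s1 s2].
  have -> : p s t = ofR (1 - s) * w + ofR s * z t.
    by rewrite /p ofRD ofRN ofR1; ring.
  apply: le_trans (cmodD _ _) _; rewrite !cmodM !cmod_ofR zr /r''.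
  have hA : `|1 - s| * cmod w <= `|1 - s| * r by rewrite ler_wpM2l // ltW.
  suff hB : (`|1 - s| + `|s|) * r <= r + 2 * (d * r) by lra.
  apply: (@le_trans _ _ ((1 + 2 * d) * r)); last by lra.
  rewrite ler_wpM2r ?ltW //.
  by have [h1|h1] := leP 0 s; have [h2|h2] := leP 0 (1 - s);
    rewrite ?(ger0_norm h1) ?(ger0_norm h2) ?(ltr0_norm h1) ?(ltr0_norm h2); lra.
have hp s t : s \in `](- d), (1 + d)[ -> holomorphic_at f (p s t).
  move=> /pr pst; apply: hf; apply: le_lt_trans (pst t) _; rewrite /r''; lra.
have r''0 : 0 <= r'' by rewrite /r''; lra.
have [M HM] : exists M : R, forall z, cmod z <= r'' -> cmod ('D_1 f z) <= M.
  apply: disc_bound => // ζ ζr.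
  have := hf ζ; rewrite /holomorphic_at => /(_ _)/nbhs_singleton[] //.
  by apply: le_lt_trans ζr _; rewrite /r''; lra.
have zc : continuous z by exact: circle_point_continuous.
have pc s : continuous (p s).
  by move=> t; apply: cvgD; [exact: cvg_cst|apply: cvgM; [exact: cvg_cst|apply: cvgB; [exact: zc|exact: cvg_cst]]].
have kc : continuous k.
  move=> t; apply: cvgM; first exact: zc.
  by apply: cvgV => //; apply: cvgB; [exact: zc|exact: cvg_cst].
pose phi s t := reC (f (p s t) * k t).
pose psi s t := reC ('D_1 f (p s t) * z t).
have phic s : s \in `](- d), (1 + d)[ -> continuous (phi s).
  move=> sI t.
  have h : f (p s t) * k t @[t --> t] --> f (p s t) * k t.
    apply: cvgM (kc t).
    exact: (continuous_comp (pc s t) (holomorphic_continuous (hp s t sI))).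
  exact: cvg_comp _ _ h (@re_continuous R _).
have psic s : s \in `](- d), (1 + d)[ -> continuous (psi s).
  move=> sI t.
  have h : 'D_1 f (p s t) * z t @[t --> t] --> 'D_1 f (p s t) * z t.
    apply: cvgM (zc t).
    have := hp s t sI; rewrite /holomorphic_at => /nbhs_singleton [_ cD].
    exact: (continuous_comp (pc s t) cD).
  exact: cvg_comp _ _ h (@re_continuous R _).
have := @cint_homotopy R phi psi (- d) (1 + d) (M * r).
have -> : phi 1 = (fun t => reC (f (circle_point r t) * k t)).
  by apply/funext => t; rewrite /phi /p ofR1 mul1r addrC subrK.
have -> : phi 0 = (fun t => reC (f w * k t)).
  by apply/funext => t; rewrite /phi /p ofR0 mul0r addr0.
apply; [lra|lra|..].
- by move=> s sI; apply: continuous_cintegrable; exact: phic.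
- move=> s t sI.
  (* The factor [z t - w] from differentiating the path cancels the denominator of the kernel. *)
  have -> : psi s t = reC ('D_1 f (p s t) * (z t - w) * k t).
    by rewrite /psi /k -/(z t); congr reC; field.
  apply: path_deriv_re; apply: path_deriv_mulr.
  apply: (@path_deriv_comp R f (p^~ t)); last exact: path_deriv_line.
  exact: holomorphic_derivable (hp s t sI).
- move=> s t sI; apply: le_trans (re_le_cmod _) _; rewrite cmodM zr.
  by rewrite ler_pM2r //; exact: HM (pr s t sI).
- move=> s s01.
  have sI : s \in `](- d), (1 + d)[ by move: s01; rewrite !in_itv /=; lra.
  have s0 : s != 0 by move: s01; rewrite in_itv /=; lra.
  (* Since [z] has derivative [i z], the [t]-derivative of [f (p s t)] is [i s] times
     ['D_1 f (p s t) * z t]. Its imaginary part is [s * psi s t]. *)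
  have h : cint (fun t => s * psi s t) = 0.
    apply: (@cint_derive_periodic R (fun t => imC (f (p s t)))).
    + by move=> t; apply: cvgM; [exact: cvg_cst|exact: psic].
    + move=> t.
      have -> : s * psi s t = imC ('D_1 f (p s t) * (imag1 * z t * ofR s)).
        have -> : 'D_1 f (p s t) * (imag1 * z t * ofR s) = ofR s * (imag1 * ('D_1 f (p s t) * z t)).
          by ring.
        by rewrite imZ im_imag1M.
      apply: path_deriv_im; apply: (@path_deriv_comp R f (p s)).
        exact: holomorphic_derivable (hp s t sI).
      have h : path_deriv (fun t => (z t - w) * ofR s) t (imag1 * z t * ofR s).
        apply: path_deriv_mulr; apply/path_derivP => e e0.
        have /path_derivP /(_ e e0) := @path_deriv_circle R r t.
        by apply: filterS => u; rewrite [_ - w - _](_ : _ = z (t + u) - z t) //; ring.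
      apply/path_derivP => e e0; have /path_derivP /(_ e e0) := h.
      apply: filterS => u.
      by rewrite [_ - (z t - w) * ofR s](_ : _ = p s (t + u) - p s t) // /p; ring.
    + by rewrite /p /z circle_point_2pi.
  move: h; rewrite cintZ; last exact/continuous_cintegrable/psic.
  by move=> /eqP; rewrite mulf_eq0 (negbTE s0) => /eqP.
Qed.

End CauchyFormula.

Section Taylor.
Context {R : realType}.
Local Notation C := (Cplx R).
Implicit Types (z w : C) (r s t e : R) (f g : C -> C).

Lemma near_affine (a b z0 : C) (P : C -> Prop) :
  (\forall u \near a + b * z0, P u) -> \forall z \near z0, P (a + b * z).
Proof.
move=> /nbhs_cmodP [e e0 H].
(* The slope [b] may be 0, hence the added 1. *)
have b0 : 0 < cmod b + 1 by have := cmod_ge0 b; lra.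
apply/nbhs_cmodP; exists (e / (cmod b + 1)); first by rewrite divr_gt0.
move=> w; rewrite ltr_pdivlMr // => h; apply: H.
rewrite (_ : a + b * w - _ = b * (w - z0)); last by ring.
by rewrite cmodM; have := cmod_ge0 (w - z0); nra.
Qed.

Lemma holomorphic_affine f (a b : C) z0 : holomorphic_at f (a + b * z0) ->
  holomorphic_at (fun z => f (a + b * z)) z0.
Proof.
move=> /near_affine hf.
apply: (@holomorphic_of_derive _ _ (fun z => b * 'D_1 f (a + b * z))).
apply: filterS hf => z [df cf]; split.
  apply/is_deriveCP => e e0.
  have b0 : 0 < cmod b + 1 by have := cmod_ge0 b; lra.
  have e1 : 0 < e / (cmod b + 1) by rewrite divr_gt0.
  have /near_affine hw := (is_deriveCP _ _ _).1 (derivableP df) _ e1.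
  apply: filterS hw => w /= h.
  have -> : b * 'D_1 f (a + b * z) * (w - z) = 'D_1 f (a + b * z) * (a + b * w - (a + b * z)).
    by ring.
  apply: le_trans h _; rewrite (_ : a + b * w - _ = b * (w - z)); last by ring.
  rewrite cmodM mulrA ler_wpM2r ?cmod_ge0 // mulrAC ler_pdivrMr //.
  by rewrite ler_wpM2l ?ltW //; lra.
apply/(@cvg_cmodP _ _ (nbhs z) _) => e e0.
have b0 : 0 < cmod b + 1 by have := cmod_ge0 b; lra.
have e1 : 0 < e / (cmod b + 1) by rewrite divr_gt0.
have /near_affine hw := (@cvg_cmodP _ _ (nbhs (a + b * z)) (nbhs_filter _) _ _).1 cf _ e1.
apply: filterS hw => w; rewrite ltr_pdivlMr // => h.
by rewrite -mulrBr cmodM; have := cmod_ge0 ('D_1 f (a + b * w) - 'D_1 f (a + b * z)); nra.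
Qed.

(** For [w = 0] the kernel of [cauchy_contraction] is identically 1. *)
Lemma mean_value_re f r r' : 0 < r -> r < r' ->
  (forall z, cmod z < r' -> holomorphic_at f z) ->
  cint (fun t => reC (f (circle_point r t))) = 2 * pi * reC (f 0).
Proof.
move=> r0 rr' hf; have c0 : cmod (0 : C) < r by rewrite cmod0.
have := cauchy_contraction r0 rr' c0 hf.
have k1 t : circle_point r t / (circle_point r t - 0) = 1 :> C.
  by rewrite subr0 divff // -cmod_eq0 cmod_circle_point normr_eq0 gt_eqF.
rewrite /=; under eq_fun do rewrite k1 mulr1.
by move=> ->; under eq_fun do rewrite k1 mulr1; rewrite cint_cst.
Qed.

Lemma mean_value_im f r r' : 0 < r -> r < r' ->
  (forall z, cmod z < r' -> holomorphic_at f z) ->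
  cint (fun t => imC (f (circle_point r t))) = 2 * pi * imC (f 0).
Proof.
move=> r0 rr' hf.
have reNi z : reC (- imag1 * z) = imC z by rewrite mulNr reN re_imag1M opprK.
have -> : (fun t => imC (f (circle_point r t))) = (fun t => reC (- imag1 * f (circle_point r t))).
  by apply/funext => t; rewrite reNi.
rewrite -reNi; apply: (@mean_value_re (fun z => - imag1 * f z) r r' r0 rr') => z zr.
exact: (holomorphicM (holomorphic_cst _ _) (hf z zr)).
Qed.

Definition conj (z : C) : C := (reC z -i* imC z)%C.

Lemma conjM z w : conj (z * w) = conj z * conj w.
Proof. by apply: reim_eq => /=; rewrite ?reM ?imM /=; ring. Qed.
Lemma conjB z w : conj (z - w) = conj z - conj w.
Proof. by apply: reim_eq => /=; rewrite ?reD ?imD ?reN ?imN /=; ring. Qed.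
Lemma conj1 : conj 1 = 1.
Proof. by apply: reim_eq; rewrite /= ?oppr0. Qed.
Lemma conjV z : conj z^-1 = (conj z)^-1.
Proof.
have [->|z0] := eqVneq z 0; first by rewrite invr0; apply: reim_eq; rewrite /= ?mul0r ?oppr0 ?mul0r ?oppr0.
have h : conj z^-1 * conj z = 1 by rewrite -conjM mulVf // conj1.
have c0 : conj z != 0.
  by apply/eqP => e; move: h; rewrite e mulr0 => /eqP; rewrite eq_sym oner_eq0.
by rewrite -[LHS]mulr1 -(mulfV c0) mulrA h mul1r.
Qed.
Lemma conjK z : conj (conj z) = z.
Proof. by apply: reim_eq => //=; rewrite opprK. Qed.
Lemma mul_conj z : z * conj z = ofR (cmod z ^+ 2).
Proof. by apply: reim_eq; rewrite ?reM ?imM /= ?cmod_sqr; ring. Qed.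
Lemma cmod_conj z : cmod (conj z) = cmod z.
Proof. by apply/eqP; rewrite -(@eqrXn2 _ 2) ?cmod_ge0 // !cmod_sqr /= sqrrN. Qed.

Lemma circle_continuous (T : topologicalType) (f : C -> T) r : 0 <= r ->
  (forall z, cmod z = r -> {for z, continuous f}) ->
  continuous (fun t => f (circle_point r t)).
Proof.
move=> r0 fc t; apply: (continuous_comp (@circle_point_continuous R r t)).
by apply: fc; rewrite cmod_circle_point ger0_norm.
Qed.

Lemma circle_im_continuous f r : 0 <= r ->
  (forall z, cmod z = r -> {for z, continuous f}) ->
  continuous (fun t => imC (f (circle_point r t))).
Proof.
move=> r0 fc; apply: (@circle_continuous _ (fun z => imC (f z))) => // z zr.
exact: continuous_comp (fc z zr) (@im_continuous R (f z)).
Qed.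

(** On the circle [conj z = r^2 / z], so the kernel is the conjugate of [g z], where [g] has its
    only possible pole outside the disc and [g 0 = 1]. The mean value property of [g] therefore
    evaluates both integrals. *)
Lemma cint_cauchy_kernel r w : 0 < r -> cmod w < r ->
  let k t := circle_point r t / (circle_point r t - w) in
  cint (fun t => reC (k t)) = 2 * pi /\ cint (fun t => imC (k t)) = 0.
Proof.
move=> r0 wr k; pose g ζ := (1 - ofR (r ^+ 2)^-1 * conj w * ζ)^-1.
have w0 := cmod_ge0 w.
(* A radius strictly between [r] and the distance [r^2 / |w|] of the pole of [g], written so that it
   also makes sense for [w = 0]. *)
pose r' := 2 * r ^+ 2 / (r + cmod w).
have rw : 0 < r + cmod w by lra.
have rr' : r < r' by rewrite /r' ltr_pdivlMr //; nra.
have hg ζ : cmod ζ < r' -> holomorphic_at g ζ.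
  move=> ζr; apply: holomorphicV.
    apply: holomorphicB; first exact: holomorphic_cst.
    exact: (holomorphicM (holomorphic_cst _ _) (holomorphic_id _)).
  rewrite subr_eq0; apply/eqP => /(congr1 (@cmod R)).
  rewrite cmod1 !cmodM cmod_ofR cmod_conj gtr0_norm ?invr_gt0 ?exprn_gt0 //.
  have h : cmod w * cmod ζ < r ^+ 2.
    apply: (@le_lt_trans _ _ (cmod w * r')); first by rewrite ler_wpM2l // ltW.
    rewrite /r' mulrA ltr_pdivrMr //.
    rewrite mulrCA !mulrA.
    have : cmod w * r ^+ 2 < r * r ^+ 2 by rewrite ltr_pM2r ?exprn_gt0.
    lra.
  have r20 : r ^+ 2 != 0 by rewrite gt_eqF ?exprn_gt0.
  move=> /(congr1 (fun x => r ^+ 2 * x)).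
  by rewrite mulr1 -mulrA mulVKf //; lra.
have kg t : k t = conj (g (circle_point r t)).
  rewrite /k /g; set z := circle_point r t.
  have zr : cmod z = r by rewrite cmod_circle_point gtr0_norm.
  have z0 : z != 0 by rewrite -cmod_eq0 zr gt_eqF.
  have zw : z - w != 0.
    by rewrite subr_eq0; apply/eqP => e; move: wr; rewrite -e zr ltxx.
  have hc : ofR (r ^+ 2)^-1 = (conj z)^-1 / z.
    by rewrite ofRV -zr -mul_conj invfM mulrC.
  rewrite conjV conjB conj1 !conjM conjK hc conjM !conjV conjK.
  have cz0 : conj z != 0 by rewrite -cmod_eq0 cmod_conj zr gt_eqF.
  by field; rewrite cz0 z0 zw.
split.
- under eq_fun do rewrite kg.
  have -> : (fun t => reC (conj (g (circle_point r t)))) = (fun t => reC (g (circle_point r t))).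
    by [].
  by rewrite (mean_value_re r0 rr' hg) /g mulr0 subr0 invr1 mulr1.
- under eq_fun do rewrite kg.
  have -> : (fun t => imC (conj (g (circle_point r t)))) = (fun t => -1 * imC (g (circle_point r t))).
    by apply/funext => t; rewrite mulN1r.
  rewrite cintZ; last first.
    apply: continuous_cintegrable; apply: circle_im_continuous; [exact: ltW|move=> z zr].
    by apply/holomorphic_continuous/hg; rewrite zr.
  by rewrite (mean_value_im r0 rr' hg) /g mulr0 subr0 invr1 /= mulr0 mulr0.
Qed.

Definition ccint (h : R -> C) : C := (cint (fun t => reC (h t)) +i* cint (fun t => imC (h t)))%C.

Definition ccontinuous (h : R -> C) := forall t, {for t, continuous h}.

(** Contraction replaces [f] under the integral by the constant [f w], and the kernel alone has a
    known integral. The imaginary part is the real part for [- imag1 * f]. *)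
Lemma cauchy_formula f r r' w : 0 < r -> r < r' -> cmod w < r ->
  (forall z, cmod z < r' -> holomorphic_at f z) ->
  ccint (fun t => f (circle_point r t) * (circle_point r t / (circle_point r t - w)))
  = ofR (2 * pi) * f w.
Proof.
move=> r0 rr' wr hf.
pose k t : C := circle_point r t / (circle_point r t - w).
have [kr ki] := cint_cauchy_kernel r0 wr.
have kc t : {for t, continuous k}.
  have zc := @circle_point_continuous R r t.
  apply: cvgM; first exact: zc.
  apply: cvgV; last by apply: cvgB; [exact: zc|exact: cvg_cst].
  rewrite subr_eq0; apply/eqP => e.
  by move: wr; rewrite -e cmod_circle_point gtr0_norm // ltxx.
have krc : cintegrable (fun t => reC (k t)).
  by apply: continuous_cintegrable => t; apply: (continuous_comp (kc t)); exact: re_continuous.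
have kic : cintegrable (fun t => imC (k t)).
  by apply: continuous_cintegrable => t; apply: (continuous_comp (kc t)); exact: im_continuous.
have main g : (forall z, cmod z < r' -> holomorphic_at g z) ->
    cint (fun t => reC (g (circle_point r t) * k t)) = 2 * pi * reC (g w).
  move=> hg; rewrite (cauchy_contraction r0 rr' wr hg).
  rewrite (_ : (fun t => _) = (fun t => reC (g w) * reC (k t) + - imC (g w) * imC (k t))).
    rewrite cintD; try exact: cintegrableZ.
    by rewrite !cintZ // kr ki; ring.
  by apply/funext => t; rewrite -/(k t) reM; ring.
apply: reim_eq.
- by rewrite reZ; exact: main.
- rewrite imZ.
  have reNi z : reC (- imag1 * z) = imC z by rewrite mulNr reN re_imag1M opprK.
  have hNf z : cmod z < r' -> holomorphic_at (fun z => - imag1 * f z) z.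
    by move=> zr; exact: (holomorphicM (holomorphic_cst _ _) (hf z zr)).
  rewrite -[imC (f w)]reNi; apply: etrans (main _ hNf).
  by congr cint; apply/funext => t; rewrite -mulrA reNi.
Qed.

End Taylor.

Section TaylorSeries.
Context {R : realType}.
Local Notation C := (Cplx R).
Implicit Types (z w : C) (r s t e : R) (f g : C -> C).

Lemma ccontinuousM (h1 h2 : R -> C) : ccontinuous h1 -> ccontinuous h2 ->
  ccontinuous (fun t => h1 t * h2 t).
Proof. by move=> c1 c2 t; exact: cvgM (c1 t) (c2 t). Qed.

Lemma ccontinuousD (h1 h2 : R -> C) : ccontinuous h1 -> ccontinuous h2 ->
  ccontinuous (fun t => h1 t + h2 t).
Proof. by move=> c1 c2 t; exact: cvgD (c1 t) (c2 t). Qed.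

Lemma ccontinuousV (h : R -> C) : ccontinuous h -> (forall t, h t != 0) ->
  ccontinuous (fun t => (h t)^-1).
Proof. by move=> c0 h0 t; exact: cvgV (h0 t) (c0 t). Qed.

Lemma ccontinuous_cst (c : C) : ccontinuous (fun=> c).
Proof. by move=> t; exact: cvg_cst. Qed.

Lemma ccontinuousX (h : R -> C) n : ccontinuous h -> ccontinuous (fun t => h t ^+ n).
Proof.
move=> hc; elim: n => [|n IH]; first exact: ccontinuous_cst.
by under eq_fun do rewrite exprS; exact: (ccontinuousM hc IH).
Qed.

Lemma ccontinuous_circle r : ccontinuous (circle_point r).
Proof. exact: circle_point_continuous. Qed.

Lemma ccontinuous_re_integrable (h : R -> C) : ccontinuous h -> cintegrable (fun t => reC (h t)).
Proof.
by move=> hc; apply: continuous_cintegrable => t;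
  apply: (continuous_comp (hc t)); exact: re_continuous.
Qed.

Lemma ccontinuous_im_integrable (h : R -> C) : ccontinuous h -> cintegrable (fun t => imC (h t)).
Proof.
by move=> hc; apply: continuous_cintegrable => t;
  apply: (continuous_comp (hc t)); exact: im_continuous.
Qed.

Lemma ccintD (h1 h2 : R -> C) : ccontinuous h1 -> ccontinuous h2 ->
  ccint (fun t => h1 t + h2 t) = ccint h1 + ccint h2.
Proof.
move=> c1 c2; apply: reim_eq; rewrite ?reD ?imD /=.
  rewrite -cintD; [|exact: ccontinuous_re_integrable..].
  by congr cint; apply/funext => t; rewrite reD.
rewrite -cintD; [|exact: ccontinuous_im_integrable..].
by congr cint; apply/funext => t; rewrite imD.
Qed.

Lemma ccintZ (h : R -> C) (c : C) : ccontinuous h ->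
  ccint (fun t => h t * c) = ccint h * c.
Proof.
move=> hc; have hr := ccontinuous_re_integrable hc; have hi := ccontinuous_im_integrable hc.
apply: reim_eq; rewrite ?reM ?imM /=.
  rewrite (_ : (fun t => _) = (fun t => reC c * reC (h t) + - imC c * imC (h t))).
    by rewrite cintD ?cintZ //; [ring|exact: cintegrableZ..].
  by apply/funext => t; rewrite reM; ring.
rewrite (_ : (fun t => _) = (fun t => reC c * imC (h t) + imC c * reC (h t))).
  by rewrite cintD ?cintZ //; [ring|exact: cintegrableZ..].
by apply/funext => t; rewrite imM; ring.
Qed.

Lemma ccontinuous_sum (n : nat) (h : nat -> R -> C) : (forall k, ccontinuous (h k)) ->
  ccontinuous (fun t => \sum_(0 <= k < n) h k t).
Proof.
move=> hc; elim: n => [|m IHm].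
  rewrite (_ : (fun t => _) = (fun=> 0)); first exact: ccontinuous_cst.
  by apply/funext => t; rewrite big_geq.
rewrite (_ : (fun t => _) = (fun t => \sum_(0 <= k < m) h k t + h m t)).
  exact: (ccontinuousD IHm (hc m)).
by apply/funext => t; rewrite big_nat_recr.
Qed.

Lemma ccint_sum (n : nat) (h : nat -> R -> C) : (forall k, ccontinuous (h k)) ->
  ccint (fun t => \sum_(0 <= k < n) h k t) = \sum_(0 <= k < n) ccint (h k).
Proof.
move=> hc; elim: n => [|n IH].
  rewrite big_geq //; under eq_fun do rewrite big_geq //.
  by apply: reim_eq => /=; rewrite cint_cst mulr0.
rewrite big_nat_recr //= -IH -(ccintD (@ccontinuous_sum n _ hc) (hc n)).
by congr ccint; apply/funext => t; rewrite big_nat_recr.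
Qed.

Lemma cint_bound (h : R -> R) (M : R) : cintegrable h -> (forall t, `|h t| <= M) ->
  `|cint h| <= 2 * pi * M.
Proof.
move=> ih hM; rewrite /cint; apply: le_trans (le_normr_Rintegral _ ih) _ => //.
rewrite -cint_cst; apply: le_Rintegral => //.
- by move/integrable_norm : ih.
- by apply: continuous_cintegrable; exact: cst_continuous.
Qed.

(** Bounding real and imaginary parts separately costs a factor 2, harmless where only convergence
    to 0 is at stake. *)
Lemma ccint_bound (h : R -> C) (M : R) : ccontinuous h -> (forall t, cmod (h t) <= M) ->
  cmod (ccint h) <= 4 * pi * M.
Proof.
move=> hc hM; apply: le_trans (cmod_le_reim _) _ => /=.
have h1 := cint_bound (ccontinuous_re_integrable hc) (fun t => le_trans (re_le_cmod _) (hM t)).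
have h2 := cint_bound (ccontinuous_im_integrable hc) (fun t => le_trans (im_le_cmod _) (hM t)).
lra.
Qed.

(** The Cauchy kernel is expanded into a finite geometric sum with its exact remainder. Only finite
    sums are integrated, so no limit has to be exchanged with the integral. *)
Lemma taylor_disc f r r' : 0 < r -> r < r' ->
  (forall z, cmod z < r' -> holomorphic_at f z) ->
  exists c : nat -> C, forall w, cmod w < r ->
    series (fun k => c k * w ^+ k) n @[n --> \oo] --> f w.
Proof.
move=> r0 rr' hf; pose z t : C := circle_point r t.
have zr t : cmod (z t) = r by rewrite cmod_circle_point gtr0_norm.
have z0 t : z t != 0 by rewrite -cmod_eq0 zr gt_eqF.
have zc : ccontinuous z by exact: ccontinuous_circle.
have fc : ccontinuous (fun t => f (z t)).
  apply: circle_continuous; first exact: ltW.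
  by move=> ζ ζr; apply/holomorphic_continuous/hf; rewrite ζr.
have pi0 : (2 * pi : R) != 0 by rewrite gt_eqF // twopi_gt0.
have opi0 : ofR (2 * pi) != 0 :> C by rewrite -cmod_eq0 cmod_ofR normr_eq0.
pose c k := (ofR (2 * pi))^-1 * ccint (fun t => f (z t) * ((z t)^-1) ^+ k).
exists c => w wr.
have zw t : z t - w != 0.
  by rewrite subr_eq0; apply/eqP => e; move: wr; rewrite -e zr ltxx.
pose K t := f (z t) * (z t / (z t - w)).
have kc : ccontinuous (fun t => z t / (z t - w)).
  have c1 : ccontinuous (fun t => z t - w) := ccontinuousD zc (@ccontinuous_cst (- w)).
  have c2 : ccontinuous (fun t => (z t - w)^-1) := ccontinuousV c1 zw.
  exact: (ccontinuousM zc c2).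
have Kc : ccontinuous K by exact: (ccontinuousM fc kc).
have zVc : ccontinuous (fun t => (z t)^-1) by exact: (ccontinuousV zc z0).
have wzc : ccontinuous (fun t => w / z t).
  exact: (ccontinuousM (@ccontinuous_cst w) zVc).
have Kf : ccint K = ofR (2 * pi) * f w by exact: (cauchy_formula r0 rr' wr hf).
have geo n t : K t = \sum_(0 <= k < n) f (z t) * (z t)^-1 ^+ k * w ^+ k + K t * (w / z t) ^+ n.
  elim: n => [|n IH]; first by rewrite big_geq // expr0 mulr1 add0r.
  rewrite {1}IH big_nat_recr //= -addrA; congr (_ + _).
  have -> : f (z t) * (z t)^-1 ^+ n * w ^+ n = f (z t) * (w / z t) ^+ n.
    by rewrite exprMn; ring.
  rewrite exprS /K; move: ((w / z t) ^+ n) => W.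
  by field; rewrite z0 zw.
have Kwc n : ccontinuous (fun t => K t * (w / z t) ^+ n).
  exact: (ccontinuousM Kc (@ccontinuousX _ n wzc)).
have rem n : series (fun k => c k * w ^+ k) n - f w
    = - ((ofR (2 * pi))^-1 * ccint (fun t => K t * (w / z t) ^+ n)).
  have -> : f w = (ofR (2 * pi))^-1 * ccint K by rewrite Kf mulKf.
  have cc k : ccontinuous (fun t => f (z t) * (z t)^-1 ^+ k).
    exact: (ccontinuousM fc (@ccontinuousX _ k zVc)).
  have -> : ccint K = \sum_(0 <= k < n) ccint (fun t => f (z t) * (z t)^-1 ^+ k * w ^+ k)
        + ccint (fun t => K t * (w / z t) ^+ n).
    have ccw k : ccontinuous (fun t => f (z t) * (z t)^-1 ^+ k * w ^+ k).
      exact: (ccontinuousM (cc k) (@ccontinuous_cst (w ^+ k))).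
    rewrite -(@ccint_sum n _ ccw) -(ccintD (@ccontinuous_sum n _ ccw) (Kwc n)).
    by congr ccint; apply/funext => t; exact: geo.
  rewrite mulrDr mulr_sumr /series /= opprD addrA.
  rewrite (_ : \sum_(0 <= k < n) c k * w ^+ k = \sum_(0 <= k < n) (ofR (2 * pi))^-1 * ccint (fun t => f (z t) * (z t)^-1 ^+ k * w ^+ k)).
    by rewrite subrr sub0r.
  by apply: eq_bigr => k _; rewrite (ccintZ _ (cc k)) /c mulrA.
have [M HM] : exists M, forall ζ, cmod ζ <= r -> cmod (f ζ) <= M.
  apply: disc_bound; first exact: ltW.
  by move=> ζ ζr; apply/holomorphic_continuous/hf; exact: le_lt_trans rr'.
pose q := cmod w / r.
have q1 : `|q| < 1.
  by rewrite ger0_norm ?divr_ge0 ?cmod_ge0 ?ltW // ltr_pdivrMr // mul1r.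
have M0 : 0 <= M by apply: le_trans (cmod_ge0 (f 0)) (HM _ _); rewrite cmod0 ltW.
(* The 2 is [4 * pi] from [ccint_bound] over the normalising [2 * pi]; the other factor bounds [K],
   as [|z t - w| >= r - |w|]. *)
pose B := 2 * (M * (r / (r - cmod w))).
have bnd n : cmod (series (fun k => c k * w ^+ k) n - f w) <= B * q ^+ n.
  rewrite rem cmodN cmodM cmodV cmod_ofR gtr0_norm ?twopi_gt0 //.
  have h : cmod (ccint (fun t => K t * (w / z t) ^+ n)) <=
      4 * pi * ((M * (r / (r - cmod w))) * q ^+ n).
    apply: (ccint_bound (Kwc n)) => t; rewrite cmodM cmodX cmodM cmodV zr -/q ler_wpM2r //.
      by rewrite exprn_ge0 // divr_ge0 ?cmod_ge0 ?ltW.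
    rewrite /K cmodM; apply: ler_pM; rewrite ?cmod_ge0 //.
      by apply: HM; rewrite zr.
    rewrite cmodM cmodV zr ler_pM2l // lef_pV2 ?posrE ?cmod_gt0 ?subr_gt0 //.
    by have := cmodD (z t - w) w; rewrite subrK zr; lra.
  rewrite mulrC ler_pdivrMr ?twopi_gt0 //; apply: le_trans h _.
  by rewrite /B le_eqVlt; apply/orP; left; apply/eqP; ring.
apply/cvg_cmodP => e e0.
have qn : B * q ^+ n @[n --> \oo] --> B * 0 by apply: cvgM; [exact: cvg_cst|exact: cvg_expr].
rewrite mulr0 in qn.
near=> n; apply: le_lt_trans (bnd n) _.
apply: le_lt_trans (ler_norm _) _.
by near: n; move/cvgr0_norm_lt : qn; apply.
Unshelve. all: end_near. Qed.

Lemma analytic_of_holomorphic f z0 : holomorphic_at f z0 -> analytic_at f z0.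
Proof.
move=> /holomorphic_at_near /nbhs_cmodP [e e0 H].
have e1 : 0 < e / 2 by lra.
have e2 : e / 2 < e by lra.
have h z : cmod z < e -> holomorphic_at (fun z => f (z0 + 1 * z)) z.
  by move=> ze; apply: holomorphic_affine; apply: H; rewrite mul1r addrC addKr.
have [c Hc] := taylor_disc e1 e2 h.
exists c; apply/nbhs_cmodP; exists (e / 2) => //.
by move=> w; rewrite subr0 => /Hc; rewrite mul1r.
Qed.

End TaylorSeries.

(** * Termwise differentiation of power series *)

Section PowerSeries.
Context {R : realType}.
Local Notation C := (Cplx R).
Implicit Types (z w v : C) (r s t e : R) (f g : C -> C).

Lemma re_series (u : nat -> C) n : reC (series u n) = series (fun k => reC (u k)) n.
Proof.
rewrite /series /=; elim: n => [|n IH]; first by rewrite !big_geq.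
by rewrite !big_nat_recr //= reD IH.
Qed.

Lemma im_series (u : nat -> C) n : imC (series u n) = series (fun k => imC (u k)) n.
Proof.
rewrite /series /=; elim: n => [|n IH]; first by rewrite !big_geq.
by rewrite !big_nat_recr //= imD IH.
Qed.

Lemma cvg_series_geometric (x : nat -> R) (A q : R) : 0 <= q < 1 ->
  (forall k, `|x k| <= A * q ^+ k) -> cvgn (series x).
Proof.
move=> /andP[q0 q1] H; apply: normed_cvg.
apply: (series_le_cvg _ _ H); first by move=> k; exact: normr_ge0.
- by move=> k; exact: le_trans (normr_ge0 _) (H k).
- by apply: is_cvg_geometric_series; rewrite ger0_norm.
Qed.

Lemma ccvg_series_geometric (u : nat -> C) (A q : R) : 0 <= q < 1 ->
  (forall k, cmod (u k) <= A * q ^+ k) -> exists l : C, series u n @[n --> \oo] --> l.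
Proof.
move=> q01 H.
have hr := cvg_series_geometric q01 (fun k => le_trans (re_le_cmod _) (H k)).
have hi := cvg_series_geometric q01 (fun k => le_trans (im_le_cmod _) (H k)).
exists (limn (series (fun k => reC (u k))) +i* limn (series (fun k => imC (u k))))%C.
apply: cvg_reim => /=.
- by under eq_fun do rewrite re_series; exact: hr.
- by under eq_fun do rewrite im_series; exact: hi.
Qed.

Lemma cvg_series_bounded (u : nat -> C) (l : C) : series u n @[n --> \oo] --> l ->
  exists A : R, forall k, cmod (u k) <= A.
Proof.
move=> /cvg_cmodP /(_ 1 ltr01) [N _ HN].
exists (2 + \sum_(0 <= k < N) cmod (u k)) => k /=.
have S0 : 0 <= \sum_(0 <= k < N) cmod (u k) by apply: sumr_ge0 => i _; exact: cmod_ge0.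
have [kN|Nk] := ltnP k N.
  apply: (@le_trans _ _ (\sum_(0 <= k < N) cmod (u k))); last by rewrite lerDr.
  by rewrite big_mkord (bigD1 (Ordinal kN)) //= lerDl; apply: sumr_ge0 => i _; exact: cmod_ge0.
have h1 := HN _ Nk; have h2 := HN k.+1 (leqW Nk).
have -> : u k = (series u k.+1 - l) - (series u k - l).
  by rewrite /series /= big_nat_recr //=; ring.
apply: le_trans (cmodD _ _) _; rewrite cmodN; move: h1 h2 => /=; lra.
Qed.

(** The second order remainder [E_k] of the power satisfies [E_(k+1) = v E_k + k w^(k-1) (v - w)^2],
    and [k^2 + k <= (k + 1)^2] closes the induction. The factor [rho ^+ 2] on the left avoids the
    exponent [k - 2] on the right. *)
Lemma power_taylor1 v w (rho : R) k : 0 <= rho -> cmod v <= rho -> cmod w <= rho ->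
  rho ^+ 2 * cmod (v ^+ k - w ^+ k - k%:R * w ^+ k.-1 * (v - w))
    <= k%:R ^+ 2 * rho ^+ k * cmod (v - w) ^+ 2.
Proof.
move=> r0 vr wr; elim: k => [|k IH].
  by rewrite !expr0 subrr mul0r mul0r subrr cmod0 mulr0 expr0n !mul0r.
have -> : v ^+ k.+1 - w ^+ k.+1 - k.+1%:R * w ^+ k.+1.-1 * (v - w)
   = v * (v ^+ k - w ^+ k - k%:R * w ^+ k.-1 * (v - w)) + k%:R * w ^+ k.-1 * ((v - w) * (v - w)).
  case: k {IH} => [|k] /=; first by rewrite !expr0 !expr1; ring.
  by rewrite !exprS -!natr1; ring.
set E := _ - _ - _ in IH *.
have e0 := cmod_ge0 E.
apply: (@le_trans _ _ (rho ^+ 2 * (rho * cmod E) + rho ^+ 2 * (k%:R * rho ^+ k.-1 * cmod (v - w) ^+ 2))).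
  rewrite -mulrDr ler_wpM2l ?exprn_ge0 //.
  apply: le_trans (cmodD _ _) _; rewrite lerD //.
    by rewrite cmodM ler_wpM2r.
  rewrite !cmodM !cmodX -expr2 ler_wpM2r ?sqr_ge0 // (_ : k%:R = ofR k%:R) ?cmod_ofR ?ger0_norm //; last by rewrite /ofR rmorph_nat.
  by rewrite ler_wpM2l // lerXn2r ?nnegrE ?cmod_ge0.
move: IH (sqr_ge0 (cmod (v - w))); move: (cmod E) (cmod (v - w) ^+ 2) => e d IH d0.
have h1 : rho * (rho ^+ 2 * e) <= rho * (k%:R ^+ 2 * rho ^+ k * d) by rewrite ler_wpM2l.
have h2 : rho ^+ 2 * (k%:R * rho ^+ k.-1 * d) = k%:R * (rho ^+ k.+1 * d).
  case: k {E e0 IH h1} => [|k] /=; first by rewrite mulr0n !mul0r mulr0.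
  by rewrite !exprS; ring.
have h3 : 0 <= rho ^+ k.+1 * d by rewrite mulr_ge0 // exprn_ge0.
have h4 : rho * (k%:R ^+ 2 * rho ^+ k * d) = k%:R ^+ 2 * (rho ^+ k.+1 * d).
  by rewrite [rho ^+ k.+1]exprS; ring.
rewrite h2 -natr1; have := ler0n R k; nra.
Qed.

Lemma sqr_le_exp4 k : k%:R ^+ 2 <= 4 ^+ k :> R.
Proof.
elim: k => [|[|k] IH]; first by rewrite expr0n expr0 ler01.
  by rewrite expr1n expr1; lra.
rewrite exprS; apply: le_trans (ler_wpM2l _ IH) => //.
by rewrite -!natr1; have := ler0n R k; nra.
Qed.

Lemma le_lim_cmod (u : nat -> C) l (B : R) : u n @[n --> \oo] --> l ->
  (forall n, cmod (u n) <= B) -> cmod l <= B.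
Proof.
move=> /cvg_cmodP ul uB; apply/ler_addgt0Pl => e e0.
have [N _ HN] := ul e e0.
have := HN N (leqnn N); have := uB N; have := cmodD (u N) (l - u N).
by rewrite addrC subrK /= [cmod (l - _)]cmodB; lra.
Qed.

(** Summing the remainders of [power_taylor1] bounds the error of the linear approximation by a
    constant times [|v - w|^2]. A disc smaller than the given one suffices, since analyticity is
    local. *)
Lemma power_series_derive (c : nat -> C) g (r : R) : 0 < r ->
  (forall w, cmod w < r -> series (fun k => c k * w ^+ k) n @[n --> \oo] --> g w) ->
  exists (D : C -> C) (rho : R), 0 < rho /\ forall w, cmod w < rho ->
    is_derive w (1 : C) g (D w) /\
    series (fun k => (k.+1%:R * c k.+1) * w ^+ k) n @[n --> \oo] --> D w.
Proof.
move=> r0 Hg.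
(* Convergence at [r1] bounds [|c k| r1^k], so [|c k| rho^k] decays like [8^-k]; this absorbs
   [k^2 <= 4^k] and still leaves [2^-k]. *)
pose r1 := r / 2; pose rho := r1 / 8.
have r10 : 0 < r1 by rewrite /r1; lra.
have rho0 : 0 < rho by rewrite /rho; lra.
have [A HA] : exists A, forall k, cmod (c k) * r1 ^+ k <= A.
  have /Hg /cvg_series_bounded [A HA] : cmod (ofR r1) < r.
    by rewrite cmod_ofR gtr0_norm /r1; lra.
  by exists A => k; have := HA k; rewrite cmodM cmodX cmod_ofR gtr0_norm.
have A0 : 0 <= A by apply: le_trans (HA 0%N); rewrite mulr_ge0 ?cmod_ge0 // exprn_ge0 // ltW.
have cb k : cmod (c k) * rho ^+ k <= A * 8^-1 ^+ k.
  rewrite /rho exprMn mulrA; apply: ler_wpM2r; last exact: HA.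
  by rewrite exprn_ge0.
have hk k : k%:R ^+ 2 * (cmod (c k) * rho ^+ k) <= A * (1 / 2) ^+ k.
  apply: (@le_trans _ _ (4 ^+ k * (A * 8^-1 ^+ k))).
    apply: ler_pM; rewrite ?sqr_ge0 ?sqr_le_exp4 //.
    by rewrite mulr_ge0 ?cmod_ge0 // exprn_ge0 // ltW.
  by rewrite mulrCA -exprMn (_ : 4 * 8^-1 = 1 / 2 :> R) //; lra.
have q2 : 0 <= (1 / 2 : R) < 1 by lra.
have DA w : exists l : C, cmod w < rho ->
    series (fun k => (k.+1%:R * c k.+1) * w ^+ k) n @[n --> \oo] --> l.
  have [wr|] := pselect (cmod w < rho); last by exists 0.
  have [|l Hl] := @ccvg_series_geometric (fun k => (k.+1%:R * c k.+1) * w ^+ k) (A / rho) (1 / 2) q2.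
    move=> k; rewrite !cmodM cmodX (_ : k.+1%:R = ofR k.+1%:R); last by rewrite /ofR rmorph_nat.
    rewrite cmod_ofR ger0_norm // [leRHS]mulrAC ler_pdivlMr //.
    apply: le_trans (le_trans (hk k.+1) _); last first.
      by rewrite exprS; have := exprn_ge0 k (_ : 0 <= 1 / 2 :> R); nra.
    have h1 : cmod w ^+ k * rho <= rho ^+ k.+1.
      rewrite exprSr; apply: ler_wpM2r; first exact: ltW.
      by rewrite lerXn2r ?nnegrE ?cmod_ge0 // ltW.
    have h2 : k.+1%:R <= k.+1%:R ^+ 2 :> R by rewrite expr2 ler_pMr ?ltr0n // ler1n.
    have h3 : 0 <= cmod w ^+ k * rho by rewrite mulr_ge0 ?exprn_ge0 ?cmod_ge0 // ltW.
    have h5 := (ler_pM (ler0n R _) (mulr_ge0 (cmod_ge0 _) h3) h2 (ler_wpM2l (cmod_ge0 (c k.+1)) h1)).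
    by move: h5; rewrite !mulrA.
  by exists l.
pose D w := projT1 (cid (DA w)).
have DP w : cmod w < rho -> series (fun k => (k.+1%:R * c k.+1) * w ^+ k) n @[n --> \oo] --> D w.
  exact: projT2 (cid (DA w)).
pose B := 2 * A / rho ^+ 2.
exists D, rho; split => // w wr; split; last exact: DP.
have key v : cmod v < rho -> cmod (g v - g w - D w * (v - w)) <= B * cmod (v - w) ^+ 2.
  move=> vr.
  (* The derived series has lost the constant term: its [n] terms correspond to [n.+1] terms of the
     original. *)
  have gv : series (fun k => c k * v ^+ k) n.+1 @[n --> \oo] --> g v.
    by rewrite (cvg_shiftS (series _)); apply: Hg; move: vr; rewrite /rho /r1; lra.
  have gw : series (fun k => c k * w ^+ k) n.+1 @[n --> \oo] --> g w.
    by rewrite (cvg_shiftS (series _)); apply: Hg; move: wr; rewrite /rho /r1; lra.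
  have h : (series (fun k => c k * v ^+ k) n.+1 - series (fun k => c k * w ^+ k) n.+1
      - series (fun k => (k.+1%:R * c k.+1) * w ^+ k) n * (v - w)) @[n --> \oo]
      --> g v - g w - D w * (v - w).
    exact: cvgB (cvgB gv gw) (cvgM (DP w wr) (cvg_cst (v - w))).
  apply: (le_lim_cmod h) => n.
  set X := (X in cmod X).
  have -> : X = \sum_(0 <= k < n.+1) c k * (v ^+ k - w ^+ k - k%:R * w ^+ k.-1 * (v - w)).
    have -> : \sum_(0 <= k < n.+1) c k * (v ^+ k - w ^+ k - k%:R * w ^+ k.-1 * (v - w)) =
      \sum_(0 <= k < n.+1) c k * v ^+ k - \sum_(0 <= k < n.+1) c k * w ^+ k
        - (\sum_(0 <= k < n.+1) k%:R * c k * w ^+ k.-1) * (v - w).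
      by rewrite mulr_suml -!sumrB; apply: eq_bigr => k _; ring.
    rewrite [X in _ - X * _]big_nat_recl //= mul0r mul0r add0r.
    by rewrite /X.
  apply: le_trans (cmod_sum _ _ _) _.
  apply: (@le_trans _ _ (\sum_(0 <= k < n.+1) (A * (1 / 2) ^+ k) * (cmod (v - w) ^+ 2 / rho ^+ 2))).
    apply: ler_sum => k _; rewrite cmodM mulrA ler_pdivlMr ?exprn_gt0 //.
    apply: (@le_trans _ _ ((k%:R ^+ 2 * (cmod (c k) * rho ^+ k)) * cmod (v - w) ^+ 2)); last first.
      by rewrite ler_wpM2r ?sqr_ge0.
    have := ler_wpM2l (cmod_ge0 (c k)) (power_taylor1 k (ltW rho0) (ltW vr) (ltW wr)).
    lra.
  rewrite -mulr_suml -mulr_sumr.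
  have geo m : \sum_(0 <= k < m) (1 / 2) ^+ k <= 2 - 2 * (1 / 2) ^+ m :> R.
    elim: m => [|m IHm]; first by rewrite big_geq // expr0; lra.
    by rewrite big_nat_recr //= exprS; lra.
  have h1 : \sum_(0 <= k < n.+1) (1 / 2) ^+ k <= 2 :> R.
    by apply: le_trans (geo _) _; have := exprn_ge0 n.+1 (_ : 0 <= 1 / 2 :> R); lra.
  rewrite /B (_ : 2 * A / rho ^+ 2 * _ = A * 2 * (cmod (v - w) ^+ 2 / rho ^+ 2)); last by ring.
  apply: ler_wpM2r; last exact: ler_wpM2l.
  by rewrite divr_ge0 ?sqr_ge0.
apply/is_deriveCP => e e0.
have B0 : 0 <= B by rewrite divr_ge0 ?mulr_ge0 ?exprn_ge0 // ltW.
near=> v.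
have vr : cmod v < rho.
  have := cmodD (v - w) w; rewrite subrK => h; apply: le_lt_trans h _.
  rewrite -ltrBrDr; near: v; apply: near_cmod; lra.
apply: le_trans (key v vr) _; rewrite expr2 mulrA ler_wpM2r ?cmod_ge0 //.
have d1 : cmod (v - w) < e / (B + 1) by near: v; apply: near_cmod; rewrite divr_gt0 //; lra.
move: d1; rewrite ltr_pdivlMr; last lra.
by have := cmod_ge0 (v - w); nra.
Unshelve. all: end_near. Qed.

Lemma analytic_derive f z0 : analytic_at f z0 -> exists D,
  (\forall z \near z0, is_derive z (1 : C) f (D z)) /\ analytic_at D z0.
Proof.
move=> [c /nbhs_cmodP [r r0 H]].
have Hg w : cmod w < r -> series (fun k => c k * w ^+ k) n @[n --> \oo] --> f (z0 + w).
  by move=> wr; apply: H; rewrite subr0.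
have [D [rho [rho0 HD]]] := power_series_derive r0 Hg.
exists (fun z => D (z - z0)); split.
- apply/nbhs_cmodP; exists rho => // z /HD [dz _].
  apply/is_deriveCP => e e0.
  have := (is_deriveCP _ _ _).1 dz e e0.
  rewrite (_ : z - z0 = - z0 + 1 * z); last by ring.
  move=> /near_affine; apply: filterS => w.
  rewrite (_ : z0 + (- z0 + 1 * w) = w); last by ring.
  rewrite (_ : z0 + (- z0 + 1 * z) = z); last by ring.
  by rewrite (_ : - z0 + 1 * w - (- z0 + 1 * z) = w - z); last by ring.
- exists (fun k => k.+1%:R * c k.+1); apply/nbhs_cmodP; exists rho => // w.
  by rewrite subr0 => /HD [_]; rewrite addrC addKr.
Qed.

(** A second application of [analytic_derive] makes the derivative itself derivable, hence
    continuous. *)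
Lemma holomorphic_of_analytic f z0 : analytic_at f z0 -> holomorphic_at f z0.
Proof.
move=> /analytic_derive [D [fD /analytic_derive [D2 [DD _]]]].
apply: (@holomorphic_of_derive _ f D); apply: filterS2 fD DD => z fz Dz; split => //.
by apply: derivable_continuousC; case: Dz.
Qed.

Lemma holomorphic_derive1 f z0 : holomorphic_at f z0 ->
  holomorphic_at (fun z => 'D_1 f z) z0.
Proof.
move=> /analytic_of_holomorphic /analytic_derive [D [fD /holomorphic_of_analytic]].
apply: near_eq_holomorphic; apply: filterS fD => z fz.
by rewrite derive_val.
Qed.

End PowerSeries.

(** * Means of logarithms over circles *)

Section LogMeans.
Context {R : realType}.
Local Notation C := (Cplx R).
Local Notation mu := (@lebesgue_measure R).
Local Notation I2pi := (`[0, 2 * pi]%classic : set R).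
Implicit Types (z w : C) (r s t e : R) (f g : C -> C).

(** Half the real logarithm of the squared modulus is differentiated, so no branch of the complex
    logarithm is chosen. *)
Lemma ln_cmod_derive (p : R -> C) t (d : C) : path_deriv p t d -> p t != 0 ->
  is_derive t 1 (fun s => ln (cmod (p s))) (reC (d / p t)).
Proof.
move=> pd p0; have pt0 : 0 < cmod (p t) by rewrite cmod_gt0.
have dr := path_deriv_re pd; have di := path_deriv_im pd.
pose q s := reC (p s) * reC (p s) + imC (p s) * imC (p s).
have qE s : q s = cmod (p s) ^+ 2 by rewrite cmod_sqr !expr2.
have q0 : 0 < q t by rewrite qE exprn_gt0.
have dq : is_derive t 1 q (2 * (reC (p t) * reC d + imC (p t) * imC d)).
  have h := is_deriveD (is_deriveM dr dr) (is_deriveM di di).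
  by apply: is_derive_eq h _; rewrite -![_ *: _]/(_ * _); ring.
have dl := is_derive1_ln q0.
have := is_deriveZ (2^-1) (@is_derive1_comp _ _ _ _ _ _ dl dq).
rewrite (_ : 2^-1 \*: ((@ln R) \o q) = fun s => ln (cmod (p s))); last first.
  apply/funext => s; rewrite /= qE -[_ *: _]/(_ * _).
  have [->|ps0] := eqVneq (cmod (p s)) 0; first by rewrite expr0n /= ln0 // mulr0.
  by rewrite lnXn ?lt_def ?ps0 ?cmod_ge0 // -mulr_natr; field.
move=> h; apply: is_derive_eq h _.
rewrite -![_ *: _]/(_ * _).
have -> : d / p t = ofR (q t)^-1 * (d * conj (p t)).
  have cp0 : conj (p t) != 0 by rewrite -cmod_eq0 cmod_conj cmod_eq0.
  by rewrite qE ofRV -mul_conj; field; rewrite ?p0 ?cp0.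
have q1 : q t != 0 by rewrite gt_eqF.
by rewrite reZ reM /= -/(reC (p t)) -/(imC (p t)); field.
Qed.

Lemma log_mean_zero_free g r r' : 0 < r -> r < r' ->
  (forall z, cmod z < r' -> holomorphic_at g z /\ g z != 0) ->
  cint (fun t => ln (cmod (g (circle_point r t)))) = 2 * pi * ln (cmod (g 0)).
Proof.
move=> r0 rr' hg; pose z t : C := circle_point r t.
have zr t : cmod (z t) = r by rewrite cmod_circle_point gtr0_norm.
pose d := (r' - r) / (2 * r).
have d0 : 0 < d by rewrite divr_gt0 ?subr_gt0 // mulr_gt0.
have dr : d * (2 * r) = r' - r by rewrite divfK // mulf_neq0 ?gt_eqF.
pose r'' := (r + r') / 2.
have r''r' : r'' < r' by rewrite /r''; lra.
have r''0 : 0 <= r'' by rewrite /r''; lra.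
pose H ζ := 'D_1 g ζ / g ζ.
have hH ζ : cmod ζ < r' -> holomorphic_at H ζ.
  move=> /hg [hgζ g0].
  exact: (holomorphicM (holomorphic_derive1 hgζ) (holomorphicV hgζ g0)).
pose p s t := ofR s * z t.
have pr s t : s \in `](- d), (1 + d)[ -> cmod (p s t) <= r''.
  move=> sI; have /andP[s1 s2] : - d < s < 1 + d by move: sI; rewrite in_itv.
  rewrite /p cmodM cmod_ofR zr.
  have : `|s| * r <= (1 + d) * r by rewrite ler_wpM2r ?ltW //; rewrite ltr_norml; lra.
  rewrite /r''; lra.
have pr' s t : s \in `](- d), (1 + d)[ -> cmod (p s t) < r'.
  by move=> sI; exact: le_lt_trans (pr s t sI) r''r'.
have [M HM] : exists M : R, forall ζ, cmod ζ <= r'' -> cmod (H ζ) <= M.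
  apply: disc_bound => // ζ ζr; apply: holomorphic_continuous.
  by apply: hH; exact: le_lt_trans r''r'.
have zc : continuous z by exact: circle_point_continuous.
have pc s : continuous (p s).
  by move=> t; exact: cvgM (cvg_cst _) (zc t).
pose phi s t := ln (cmod (g (p s t))).
pose psi s t := reC (H (p s t) * z t).
have phic s : s \in `](- d), (1 + d)[ -> continuous (phi s).
  move=> sI t; have [hgp gp0] := hg _ (pr' s t sI).
  have h1 := continuous_comp (pc s t) (holomorphic_continuous hgp).
  have h2 := continuous_comp h1 (@cmod_continuous R _).
  apply: (continuous_comp h2); apply: continuous_ln.
  by rewrite /= cmod_gt0.
have := @cint_homotopy R phi psi (- d) (1 + d) (M * r).
have -> : phi 1 = (fun t => ln (cmod (g (circle_point r t)))).
  by apply/funext => t; rewrite /phi /p ofR1 mul1r.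
have -> : phi 0 = (fun t => ln (cmod (g 0))).
  by apply/funext => t; rewrite /phi /p ofR0 mul0r.
rewrite cint_cst; apply; [lra|lra|..].
- by move=> s sI; apply: continuous_cintegrable; exact: phic.
- move=> s t sI; have [hgp gp0] := hg _ (pr' s t sI).
  have -> : psi s t = reC ('D_1 g (p s t) * z t / g (p s t)).
    by rewrite /psi /H; congr reC; ring.
  apply: ln_cmod_derive => //.
  apply: (@path_deriv_comp R g (p^~ t)); first exact: holomorphic_derivable.
  have := @path_deriv_line R 0 (z t) s.
  by rewrite (_ : (fun s0 : R => 0 + ofR s0 * z t) = p^~ t) //; apply/funext => u; rewrite add0r.
- move=> s t sI; apply: le_trans (re_le_cmod _) _; rewrite cmodM zr.
  by rewrite ler_pM2r //; exact: HM (pr s t sI).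
- move=> s; rewrite in_itv /= => /andP[s0 s1].
  (* The integrand [psi s] is the real part of this holomorphic function on the circle. The function
     vanishes at 0, so its mean is 0. *)
  have hF ζ : cmod ζ < r' -> holomorphic_at (fun ζ => H (0 + ofR s * ζ) * ζ) ζ.
    move=> ζr; apply: (fun h => holomorphicM h (holomorphic_id ζ)).
    apply: holomorphic_affine; apply: hH; rewrite add0r cmodM cmod_ofR gtr0_norm //.
    by have := cmod_ge0 ζ; nra.
  have := mean_value_re r0 rr' hF; rewrite mulr0 /= mulr0 => <-.
  by congr cint; apply/funext => t; rewrite add0r.
Qed.

End LogMeans.

(** * Finite sets of exceptional angles *)

Section LinearFactors.
Context {R : realType}.
Local Notation C := (Cplx R).
Local Notation mu := (@lebesgue_measure R).
Local Notation I2pi := (`[0, 2 * pi]%classic : set R).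
Implicit Types (z w : C) (r s t e : R) (f g : C -> C).

Lemma finite_set_null (F : set R) : finite_set F -> measurable F /\ mu F = 0.
Proof.
move=> fF; split; last by apply: countable_lebesgue_measure0; exact: finite_set_countable.
rewrite (_ : F = \bigcup_(x in F) [set x]).
  by apply: fin_bigcup_measurable => // x _; exact: measurable_set1.
by apply/seteqP; split => [x Fx|x [y Fy ->]//]; exists x.
Qed.

(** All subsets of a finite set are measurable and null, so whatever [h] does on [F] affects neither
    its measurability nor its integral. *)
Lemma cintegrable_off (h : R -> R) (F : set R) : finite_set F ->
  mu.-integrable (I2pi `\` F) (EFin \o h) ->
  cintegrable h /\ cint h = \int[mu]_(t in I2pi `\` F) h t.
Proof.
move=> fF ih; have [mF F0] := finite_set_null fF.
have mI : measurable I2pi by exact: measurable_itv.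
have ih' : cintegrable h.
  have H := (@negligible_integrable _ _ R mu I2pi F (EFin \o h) mF mI).
  apply: (H _ F0).2 => //.
  rewrite -(setDUK (A := I2pi `&` F) (B := I2pi)); last exact: subIsetl.
  apply/measurable_funU.
  - exact: measurableI.
  - by apply: measurableD => //; exact: measurableI.
  split.
  - move=> _ Y mY; apply: (finite_set_null _).1.
    by apply: sub_finite_set fF => x [[]].
  - rewrite setDIr setDv set0U; exact: measurable_int ih.
split=> //; rewrite /cint /Rintegral; congr fine.
exact: (@negligible_integral _ _ R mu I2pi F (EFin \o h) mF mI ih' F0).
Qed.

Lemma cint_eq_off (h1 h2 : R -> R) (F : set R) : finite_set F ->
  (forall t, I2pi t -> ~ F t -> h1 t = h2 t) -> cintegrable h1 ->
  cintegrable h2 /\ cint h2 = cint h1.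
Proof.
move=> fF h12 i1.
have [mF F0] := finite_set_null fF.
have mI : measurable I2pi by exact: measurable_itv.
have i2 : mu.-integrable (I2pi `\` F) (EFin \o h1).
  by apply: integrableS i1 => //; exact: measurableD.
have i3 : mu.-integrable (I2pi `\` F) (EFin \o h2).
  apply: eq_integrable i2; first exact: measurableD.
  by move=> t; rewrite inE /= => -[It nFt]; rewrite /= h12.
have [i4 ->] := cintegrable_off fF i3; split => //.
have [_ ->] := cintegrable_off fF i2.
by apply: eq_Rintegral => t; rewrite inE => -[It nFt]; rewrite h12.
Qed.

(** Equal points give [cos (s - t) = 1], and cosine is injective on [[0, pi]]. *)
Lemma circle_point_local_inj r t : r != 0 ->
  \forall s \near t^', circle_point r s != circle_point r t :> C.
Proof.
move=> r0; have near_dist_pi : \forall s \near t, `|s - t| < pi.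
  apply/nbhs_ballP; exists pi => /=; first exact: pi_gt0.
  by move=> s; rewrite /ball /= distrC.
rewrite near_withinE; near=> s => st.
apply: contra st => /eqP [/(mulfI r0) hc /(mulfI r0) hs].
have h1 : cos (s - t) = 1 by rewrite cosB hc hs -!expr2 cos2Dsin2.
have h2 : `|s - t| < pi.
  near: s; exact: near_dist_pi.

have h3 : cos `|s - t| = 1 by rewrite cos_norm.
have : `|s - t| = 0.
  by apply: cos_inj; rewrite ?h3 ?cos0 // in_itv /= ?lexx ?normr_ge0 ?pi_ge0 //= ltW.
by move/normr0_eq0/eqP; rewrite subr_eq0.
Unshelve. all: end_near. Qed.

(** Local injectivity turns a punctured neighbourhood in the plane into a punctured neighbourhood of
    the angle; compactness of [[0, 2 pi]] does the rest. *)
Lemma circle_exceptions (P : C -> Prop) r : 0 < r ->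
  (forall z, cmod z = r -> \forall w \near z^', P w) ->
  finite_set [set t | I2pi t /\ ~ P (circle_point r t)].
Proof.
move=> r0 H; have := @finite_compact_exceptions R I2pi (fun t => P (circle_point r t)).
apply; first exact: segment_compact.
move=> t _; have zr : cmod (circle_point r t : C) = r by rewrite cmod_circle_point gtr0_norm.
have h1 : \forall s \near t,
    (circle_point r s : C) != circle_point r t -> P (circle_point r s).
  by have := H _ zr; rewrite near_withinE => /(@circle_point_continuous R r t).
have rn0 : r != 0 by rewrite gt_eqF.
have := circle_point_local_inj t rn0; rewrite !near_withinE => h2.
by apply: filterS2 h1 h2 => s h1 h2 st; apply: h1; exact: h2.
Qed.

End LinearFactors.

Section LinearMeans.
Context {R : realType}.
Local Notation C := (Cplx R).
Local Notation mu := (@lebesgue_measure R).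
Local Notation I2pi := (`[0, 2 * pi]%classic : set R).
Implicit Types (z w a : C) (r s t e : R) (f g : C -> C).

Lemma circle_log_continuous g r : 0 < r ->
  (forall z, cmod z = r -> holomorphic_at g z /\ g z != 0) ->
  continuous (fun t => ln (cmod (g (circle_point r t)))).
Proof.
move=> r0 hg; apply: (@circle_continuous R _ (fun z => ln (cmod (g z)))); first exact: ltW.
move=> z zr; have [hgz g0] := hg z zr.
have h1 := continuous_comp (holomorphic_continuous hgz) (@cmod_continuous R (g z)).
by apply: (continuous_comp h1); apply: continuous_ln; rewrite /= cmod_gt0.
Qed.

Lemma holomorphic_linear a z : holomorphic_at (fun z : C => z - a) z.
Proof. exact: (holomorphicB (holomorphic_id z) (holomorphic_cst a z)). Qed.

Lemma log_mean_linear_out a r : 0 < r -> r < cmod a ->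
  cintegrable (fun t => ln (cmod (circle_point r t - a))) /\
  cint (fun t => ln (cmod (circle_point r t - a))) = 2 * pi * ln (cmod a).
Proof.
move=> r0 ra.
have hg (z : C) : cmod z < cmod a -> holomorphic_at (fun z => z - a) z /\ z - a != 0.
  move=> za; split; first exact: holomorphic_linear.
  by rewrite subr_eq0; apply/eqP => e; rewrite e ltxx in za.
split.
  apply: continuous_cintegrable.
  apply: (@circle_log_continuous (fun z => z - a)) => // z zr.
  by apply: hg; rewrite zr.
by rewrite (log_mean_zero_free r0 ra hg) sub0r cmodN.
Qed.

(* On [|z| = r] the factor [z - a] has the same modulus as [r - conj a z / r],
   which is zero free on the closed disc when [|a| < r]. *)
Lemma log_mean_linear_in a r : 0 < r -> cmod a < r ->
  cintegrable (fun t => ln (cmod (circle_point r t - a))) /\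
  cint (fun t => ln (cmod (circle_point r t - a))) = 2 * pi * ln r.
Proof.
move=> r0 ar; pose g (z : C) : C := ofR r - (ofR r^-1 * conj a) * z.
pose r' := 2 * r ^+ 2 / (r + cmod a).
have a0 := cmod_ge0 a.
have ra0 : 0 < r + cmod a by lra.
have rr' : r < r' by rewrite /r' ltr_pdivlMr //; nra.
have hg z : cmod z < r' -> holomorphic_at g z /\ g z != 0.
  move=> zr; split.
    apply: holomorphicB; first exact: holomorphic_cst.
    exact: (holomorphicM (holomorphic_cst _ _) (holomorphic_id _)).
  rewrite subr_eq0; apply/eqP => /(congr1 (@cmod R)).
  rewrite !cmodM !cmod_ofR cmod_conj !gtr0_norm ?invr_gt0 // => e1.
  have e2 : cmod a * cmod z = r ^+ 2 by rewrite expr2 {2}e1; field; rewrite gt_eqF.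
  have h : cmod a * r' < r ^+ 2.
    rewrite /r' mulrA ltr_pdivrMr // mulrCA !mulrA.
    have : cmod a * r ^+ 2 < r * r ^+ 2 by rewrite ltr_pM2r ?exprn_gt0.
    lra.
  have : cmod a * cmod z <= cmod a * r' by rewrite ler_wpM2l // ltW.
  lra.
have gz t : cmod (g (circle_point r t)) = cmod (circle_point r t - a).
  set z := circle_point r t.
  have zr : cmod z = r by rewrite cmod_circle_point gtr0_norm.
  have z0 : z != 0 by rewrite -cmod_eq0 zr gt_eqF.
  have -> : g z = ofR r^-1 * (z * conj (z - a)).
    rewrite conjB mulrBr mul_conj zr /g ofRM ofRV.
    have or0 : ofR r != 0 :> C by rewrite -cmod_eq0 cmod_ofR normr_eq0 gt_eqF.
    by field.
  by rewrite !cmodM cmod_ofR cmod_conj zr gtr0_norm ?invr_gt0 // mulKf ?gt_eqF.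
split.
  apply: continuous_cintegrable.
  under eq_fun do rewrite -gz.
  by apply: circle_log_continuous => // z zr; apply: hg; rewrite zr.
under eq_fun do rewrite -gz.
by rewrite (log_mean_zero_free r0 rr' hg) /g mulr0 subr0 cmod_ofR gtr0_norm.
Qed.

Lemma circle_avoids a r : 0 < r -> finite_set [set t | I2pi t /\ circle_point r t = a].
Proof.
move=> r0; have := @circle_exceptions R (fun z => z != a) r r0.
rewrite (_ : [set t | I2pi t /\ ~ circle_point r t != a] =
             [set t | I2pi t /\ circle_point r t = a]).
  apply=> z _; have [->|za] := eqVneq z a; first exact: nbhs_dnbhs_neq.
  apply: nbhs_dnbhs; apply/nbhs_cmodP; exists (cmod (z - a)).
    by rewrite cmod_gt0 subr_eq0.
  by move=> w; apply: contraTneq => ->; rewrite cmodB ltxx.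
apply/seteqP; split => t /= [It]; first by move=> /negP; rewrite negbK => /eqP.
by move=> ->; split=> //; rewrite eqxx.
Qed.

(* With [k_n = (1 - l_n)^2 / l_n], one has [|z - l_n a|^2 / l_n = (2 + k_n) r^2
   - 2 Re (z conj a)], which decreases to [|z - a|^2]: monotone convergence. *)
Lemma log_mean_linear_on a r : 0 < r -> cmod a = r ->
  cintegrable (fun t => ln (cmod (circle_point r t - a))) /\
  cint (fun t => ln (cmod (circle_point r t - a))) = 2 * pi * ln r.
Proof.
move=> r0 ar.
pose z t : C := circle_point r t.
have zr t : cmod (z t) = r by rewrite cmod_circle_point gtr0_norm.
pose x t := reC (z t * conj a).
have xr t : `|x t| <= r ^+ 2.
  by apply: le_trans (re_le_cmod _) _; rewrite cmodM cmod_conj zr ar expr2.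
pose l (n : nat) : R := n.+1%:R / n.+2%:R.
pose k (n : nat) : R := (n.+1%:R * n.+2%:R)^-1.
have l0 n : 0 < l n by rewrite divr_gt0.
have k0 n : 0 < k n by rewrite invr_gt0 mulr_gt0.
have dist2 (s : R) t : cmod (z t - ofR s * a) ^+ 2 = r ^+ 2 + s ^+ 2 * r ^+ 2 - 2 * s * x t.
  rewrite /x -{1}(zr t) -[in RHS]ar !cmod_sqr !reD !imD !reN !imN reZ imZ reM /=.
  by rewrite -/(reC a) -/(imC a) -/(reC (z t)) -/(imC (z t)); ring.
pose F n t := ln (r ^+ 2 * (2 + k n) - 2 * x t).
have Fl n t : r ^+ 2 * (2 + k n) - 2 * x t = cmod (z t - ofR (l n) * a) ^+ 2 / l n.
  rewrite dist2 /k /l -(natr1 n.+1).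
  have m0 : 0 < n.+1%:R :> R by [].
  by field; rewrite !gt_eqF // addr_gt0.
have Fpos n t : 0 < r ^+ 2 * (2 + k n) - 2 * x t.
  have := xr t; rewrite ler_norml => /andP[_ h].
  have : 0 < r ^+ 2 * k n by rewrite mulr_gt0 ?exprn_gt0.
  lra.
have lin n : cmod (ofR (l n) * a) < r.
  rewrite cmodM cmod_ofR ar gtr0_norm // gtr_pMl // /l ltr_pdivrMr // mul1r ltr_nat.
  by [].
have FE n t : F n t = 2 * ln (cmod (z t - ofR (l n) * a)) + - ln (l n).
  rewrite /F Fl lnM ?lnV ?posrE ?invr_gt0 //; last first.
    by have := Fpos n t; rewrite Fl pmulr_lgt0 // invr_gt0.
  rewrite lnXn; last first.
    have := Fpos n t; rewrite Fl pmulr_lgt0 ?invr_gt0 // => h.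
    by rewrite lt_def cmod_ge0 andbT; apply/eqP => e; move: h; rewrite e expr0n /= ltxx.
  by rewrite mulr_natl.
have iF n : cintegrable (F n) /\ cint (F n) = 2 * (2 * pi * ln r) - 2 * pi * ln (l n).
  have [i1 e1] := log_mean_linear_in r0 (lin n).
  have -> : F n = (fun t => 2 * ln (cmod (z t - ofR (l n) * a)) + - ln (l n)).
    by apply/funext => t; exact: FE.
  have ic : cintegrable (fun=> - ln (l n)) by apply: continuous_cintegrable; exact: cst_continuous.
  split; first by apply: cintegrableD => //; exact: cintegrableZ.
  rewrite cintD //; last exact: cintegrableZ.
  by rewrite cintZ // e1 cint_cst; ring.
(* As [k n <= 1/2] and [|x t| <= r^2], the argument of the logarithm in [F n] is at most [5 r^2].
   Hence [M - F n] is nonnegative, and it increases with [n]. *)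
pose M : R := ln (5 * r ^+ 2).
(* At the removed angles [F n] tends to minus infinity, while the limit function would be read with
   [ln 0 = 0]. *)
pose D := I2pi `\` [set t | I2pi t /\ z t = a].
have fB := @circle_avoids a r r0.
have [mB B0] := finite_set_null fB.
have mI : measurable I2pi by exact: measurable_itv.
have mD : measurable D by exact: measurableD.
pose G n t : \bar R := (M - F n t)%:E.
have iG n : cintegrable (fun t => M + -1 * F n t).
  apply: cintegrableD; first by apply: continuous_cintegrable; exact: cst_continuous.
  by apply: cintegrableZ; case: (iF n).
have GE n : G n = EFin \o (fun t => M + -1 * F n t).
  by apply/funext => t; rewrite /G /= mulN1r.
have iGD n : mu.-integrable D (G n).
  rewrite GE; apply: (@integrableS _ _ _ mu I2pi) => //; last exact: iG.
  by move=> t [].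
have k2 n : k n <= 1 / 2.
  rewrite /k div1r lef_pV2 ?posrE ?mulr_gt0 // -natrM ler_nat.
  by case: n.
have G0 n t : D t -> (0 <= G n t)%E.
  move=> _; rewrite /G lee_fin subr_ge0 /M /F ler_ln ?posrE ?mulr_gt0 ?exprn_gt0 //.
  have := xr t; rewrite ler_norml => /andP[h _].
  have := k2 n; have := exprn_gt0 2 r0; nra.
have kd m n : (m <= n)%N -> k n <= k m.
  move=> mn; rewrite /k lef_pV2 ?posrE ?mulr_gt0 // -!natrM ler_nat.
  by rewrite leq_mul // ltnS.
have Gd t : D t -> {homo G^~ t : m n / (m <= n)%N >-> (m <= n)%E}.
  move=> _ m n mn; rewrite /G lee_fin lerD2l lerN2 ler_ln ?posrE ?Fpos //.
  by rewrite lerD2r ler_pM2l ?exprn_gt0 // lerD2l kd.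
have kc : k n @[n --> \oo] --> 0.
  apply: (@squeeze_cvgr _ _ _ _ (cst 0) harmonic); last 2 first.
  - exact: cvg_cst.
  - exact: cvg_harmonic.
  apply: nearW => n; rewrite ltW //= /k /harmonic /= lef_pV2 ?posrE ?mulr_gt0 //.
  by rewrite ler_peMr // ler1n.
have lc : ln (l n) @[n --> \oo] --> 0.
  rewrite -(@ln1 R); apply: (@continuous_cvg _ _ _ (nbhs \oo) _ l (@ln R) 1).
    by apply: continuous_ln; exact: ltr01.
  have -> : l = (fun n => 1 - @harmonic R n.+1).
    by apply/funext => n; rewrite /l /harmonic /= -(natr1 n.+1); field; rewrite gt_eqF // addr_gt0.
  rewrite -[X in _ --> X](subr0 (1 : R)); apply: cvgB; first exact: cvg_cst.
  by rewrite (cvg_shiftS (@harmonic R)); exact: cvg_harmonic.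
pose h t := M + -1 * (2 * ln (cmod (z t - a))).
have dist1 t : cmod (z t - a) ^+ 2 = 2 * r ^+ 2 - 2 * x t.
  by have := dist2 1 t; rewrite ofR1 mul1r => ->; ring.
have zt0 t : D t -> 0 < cmod (z t - a).
  by move=> [It nB]; rewrite cmod_gt0 subr_eq0; apply/eqP => e; apply: nB.
have Gcvg t : D t -> G n t @[n --> \oo] --> (h t)%:E.
  move=> Dt; apply: cvg_EFin; first exact: nearW.
  have h0 := zt0 t Dt.
  have hl : 2 * ln (cmod (z t - a)) = ln (r ^+ 2 * (2 + 0) - 2 * x t).
    by rewrite mulr_natl -lnXn // dist1 addr0 (mulrC (r ^+ 2)).
  rewrite /h mulN1r hl /comp /=; apply: cvgB; first exact: cvg_cst.
  have c0 : 0 < r ^+ 2 * (2 + 0) - 2 * x t.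
    by rewrite addr0 (mulrC (r ^+ 2)) -dist1 exprn_gt0.
  apply: (@continuous_cvg _ _ _ (nbhs \oo) _ (fun n => r ^+ 2 * (2 + k n) - 2 * x t) (@ln R) _ (continuous_ln c0)).
  apply: cvgB; last exact: cvg_cst.
  by apply: cvgM; [exact: cvg_cst|apply: cvgD; [exact: cvg_cst|exact: kc]].
have ch : (\int[mu]_(x in D) G n x)%E @[n --> \oo] --> (\int[mu]_(x in D) (h x)%:E)%E.
  have -> : (\int[mu]_(x in D) (h x)%:E = \int[mu]_(x in D) (fun t => limn (G^~ t)) x)%E.
    by apply: eq_integral => t; rewrite inE => Dt; apply/esym/cvg_lim => //; exact: Gcvg.
  have H := @cvg_monotone_convergence _ _ R mu D mD G (fun n => measurable_int mu (iGD n)) G0 Gd.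
  exact: H.
have IG n : (\int[mu]_(x in D) G n x = (2 * pi * M - (2 * (2 * pi * ln r) - 2 * pi * ln (l n)))%:E)%E.
  have iGn : mu.-integrable D (EFin \o (fun t => M + -1 * F n t)) by rewrite -GE.
  have [_ e1] := cintegrable_off fB iGn.
  have fin := @integrable_fin_num _ _ R mu D mD _ iGn.
  rewrite GE -(fineK fin); congr EFin; apply: etrans (esym e1) _.
  have [iFn eFn] := iF n.
  rewrite cintD; [|by apply: continuous_cintegrable; exact: cst_continuous|exact: cintegrableZ].
  by rewrite cintZ // eFn cint_cst mulN1r.
have ch2 : (\int[mu]_(x in D) G n x)%E @[n --> \oo] --> (2 * pi * M - 2 * (2 * pi * ln r))%:E.
  under eq_cvg do rewrite IG.
  apply: cvg_EFin; first exact: nearW.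
  rewrite /comp /=.
  apply: cvgB; first exact: cvg_cst.
  rewrite -[X in _ --> X]subr0; apply: cvgB; first exact: cvg_cst.
  by rewrite -(mulr0 (2 * pi)); apply: cvgM; [exact: cvg_cst|exact: lc].
(* The integrals of [G n] have two limits, one from monotone convergence and one from the explicit
   means. Their equality also shows that the integral of [h] is finite, which gives integrability
   below. *)
have e1 : (\int[mu]_(x in D) (h x)%:E = (2 * pi * M - 2 * (2 * pi * ln r))%:E)%E.
  by have <- := cvg_lim (@ereal_hausdorff R) ch; exact: (cvg_lim (@ereal_hausdorff R) ch2).
have h0 t : D t -> 0 <= h t.
  move=> /zt0 c0; rewrite /h mulN1r subr_ge0 mulr_natl -lnXn // /M.
  rewrite ler_ln ?posrE ?mulr_gt0 ?exprn_gt0 // dist1.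
  have := xr t; rewrite ler_norml => /andP[hx _].
  have := exprn_gt0 2 r0; lra.
have ih : mu.-integrable D (EFin \o h).
  apply/integrableP; split.
    exact: (@emeasurable_fun_cvg _ _ R D G (EFin \o h) (fun n => measurable_int mu (iGD n)) Gcvg).
  rewrite (_ : (\int[mu]_(x in D) _)%E = (\int[mu]_(x in D) (h x)%:E)%E); last first.
    by apply: eq_integral => t; rewrite inE => Dt /=; rewrite ger0_norm ?h0.
  by rewrite e1 ltry.
have [ich ech] := cintegrable_off fB ih.
have ech2 : cint h = 2 * pi * M - 2 * (2 * pi * ln r) by rewrite ech /Rintegral -/D e1.
have -> : (fun t => ln (cmod (circle_point r t - a))) = (fun t => M / 2 + (- 2^-1) * h t).
  by apply/funext => t; rewrite /h /z; field.
have icM : cintegrable (fun=> M / 2) by apply: continuous_cintegrable; exact: cst_continuous.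
split; first by apply: cintegrableD => //; exact: cintegrableZ.
rewrite cintD //; last exact: cintegrableZ.
by rewrite cint_cst cintZ // ech2; field.
Qed.

Lemma log_mean_linear a r : 0 < r ->
  cintegrable (fun t => ln (cmod (circle_point r t - a))) /\
  cint (fun t => ln (cmod (circle_point r t - a))) = 2 * pi * ln (Num.max r (cmod a)).
Proof.
move=> r0; case: (ltgtP r (cmod a)) => [ra|ar|ar].
- exact: log_mean_linear_out.
- exact: log_mean_linear_in.
- by apply: log_mean_linear_on.
Qed.

End LinearMeans.

(** * Zeros and poles *)

Section LocalOrder.
Context {R : realType}.
Local Notation C := (Cplx R).
Implicit Types (z w a : C) (f g : C -> C).

(** One signed order serves zeros and poles: positive at the former, negative at the latter, and
    additive under products. *)
Definition local_order f z0 (m : int) : Prop := exists g : C -> C,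
  [/\ holomorphic_at g z0, g z0 != 0 & \forall z \near z0^', f z = (z - z0) ^ m * g z].

Lemma cvg_series_shift (u : nat -> C) (l : C) m : (forall k, (k < m)%N -> u k = 0) ->
  series u n @[n --> \oo] --> l ->
  series (fun k => u (k + m)%N) n @[n --> \oo] --> l.
Proof.
move=> u0; rewrite -(cvg_shiftn m).
suff -> : (fun n => series u (n + m)%N) = series (fun k => u (k + m)%N) by [].
apply/funext => n; rewrite /series /= (@big_cat_nat _ _ _ m) //=; last exact: leq_addl.
rewrite big1_seq ?add0r; last by move=> i; rewrite mem_index_iota => /andP[_ /u0].
by rewrite -{1}[m]add0n big_addn addnK.
Qed.

(** The order is the index of the first nonzero Taylor coefficient, and [g] is the sum of the
    shifted series. *)
Lemma holomorphic_zero_or_order f z0 : holomorphic_at f z0 ->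
  (\forall z \near z0, f z = 0) \/
  exists (m : nat) (g : C -> C), [/\ holomorphic_at g z0, g z0 != 0 &
    \forall z \near z0, f z = (z - z0) ^+ m * g z].
Proof.
move=> /analytic_of_holomorphic [c /nbhs_cmodP [e e0 H]].
have Hz z : cmod (z - z0) < e ->
    series (fun k => c k * (z - z0) ^+ k) n @[n --> \oo] --> f z.
  move=> ze; have := H (z - z0); rewrite subr0 => /(_ ze).
  by rewrite (_ : z0 + (z - z0) = z); last by ring.
have [call0|/existsNP [m0 /eqP cm0]] := pselect (forall k, c k = 0).
  left; apply/nbhs_cmodP; exists e; first exact: e0.
  move=> z /Hz.
  rewrite (_ : series _ = (fun=> 0)); first by move=> /(cvg_lim (@norm_hausdorff _ _)) <-; rewrite lim_cst.
  by apply/funext => n; rewrite /series /= big1 // => k _; rewrite call0 mul0r.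
right; have ex : exists m, c m != 0 by exists m0.
case: (ex_minnP ex) => m cm mmin {ex m0 cm0}.
have c0 k : (k < m)%N -> c k = 0.
  by move=> km; apply/eqP/negPn/negP => /mmin; rewrite leqNgt km.
pose g z := if z == z0 then c m else f z / (z - z0) ^+ m.
exists m, g; split.
- apply: holomorphic_of_analytic; exists (fun k => c (k + m)%N).
  apply/nbhs_cmodP; exists e; first exact: e0.
  move=> w; rewrite subr0 => we.
  have [->|w0] := eqVneq w 0.
    rewrite /g addr0 eqxx; apply/cvg_cmodP => d d0; exists 1%N => // n /= n0.
    rewrite /series /= (big_ltn n0) expr0 mulr1 add0n big1_seq ?addr0 ?subrr ?cmod0 //.
    by move=> i; rewrite mem_index_iota => /andP[_ /andP[i0 _]]; rewrite expr0n gtn_eqF // mulr0.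
  have zw : z0 + w != z0 by rewrite -subr_eq0 addrAC subrr add0r.
  rewrite /g (negbTE zw).
  have wE : z0 + w - z0 = w by rewrite addrAC subrr add0r.
  have := Hz (z0 + w); rewrite !wE => /(_ we) h.
  have h2 : series (fun k => c (k + m)%N * w ^+ (k + m)) n @[n --> \oo] --> f (z0 + w).
    by apply: (cvg_series_shift (u := fun k => c k * w ^+ k) _ h) => k km; rewrite c0 ?mul0r.
  have h3 : series (fun k => c (k + m)%N * w ^+ (k + m)) n * w ^- m @[n --> \oo]
      --> f (z0 + w) / w ^+ m.
    exact: cvgM h2 (cvg_cst (w ^- m)).
  rewrite (_ : series _ = fun n => series (fun k => c (k + m)%N * w ^+ (k + m)) n * w ^- m) //.
  apply/funext => n; rewrite /series /= mulr_suml; apply: eq_bigr => k _.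
  by rewrite exprD mulrA mulfK // expf_neq0.
- by rewrite /g eqxx.
- apply/nbhs_cmodP; exists e; first exact: e0.
  move=> z _.
  rewrite /g; have [->|zz0] := eqVneq z z0; last first.
    by rewrite mulrC divfK // expf_neq0 // subr_eq0.
  have fz0 : f z0 = c 0%N.
    have h := Hz z0; rewrite subrr cmod0 in h.
    have h1 : series (fun k => c k * 0 ^+ k) n @[n --> \oo] --> c 0%N.
      apply/cvg_cmodP => d d0; exists 1%N => // n /= n0.
      rewrite /series /= (big_ltn n0) expr0 mulr1 big1_seq ?addr0 ?subrr ?cmod0 //.
      by move=> i; rewrite mem_index_iota => /andP[_ /andP[i0 _]]; rewrite expr0n gtn_eqF // mulr0.
    exact: (cvg_unique (@norm_hausdorff _ _) (h e0) h1).
  rewrite subrr fz0; case: (m) c0 => [|k] c0; first by rewrite expr0 mul1r.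
  by rewrite c0 // expr0n mul0r.
Qed.

End LocalOrder.

Section Meromorphic.
Context {R : realType}.
Local Notation C := (Cplx R).
Implicit Types (z w a : C) (f g : C -> C).

Lemma dnbhs_cmodP z (P : C -> Prop) : (\forall w \near z^', P w) <->
  exists2 e : R, 0 < e & forall w, cmod (w - z) < e -> w != z -> P w.
Proof.
split.
  by rewrite near_withinE => /nbhs_cmodP [e e0 H]; exists e => // w /H.
by case=> e e0 H; rewrite near_withinE; apply/nbhs_cmodP; exists e => // w /H.
Qed.

Lemma dnbhs_near z0 (P : C -> Prop) : (\forall z \near z0^', P z) ->
  \forall z \near z0^', \forall w \near z, P w.
Proof.
move=> /dnbhs_cmodP [e e0 H]; apply/dnbhs_cmodP; exists e => // z ze zz0.
have d0 : 0 < Num.min (e - cmod (z - z0)) (cmod (z - z0)).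
  by rewrite lt_min subr_gt0 ze /= cmod_gt0 subr_eq0.
apply: filterS (near_cmod z d0) => w; rewrite lt_min => /andP[w1 w2].
apply: H.
  by have := cmodD (w - z) (z - z0); rewrite addrA subrK; lra.
by apply: contraTneq w2 => ->; rewrite cmodB ltxx.
Qed.

Lemma dnbhs_nonempty z0 : ~ \forall z \near (z0 : C)^', False.
Proof. by move=> /(@filter_ex _ _ _) []. Qed.

Lemma dnbhs_zero_limit (h : C -> C) z0 : {for z0, continuous h} ->
  (\forall z \near z0^', h z = 0) -> h z0 = 0.
Proof.
move=> hc h0; apply/eqP/negPn/negP => /(near_neq0 hc) /nbhs_dnbhs hn.
apply: (@dnbhs_nonempty z0).
by apply: filterS2 h0 hn => z -> /eqP.
Qed.

Lemma holomorphic_expz (z0 z : C) (m : int) : z != z0 ->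
  holomorphic_at (fun z => (z - z0) ^ m) z.
Proof.
move=> zz0; have h : holomorphic_at (fun z => z - z0) z.
  exact: (holomorphicB (holomorphic_id z) (holomorphic_cst z0 z)).
case: m => n; first exact: (holomorphicX n h).
by apply: (holomorphicV (holomorphicX n.+1 h)); rewrite expf_neq0 // subr_eq0.
Qed.

Lemma mero_zero_or_order f z0 : meromorphic f ->
  (\forall z \near z0^', f z = 0) \/ exists m, local_order f z0 m.
Proof.
move=> /(_ z0) [k [g [/holomorphic_of_analytic hg fg]]].
have [g0|[m [h [hh h0 gh]]]] := holomorphic_zero_or_order hg.
  left; move/nbhs_dnbhs : g0 => g0.
  by apply: filterS2 fg g0 => z -> ->; rewrite mul0r.
right; exists (m%:Z - k%:Z), h; split => //.
move/nbhs_dnbhs : gh => gh.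
have n0 := @nbhs_dnbhs_neq C z0.
apply: filterS3 fg gh n0 => z -> -> zz0.
rewrite expfzDr ?subr_eq0 // -exprnP -exprnN; by rewrite mulrAC.
Qed.

Lemma local_order_meromorphic f : (forall z0, (\forall z \near z0^', f z = 0) \/
  exists m, local_order f z0 m) -> meromorphic f.
Proof.
move=> H z0; have [f0|[m [g [hg g0 fg]]]] := H z0.
  exists 0%N, (fun=> 0); split.
    exact: (analytic_of_holomorphic (holomorphic_cst 0 z0)).
  by apply: filterS f0 => z ->; rewrite mul0r.
case: m fg => n fg.
  exists 0%N, (fun z => (z - z0) ^+ n * g z); split.
    apply: analytic_of_holomorphic.
    have h := holomorphicB (holomorphic_id z0) (holomorphic_cst z0 z0).
    exact: (holomorphicM (holomorphicX n h) hg).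
  by apply: filterS fg => z ->; rewrite expr0 divr1.
exists n.+1, g; split; first exact: analytic_of_holomorphic.
by apply: filterS fg => z ->; rewrite mulrC.
Qed.

Lemma local_order_near f z0 m : local_order f z0 m ->
  \forall z \near z0^', holomorphic_at f z /\ f z != 0.
Proof.
move=> [g [hg g0 fg]].
have g1 := nbhs_dnbhs (near_neq0 (holomorphic_continuous hg) g0).
have hg1 := nbhs_dnbhs (holomorphic_at_near hg).
have n0 := @nbhs_dnbhs_neq C z0.
have fg1 := dnbhs_near fg.
apply: filterS2 (filterI g1 hg1) (filterI n0 fg1) => z [gz hgz] [zz0 fgz]; split.
  apply: (@near_eq_holomorphic _ (fun z => (z - z0) ^ m * g z)).
    by apply: filterS fgz => w ->.
  exact: (holomorphicM (holomorphic_expz m zz0) hgz).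
by rewrite (nbhs_singleton fgz) mulf_neq0 // expfz_neq0 // subr_eq0.
Qed.

Lemma local_orderM f g z0 m n : local_order f z0 m -> local_order g z0 n ->
  local_order (fun z => f z * g z) z0 (m + n).
Proof.
move=> [u [hu u0 fu]] [v [hv v0 gv]]; exists (fun z => u z * v z); split.
- exact: (holomorphicM hu hv).
- by rewrite mulf_neq0.
- have n0 := @nbhs_dnbhs_neq C z0.
  apply: filterS3 fu gv n0 => z -> -> zz0.
  by rewrite expfzDr ?subr_eq0 // mulrACA.
Qed.

Lemma local_orderV f z0 m : local_order f z0 m ->
  local_order (fun z => (f z)^-1) z0 (- m).
Proof.
move=> [u [hu u0 fu]]; exists (fun z => (u z)^-1); split.
- exact: (holomorphicV hu u0).
- by rewrite invr_neq0.
- by apply: filterS fu => z ->; rewrite invfM invr_expz.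
Qed.

Lemma local_order_eq f g z0 m : (\forall z \near z0^', f z = g z) ->
  local_order f z0 m -> local_order g z0 m.
Proof.
move=> fg [u [hu u0 fu]]; exists u; split => //.
by apply: filterS2 fg fu => z <-.
Qed.

(** If [m < n], cancelling the lower power leaves [u = (z - z0)^(n - m) v] off [z0]; by continuity
    [u z0 = 0]. *)
Lemma local_order_le f z0 m n : local_order f z0 m -> local_order f z0 n -> ~~ (m < n).
Proof.
move=> [u [hu u0 fu]] [v [hv v0 fv]]; apply/negP => mn.
have [k k0 nk] : exists2 k : nat, (0 < k)%N & n = m + k%:Z.
  by exists `|n - m|%N; lia.
pose h z := u z - (z - z0) ^+ k * v z.
have hh : holomorphic_at h z0.
  have h1 := holomorphicB (holomorphic_id z0) (holomorphic_cst z0 z0).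
  exact: (holomorphicB hu (holomorphicM (holomorphicX k h1) hv)).
have : h z0 = 0.
  apply: dnbhs_zero_limit; first exact: holomorphic_continuous.
  have n0 := @nbhs_dnbhs_neq C z0.
  apply: filterS3 fu fv n0 => z fu fv zz0; apply/eqP; rewrite subr_eq0.
  have e0 : (z - z0) ^ m != 0 by rewrite expfz_neq0 // subr_eq0.
  apply/eqP/(mulfI e0); rewrite -fu fv nk expfzDr ?subr_eq0 //.
  by rewrite mulrA.
by rewrite /h subrr expr0n gtn_eqF //= mul0r subr0 => /eqP; rewrite (negbTE u0).
Qed.

Lemma local_order_uniq f z0 m n : local_order f z0 m -> local_order f z0 n -> m = n.
Proof.
move=> h1 h2; apply/eqP; rewrite eq_le.
by rewrite leNgt (local_order_le h2 h1) leNgt (local_order_le h1 h2).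
Qed.

Lemma pole_of_orderP f z0 k : pole_of_order f z0 k <-> local_order f z0 (- k%:Z).
Proof.
split=> [[g [ag g0 fg]]|[g [hg g0 fg]]]; exists g; split => //.
- exact: holomorphic_of_analytic.
- by apply: filterS fg => z ->; rewrite -exprnN mulrC.
- exact: analytic_of_holomorphic.
- by apply: filterS fg => z ->; rewrite -exprnN mulrC.
Qed.

Lemma pole_order_local f z0 m : local_order f z0 m ->
  pole_order f z0 = if m is Negz n then n.+1 else 0%N.
Proof.
move=> fm; rewrite /pole_order; case: xgetP => [k _ /pole_of_orderP /(local_order_uniq fm) ->|H].
  by case: k => [|k]; rewrite ?oppr0 // -NegzE.
case: m fm => // n fm; case: (H n.+1); apply/pole_of_orderP.
by rewrite -NegzE.
Qed.

Lemma local_order_nonzero f z0 m : local_order f z0 m ->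
  ~ \forall z \near z0^', f z = 0.
Proof.
move=> /local_order_near fm f0.
apply: (@dnbhs_nonempty z0).
by apply: filterS2 fm f0 => z [_ /eqP].
Qed.

Lemma pole_order_zero f z0 : (\forall z \near z0^', f z = 0) -> pole_order f z0 = 0%N.
Proof.
move=> f0; rewrite /pole_order; case: xgetP => // k _ /pole_of_orderP.
by move=> /local_order_nonzero.
Qed.

Lemma pole_order_eq f g z0 : (\forall z \near z0^', f z = g z) ->
  pole_order f z0 = pole_order g z0.
Proof.
move=> fg; rewrite /pole_order; congr xget; apply/seteqP; split => k /= /pole_of_orderP h;
  apply/pole_of_orderP; apply: local_order_eq h => //.
by apply: filterS fg => z ->.
Qed.

Lemma pole_order_rep f z0 : meromorphic f -> exists u : C -> C,
  holomorphic_at u z0 /\ \forall z \near z0^', f z = u z / (z - z0) ^+ pole_order f z0.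
Proof.
move=> mf; have [f0|[m fm]] := mero_zero_or_order z0 mf.
  exists (fun=> 0); split; first exact: holomorphic_cst.
  by apply: filterS f0 => z ->; rewrite mul0r.
rewrite (pole_order_local fm); case: fm => g [hg g0]; case: m => n fg.
  exists (fun z => (z - z0) ^+ n * g z); split.
    have h := holomorphicB (holomorphic_id z0) (holomorphic_cst z0 z0).
    exact: (holomorphicM (holomorphicX n h) hg).
  by apply: filterS fg => z ->; rewrite expr0 divr1.
exists g; split => //.
by apply: filterS fg => z ->; rewrite mulrC.
Qed.

(** Together with [pole_order_rep] this makes the pole order the least exponent that clears the
    singularity. As [u] may vanish at [z0], cancellation in sums needs no case analysis. *)
Lemma pole_order_le f u z0 k : holomorphic_at u z0 ->
  (\forall z \near z0^', f z = u z / (z - z0) ^+ k) -> (pole_order f z0 <= k)%N.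
Proof.
move=> hu fu; have [u0|[m [h [hh h0 uh]]]] := holomorphic_zero_or_order hu.
  rewrite pole_order_zero //; move/nbhs_dnbhs : u0 => u0.
  by apply: filterS2 fu u0 => z -> ->; rewrite mul0r.
have fm : local_order f z0 (m%:Z - k%:Z).
  exists h; split => //; move/nbhs_dnbhs : uh => uh.
  have n0 := @nbhs_dnbhs_neq C z0.
  apply: filterS3 fu uh n0 => z -> -> zz0.
  by rewrite expfzDr ?subr_eq0 // -exprnP -exprnN mulrAC.
by rewrite (pole_order_local fm); case E : (m%:Z - k%:Z) => [//|n]; lia.
Qed.

Lemma meromorphicM f g : meromorphic f -> meromorphic g ->
  meromorphic (fun z => f z * g z).
Proof.
move=> mf mg; apply: local_order_meromorphic => z0.
have [f0|[m fm]] := mero_zero_or_order z0 mf.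
  by left; apply: filterS f0 => z ->; rewrite mul0r.
have [g0|[n gn]] := mero_zero_or_order z0 mg.
  by left; apply: filterS g0 => z ->; rewrite mulr0.
by right; exists (m + n); exact: local_orderM.
Qed.

Lemma meromorphicV f : meromorphic f -> meromorphic (fun z => (f z)^-1).
Proof.
move=> mf; apply: local_order_meromorphic => z0.
have [f0|[m fm]] := mero_zero_or_order z0 mf.
  by left; apply: filterS f0 => z ->; rewrite invr0.
by right; exists (- m); exact: local_orderV.
Qed.

(** The common denominator yields the sum of the pole orders rather than their maximum, which is
    enough for the subadditivity of [N]. *)
Lemma pole_add f g z0 : meromorphic f -> meromorphic g -> exists u : C -> C,
  holomorphic_at u z0 /\
  \forall z \near z0^', f z + g z = u z / (z - z0) ^+ (pole_order f z0 + pole_order g z0).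
Proof.
move=> /(pole_order_rep z0) [u [hu fu]] /(pole_order_rep z0) [v [hv gv]].
move: (pole_order f z0) (pole_order g z0) fu gv => k l fu gv.
exists (fun z => u z * (z - z0) ^+ l + v z * (z - z0) ^+ k); split.
  have h := holomorphicB (holomorphic_id z0) (holomorphic_cst z0 z0).
  exact: (holomorphicD (holomorphicM hu (holomorphicX l h)) (holomorphicM hv (holomorphicX k h))).
have n0 := @nbhs_dnbhs_neq C z0.
apply: filterS3 fu gv n0 => z -> -> zz0.
have h : z - z0 != 0 by rewrite subr_eq0.
by rewrite exprD; field; rewrite !expf_neq0.
Qed.

Lemma meromorphicD f g : meromorphic f -> meromorphic g ->
  meromorphic (fun z => f z + g z).
Proof.
move=> mf mg z0; have [u [hu fu]] := pole_add z0 mf mg.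
by exists (pole_order f z0 + pole_order g z0)%N, u; split => //; exact: analytic_of_holomorphic.
Qed.

Lemma pole_orderD f g z0 : meromorphic f -> meromorphic g ->
  (pole_order (fun z => f z + g z)%R z0 <= pole_order f z0 + pole_order g z0)%N.
Proof. by move=> mf mg; have [u [hu /(pole_order_le hu)]] := pole_add z0 mf mg. Qed.

Lemma meromorphic_cst (c : C) : meromorphic (fun=> c).
Proof.
move=> z0; exists 0%N, (fun=> c); split; first exact: (analytic_of_holomorphic (holomorphic_cst c z0)).
by near=> z; rewrite expr0 divr1.
Unshelve. all: end_near. Qed.

Lemma meromorphicB f g : meromorphic f -> meromorphic g ->
  meromorphic (fun z => f z - g z).
Proof.
move=> mf mg.
have := meromorphicD mf (meromorphicM (meromorphic_cst (-1)) mg).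
by rewrite (_ : (fun z => f z + -1 * g z) = (fun z => f z - g z)) //; apply/funext => z; rewrite mulN1r.
Qed.

(** The set of points near which [f] vanishes is open, and closed because a point of finite order
    has none of them nearby. Pulled back along the line through [z1] and [z2] it is all of the
    connected set [R]. *)
Lemma meromorphic_identity f z1 : meromorphic f ->
  (\forall z \near z1^', f z = 0) -> mero_eq f (fun=> 0).
Proof.
move=> mf f1 z2; pose A := [set z : C | \forall w \near z^', f w = 0].
have Aopen : open A.
  rewrite openE => z zA; have /dnbhs_cmodP [e e0 H] := dnbhs_near zA.
  apply/nbhs_cmodP; exists e; first exact: e0.
  move=> w wz.
  have [->|wz0] := eqVneq w z; first exact: zA.
  exact: nbhs_dnbhs (H w wz wz0).
have Aclosed : closed A.
  rewrite -[A]setCK; apply: open_closedC; rewrite openE => z zA.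
  have [//|[m fm]] := mero_zero_or_order z mf.
  have /dnbhs_cmodP [e e0 H] := dnbhs_near (local_order_near fm).
  apply/nbhs_cmodP; exists e; first exact: e0.
  move=> w wz.
  have [->|wz0] := eqVneq w z; first exact: zA.
  have /nbhs_dnbhs h := H w wz wz0 => wA.
  apply: (@dnbhs_nonempty w).
  by apply: filterS2 h wA => y [_ /eqP].
pose p (t : R) : C := z1 + ofR t * (z2 - z1).
have pc : continuous p.
  by move=> t; exact: (path_deriv_continuous (@path_deriv_line R z1 (z2 - z1) t)).
have cR : connected [set: R] by apply/connected_intervalP.
have pA : p @^-1` A = [set: R].
  apply: cR.
  - by exists 0; rewrite /= /p ofR0 mul0r addr0.
  - exists (p @^-1` A); last by rewrite setTI.
    exact: open_comp.
  - exists (p @^-1` A); last by rewrite setTI.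
    by move/continuous_closedP : pc; apply.
have : (p @^-1` A) 1 by rewrite pA.
by rewrite /= /p ofR1 mul1r addrC subrK.
Qed.

End Meromorphic.

(** * Factorization over a disc *)

Section Factorization.
Context {R : realType}.
Local Notation C := (Cplx R).
Implicit Types (z w a : C) (f g h : C -> C) (s : seq C).

Definition ord f z0 : int := xget 0 [set m | local_order f z0 m].

Lemma ordP f z0 : meromorphic f -> ~ mero_eq f (fun=> 0) -> local_order f z0 (ord f z0).
Proof.
move=> mf nz; rewrite /ord; case: xgetP => [m _ //|H].
have [f0|[m fm]] := mero_zero_or_order z0 mf; last by case: (H m).
by case: nz; exact: meromorphic_identity f0.
Qed.

Lemma ord_eq f z0 m : local_order f z0 m -> ord f z0 = m.
Proof.
move=> fm; rewrite /ord; case: xgetP => [n _ fn|H]; last by case: (H m).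
exact: local_order_uniq fn fm.
Qed.

Lemma local_order0 f z0 : holomorphic_at f z0 -> f z0 != 0 -> local_order f z0 0.
Proof.
move=> hf f0; exists f; split => //.
by near=> z; rewrite expr0z mul1r.
Unshelve. all: end_near. Qed.

Lemma local_order_prod s (n : C -> int) z0 :
  local_order (fun z => \prod_(a <- s) (z - a) ^ n a) z0
              (\sum_(a <- s) if a == z0 then n a else 0).
Proof.
elim: s => [|a s IH].
  rewrite big_nil; under eq_fun do rewrite big_nil.
  by apply: local_order0; [exact: holomorphic_cst|exact: oner_neq0].
rewrite big_cons; under eq_fun do rewrite big_cons.
apply: local_orderM IH.
have [->|az] := eqVneq a z0.
  exists (fun=> 1); split; [exact: holomorphic_cst|exact: oner_neq0|].
  by near=> z; rewrite mulr1.
apply: local_order0; first by apply: holomorphic_expz; rewrite eq_sym.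
by rewrite expfz_neq0 // subr_eq0 eq_sym.
Unshelve. all: end_near. Qed.

(* The value at [z0] once a removable singularity is removed. *)
Definition reg h z0 : C := lim (h z @[z --> z0^']).

Lemma reg_continuous h u z0 : {for z0, continuous u} ->
  (\forall z \near z0^', h z = u z) -> reg h z0 = u z0.
Proof.
move=> uc hu; apply: cvg_lim; first exact: norm_hausdorff.
have h1 : u z @[z --> z0^'] --> u z0 by exact: cvg_trans (cvg_app _ (@nbhs_dnbhs _ z0)) uc.
apply: cvg_trans h1; apply: near_eq_cvg.
by apply: filterS hu => z ->.
Qed.

(** Where [h] agrees with [u] off [z0], the limits taken by [reg] agree with [u] at [z0] and at all
    nearby points. *)
Lemma reg_holomorphic h z0 : local_order h z0 0 ->
  holomorphic_at (reg h) z0 /\ reg h z0 != 0.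
Proof.
move=> [u [hu u0 hE]].
have hE1 : \forall z \near z0^', h z = u z by apply: filterS hE => z ->; rewrite expr0z mul1r.
have r0 : reg h z0 = u z0 by apply: reg_continuous hE1; exact: holomorphic_continuous.
rewrite r0; split; last exact: u0.
apply: (fun e => near_eq_holomorphic e hu).
have := dnbhs_near hE1; rewrite near_withinE => h1.
apply: filterS2 h1 (holomorphic_at_near hu) => z h1 huz.
have [->|zz0] := eqVneq z z0; first by rewrite r0.
apply/esym/reg_continuous; first exact: holomorphic_continuous.
exact: nbhs_dnbhs (h1 zz0).
Qed.

Lemma holomorphic_prodz s (n : C -> int) z : z \notin s ->
  holomorphic_at (fun z => \prod_(a <- s) (z - a) ^ n a) z.
Proof.
elim: s => [|a s IH] zs.
  by under eq_fun do rewrite big_nil; exact: holomorphic_cst.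
under eq_fun do rewrite big_cons.
move: zs; rewrite inE negb_or => /andP[za /IH h].
exact: (holomorphicM (holomorphic_expz (n a) za) h).
Qed.

(** By compactness only finitely many points of the disc are zeros, poles or places with a
    meaningless value. Division by the product leaves order 0 everywhere on the disc, and [reg]
    repairs the remaining values. *)
Lemma factorization f (rho : R) : 0 <= rho -> meromorphic f -> ~ mero_eq f (fun=> 0) ->
  exists (s : seq C) (g : C -> C),
  [/\ uniq s, 0 \in s,
    (forall z, cmod z <= rho -> holomorphic_at g z /\ g z != 0),
    (forall z, cmod z <= rho -> z \notin s -> ord f z = 0) &
    (forall z, cmod z <= rho -> z \notin s -> f z = g z * \prod_(a <- s) (z - a) ^ ord f a)].
Proof.
move=> rho0 mf nz.
pose Q z := holomorphic_at f z /\ f z != 0.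
have : finite_set ([set z : C | cmod z <= rho] `\` Q).
  apply: finite_compact_exceptions; first exact: compact_disc.
  move=> z _; exact: local_order_near (ordP z mf nz).
move=> /finite_seqP [s0 Hs0].
(* The origin is always listed, possibly with order 0, so that its factor can be split off in
   Jensen's formula. *)
pose s := undup (0 :: s0).
have sQ z : cmod z <= rho -> z \notin s -> Q z.
  move=> zr zs; apply: contrapT => nQ; move/negP : zs; apply.
  rewrite mem_undup inE; apply/orP; right.
  have : ([set z : C | cmod z <= rho] `\` Q) z by [].
  by rewrite Hs0.
have us : uniq s by exact: undup_uniq.
pose P (n : int) z := \prod_(a <- s) (z - a) ^ (n * ord f a).
pose h z := f z * P (- 1) z.
have sE z : cmod z <= rho -> z \notin s -> ord f z = 0.
  by move=> zr zs; apply: ord_eq; have [h1 h2] := sQ z zr zs; exact: local_order0.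
have h0 z : cmod z <= rho -> local_order h z 0.
  move=> zr; have := local_orderM (ordP z mf nz) (local_order_prod s (fun a => -1 * ord f a) z).
  rewrite [X in local_order _ _ X](_ : _ = 0) //.
  have [zs|zs] := boolP (z \in s).
    rewrite (bigD1_seq z) //= eqxx big1 ?addr0 ?mulN1r ?subrr //.
    by move=> a /negbTE ->.
  rewrite sE // add0r big1_seq // => a /= az; case: eqVneq => // e.
  by rewrite -e az in zs.
exists s, (reg h); split; [exact: us| | |exact: sE|].
- by rewrite mem_undup inE eqxx.
- by move=> z zr; exact: reg_holomorphic (h0 z zr).
- move=> z zr zs; have [hz fz] := sQ z zr zs.
  have za a : a \in s -> z - a != 0.
    by move=> ain; rewrite subr_eq0; apply: contraNneq zs => ->.
  have hP : holomorphic_at (P (-1)) z by exact: holomorphic_prodz.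
  have -> : reg h z = h z.
    apply: (@reg_continuous h h); last by near=> w.
    exact: (holomorphic_continuous (holomorphicM hz hP)).
  rewrite /h -mulrA -[LHS]mulr1; congr (_ * _).
  rewrite /P -big_split /= big1_seq // => a /= ain.
  by rewrite -expfzDr ?za // mulN1r addNr expr0z.
Unshelve. all: end_near. Qed.

End Factorization.

Local Arguments cmod : simpl never.

(** * Jensen's formula and the first main theorem *)

Section Jensen.
Context {R : realType}.
Local Notation C := (Cplx R).
Local Notation I2pi := (`[0, 2 * pi]%classic : set R).
Implicit Types (z w a : C) (f g h : C -> C) (s : seq C) (r : R).

(* The leading Laurent coefficient at [0], which replaces [f 0] in Jensen's
   formula. *)
Definition lead f : C := reg (fun z => f z * z ^ (- ord f 0)) 0.

(* The weight of a zero at [a] in Jensen's formula. *)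
Definition kappa r a : R :=
  if a == 0 then ln r else if cmod a <= r then ln (r / cmod a) else 0.

Lemma near_notin s z : \forall w \near z^', w \notin s.
Proof.
elim: s => [|a s IH]; first by near=> w.
suff h : \forall w \near z^', w != a.
  by apply: filterS2 h IH => w; rewrite inE negb_or => -> ->.
have [->|za] := eqVneq z a; first exact: nbhs_dnbhs_neq.
apply: nbhs_dnbhs; apply/nbhs_cmodP; exists (cmod (z - a)).
  by rewrite cmod_gt0 subr_eq0.
by move=> w; apply: contraTneq => ->; rewrite cmodB ltxx.
Unshelve. all: end_near. Qed.

Lemma ln_cmodM z w : z != 0 -> w != 0 ->
  ln (cmod (z * w)) = ln (cmod z) + ln (cmod w).
Proof. by move=> z0 w0; rewrite cmodM lnM // posrE cmod_gt0. Qed.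

Lemma ln_cmodXz z (n : int) : z != 0 -> ln (cmod (z ^ n)) = n%:~R * ln (cmod z).
Proof.
move=> z0; have c0 : 0 < cmod z by rewrite cmod_gt0.
case: n => n.
  by rewrite -exprnP cmodX lnXn // -mulr_natl.
rewrite NegzE -exprnN cmodV cmodX lnV ?posrE ?exprn_gt0 // lnXn //.
by rewrite mulrNz mulNr -mulr_natl.
Qed.

Lemma ln_cmod_prodz s (n : C -> int) z : z \notin s ->
  \prod_(a <- s) (z - a) ^ n a != 0 /\
  ln (cmod (\prod_(a <- s) (z - a) ^ n a)) = \sum_(a <- s) (n a)%:~R * ln (cmod (z - a)).
Proof.
elim: s => [|a s IH]; first by rewrite !big_nil cmod1 ln1 oner_neq0.
rewrite inE negb_or !big_cons => /andP[za /IH [p0 e]].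
have h : z - a != 0 by rewrite subr_eq0.
have h1 : (z - a) ^ n a != 0 by rewrite expfz_neq0.
by rewrite mulf_neq0 // ln_cmodM // e ln_cmodXz.
Qed.

Lemma cint_sum (I : Type) (l : seq I) (h : I -> R -> R) :
  (forall i, cintegrable (h i)) ->
  cintegrable (fun t => \sum_(i <- l) h i t) /\
  cint (fun t => \sum_(i <- l) h i t) = \sum_(i <- l) cint (h i).
Proof.
move=> ih; elim: l => [|i l [i1 e1]].
  rewrite big_nil; under eq_fun do rewrite big_nil.
  split; first by apply: continuous_cintegrable; exact: cst_continuous.
  by rewrite cint_cst mulr0.
rewrite big_cons; under eq_fun do rewrite big_cons.
split; first exact: cintegrableD.
by rewrite cintD // e1.
Qed.

Lemma ln_max_kappa r a : 0 < r -> a != 0 ->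
  ln (Num.max r (cmod a)) = ln (cmod a) + kappa r a.
Proof.
move=> r0 a0; rewrite /kappa (negbTE a0).
have c0 : 0 < cmod a by rewrite cmod_gt0.
case: leP => h.
  by rewrite lnM ?posrE ?invr_gt0 // lnV ?posrE // addrCA subrr addr0.
by rewrite addr0.
Qed.

Lemma jensen f r : 0 < r -> meromorphic f -> ~ mero_eq f (fun=> 0) ->
  exists s : seq C, [/\ uniq s, (forall z, cmod z <= r -> z \notin s -> ord f z = 0),
    cintegrable (fun t => ln (cmod (f (circle_point r t)))) &
    cint (fun t => ln (cmod (f (circle_point r t)))) =
      2 * pi * (ln (cmod (lead f)) + \sum_(a <- s) (ord f a)%:~R * kappa r a)].
Proof.
move=> r0 mf nz; have r10 : 0 <= r + 1 by lra.
(* The larger radius makes [g] zero free beyond the circle. Points of [s] outside the disc of radius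
   [r] do no harm, as their weight [kappa] is 0. *)
have [s [g [us s0 hg sE fE]]] := factorization r10 mf nz.
have rr1 : r < r + 1 by lra.
have sE' z : cmod z <= r -> z \notin s -> ord f z = 0 by move=> zr; apply: sE; lra.
exists s.
have hg' z : cmod z < r + 1 -> holomorphic_at g z /\ g z != 0.
  by move=> zr; apply: hg; exact: ltW.
pose z t : C := circle_point r t.
have zr t : cmod (z t) = r by rewrite cmod_circle_point gtr0_norm.
pose A a t := (ord f a)%:~R * ln (cmod (z t - a)).
pose L t := ln (cmod (g (z t))) + \sum_(a <- s) A a t.
have iA a : cintegrable (A a).
  by apply: cintegrableZ; case: (log_mean_linear a r0).
have ig : cintegrable (fun t => ln (cmod (g (z t)))).
  apply: continuous_cintegrable; apply: circle_log_continuous => // w wr.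
  by apply: hg'; rewrite wr.
have [iS eS] := cint_sum s iA.
have iL : cintegrable L by exact: cintegrableD.
have eL : cint L = 2 * pi * (ln (cmod (g 0)) +
    \sum_(a <- s) (ord f a)%:~R * ln (Num.max r (cmod a))).
  rewrite /L cintD // eS (log_mean_zero_free r0 rr1 hg') [RHS]mulrDr [X in _ = _ + X]mulr_sumr.
  congr (_ + _); apply: eq_bigr => a _; have [i1 e1] := log_mean_linear a r0.
  by rewrite /A cintZ // e1; ring.
have fF := circle_exceptions r0 (fun w (_ : cmod w = r) => near_notin s w).
have Lf t : I2pi t -> ~ [set t | I2pi t /\ ~ circle_point r t \notin s] t ->
    L t = ln (cmod (f (z t))).
  move=> It /= nF; have zs : z t \notin s.
    by apply: contrapT => h; apply: nF; split => //; apply/negP.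
  have zr1 : cmod (z t) <= r + 1 by rewrite zr; lra.
  rewrite fE //; have [p0 e] := ln_cmod_prodz (ord f) zs.
  by have [_ g0] := hg _ zr1; rewrite ln_cmodM // e.
have [ifz efz] := cint_eq_off fF Lf iL.
split; [exact: us|exact: sE'|exact: ifz|].
rewrite efz eL; congr (_ * _).
pose s' := [seq a <- s | a != 0].
have zs' : 0 \notin s' by rewrite mem_filter eqxx.
have [p0 e0] := ln_cmod_prodz (ord f) zs'.
have [hg0 g0] : holomorphic_at g 0 /\ g 0 != 0 by apply: hg; rewrite cmod0.
(* The logarithm of this product supplies exactly the terms [ln |a|] by which [ln (max r |a|)]
   differs from [kappa r a]. *)
have leadE : lead f = g 0 * \prod_(a <- s') (0 - a) ^ ord f a.
  apply: (@reg_continuous R _ (fun z => g z * \prod_(a <- s') (z - a) ^ ord f a)).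
    exact: (holomorphic_continuous (holomorphicM hg0 (holomorphic_prodz (ord f) zs'))).
  have h1 : \forall w \near (0 : C)^', cmod w <= r + 1.
    apply: nbhs_dnbhs; apply: filterS (@near_cmod R 0 r r0) => w; rewrite subr0; lra.
  apply: filterS3 h1 (near_notin s 0) (@nbhs_dnbhs_neq C 0) => w wr ws w0.
  rewrite fE // (bigD1_seq (0 : C)) //= subr0 big_filter -mulrA; congr (_ * _).
  by rewrite mulrC mulrA -expfzDr // addNr expr0z mul1r.
rewrite leadE ln_cmodM // e0 -addrA; congr (_ + _).
rewrite [in LHS](bigD1_seq (0 : C)) //= [X in _ = _ + X](bigD1_seq (0 : C)) //= big_filter.
rewrite cmod0 (max_idPl (ltW r0)) {1}/kappa eqxx addrCA -big_split /=; congr (_ + _).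
apply: eq_bigr => a a0; rewrite ln_max_kappa // sub0r cmodN.
by rewrite mulrDr.
Qed.

End Jensen.

(** * Counting functions as weighted sums over poles *)

Section Counting.
Context {R : realType}.
Local Notation C := (Cplx R).
Local Notation mu := (@lebesgue_measure R).
Implicit Types (z w a : C) (f g h : C -> C) (s : seq C) (r t b : R).

(** A pole at distance [b] from the origin adds [1/t] to the integrand of [N] from [t = b] on. *)
Lemma int_inv_cut b r : 0 < b -> b <= r ->
  mu.-integrable (`]0, r]%classic : set R) (EFin \o (fun t => if b <= t then t^-1 else 0)) /\
  \int[mu]_(t in (`]0, r]%classic : set R)) (if b <= t then t^-1 else 0) = ln r - ln b.
Proof.
move=> b0 br.
pose J : set R := `[b, r]%classic.
have ic : {within J, continuous (fun t : R => t^-1)}.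
  apply: continuous_in_subspaceT => t; rewrite inE /J /= in_itv /= => /andP[bt _].
  by apply: inv_continuous; rewrite gt_eqF // (lt_le_trans b0).
have iJ : mu.-integrable J (EFin \o (fun t : R => t^-1)).
  by apply: continuous_compact_integrable ic; exact: segment_compact.
have mJ : measurable J by exact: measurable_itv.
have m0 : measurable (`]0, r]%classic : set R) by exact: measurable_itv.
have capE : (`]0, r]%classic : set R) `&` J = J.
  rewrite setIidr // => t; rewrite /J /= !in_itv /= => /andP[bt ->].
  by rewrite (lt_le_trans b0).
have pE : {in (`]0, r]%classic : set R), (fun t => if b <= t then t^-1 else 0) =1 ((fun t : R => t^-1) \_ J)}.
  move=> t; rewrite inE /= in_itv /= => /andP[t0 tr]; rewrite patchE.
  by rewrite mem_setE in_itv /= tr andbT.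
split.
  have : mu.-integrable (`]0, r]%classic : set R) (EFin \o ((fun t : R => t^-1) \_ J)).
    rewrite (_ : EFin \o _ = (EFin \o (fun t : R => t^-1)) \_ J); last by rewrite restrict_EFin.
    by apply/(@integrable_restrict _ _ R mu J mJ _ m0 _); rewrite capE.
  apply: eq_integrable => // t It /=; congr EFin; apply/esym; exact: pE.
rewrite (eq_Rintegral mu pE) -Rintegral_mkcondr capE.
move: br; rewrite le_eqVlt => /orP[/eqP br|br].
  rewrite /J br set_itv1 Rintegral_set1 subrr //.
rewrite /Rintegral (@continuous_FTC2 _ _ (@ln R)) //.
- split.
  + by move=> t; rewrite in_itv /= => /andP[bt _]; have [] := is_derive1_ln (lt_trans b0 bt).
  + apply: cvg_at_right_filter; exact: continuous_ln.
  + by apply: cvg_at_left_filter; apply: continuous_ln; exact: lt_trans br.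
- move=> t; rewrite in_itv /= => /andP[bt _]; rewrite derive1E.
  by have [_ ->] := is_derive1_ln (lt_trans b0 bt).
Qed.

Lemma n_polesE f r t s : t <= r -> uniq s ->
  (forall z, cmod z <= r -> z \notin s -> pole_order f z = 0%N) ->
  n_poles t f = \sum_(a <- s | cmod a <= t) (pole_order f a)%:R.
Proof.
move=> tr us sE; apply/esym.
apply: (@bigfs _ _ _ _ s (fun a => cmod a <= t) (fun a => (pole_order f a)%:R) us).
by move=> z zt /sE -> //; exact: le_trans tr.
Qed.

(** Integrating pole by pole gives [ln (r / |a|)] for [a != 0], and the separate term at the origin
    gives [ln r]. These are the weights of Jensen's formula, so both can be compared term by term
    over one list. *)
Lemma N_poles_kappa f r s : 0 < r -> uniq s ->
  (forall z, cmod z <= r -> z \notin s -> pole_order f z = 0%N) ->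
  N_poles r f = \sum_(a <- s) (pole_order f a)%:R * kappa r a.
Proof.
move=> r0 us sE; rewrite /N_poles.
pose p a : R := (pole_order f a)%:R.
have n0 : n_poles 0 f = \sum_(a <- s | a == 0) p a.
  rewrite (n_polesE _ us sE) //; last exact: ltW.
  by apply: eq_bigl => a; rewrite le_eqVlt ltNge cmod_ge0 orbF cmod_eq0.
pose F a t : R := if a == 0 then 0 else p a * (if cmod a <= t then t^-1 else 0).
have intE : {in (`]0, r]%classic : set R), (fun t => (n_poles t f - n_poles 0 f) / t) =1
    (fun t => \sum_(a <- s) F a t)}.
  move=> t; rewrite inE /= in_itv /= => /andP[t0 tr].
  rewrite n0 (n_polesE tr us sE) big_mkcond [X in _ - X]big_mkcond /= -sumrB mulr_suml.
  apply: eq_bigr => a _; rewrite /F; case: (eqVneq a 0) => [->|a0].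
    by rewrite cmod0 ltW // subrr mul0r.
  by rewrite subr0; case: ifP; rewrite ?mulr0 ?mul0r.
have m0 : measurable (`]0, r]%classic : set R) by exact: measurable_itv.
have int0 : mu.-integrable (`]0, r]%classic : set R) (EFin \o (fun=> 0 : R)) /\
    \int[mu]_(t in (`]0, r]%classic : set R)) (0 : R) = 0.
  by split; [exact: integrable0|rewrite Rintegral_cst // mul0r].
have Fint a : mu.-integrable (`]0, r]%classic : set R) (EFin \o F a) /\
    \int[mu]_(t in (`]0, r]%classic : set R)) F a t = p a * (if a == 0 then 0 else kappa r a).
  rewrite /F /kappa; case: (eqVneq a 0) => [_|a0].
    by rewrite mulr0; exact: int0.
  have ca : 0 < cmod a by rewrite cmod_gt0.
  case: (leP (cmod a) r) => [ar|ra].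
    have [i1 e1] := int_inv_cut ca ar; split.
      rewrite (_ : EFin \o _ = (fun t => (p a)%:E * (EFin \o (fun t => if (cmod a <= t)%R then (t^-1)%R else 0%R)) t)%E) //.
      exact: integrableZl.
    by rewrite RintegralZl // e1 lnM ?posrE ?invr_gt0 // lnV.
  have F0 : {in (`]0, r]%classic : set R), (fun=> 0) =1 (fun t => p a * (if cmod a <= t then t^-1 else 0))}.
    move=> t; rewrite inE /= in_itv /= => /andP[_ tr].
    by rewrite ifF ?mulr0 //; apply/negbTE; rewrite -ltNge (le_lt_trans tr).
  split; last by rewrite -(eq_Rintegral mu F0) int0.2 mulr0.
  apply: eq_integrable int0.1 => // t It /=; congr EFin; exact: (F0 t It).
have sumint : mu.-integrable (`]0, r]%classic : set R) (EFin \o (fun t => \sum_(a <- s) F a t)) /\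
    \int[mu]_(t in (`]0, r]%classic : set R)) (\sum_(a <- s) F a t) =
    \sum_(a <- s) p a * (if a == 0 then 0 else kappa r a).
  elim: s {us sE n0 intE} => [|a s [i1 e1]].
    rewrite big_nil (_ : (fun t => \sum_(a <- [::]) F a t) = fun=> 0) //.
    by apply/funext => t; rewrite big_nil.
  have [i2 e2] := Fint a.
  rewrite big_cons (_ : (fun t => \sum_(b <- a :: s) F b t) = (fun t => F a t + \sum_(b <- s) F b t)); last first.
    by apply/funext => t; rewrite big_cons.
  split; last by rewrite RintegralD // e1 e2.
  rewrite (_ : EFin \o _ = (EFin \o F a \+ (EFin \o (fun t => (\sum_(a <- s) F a t)%R)))%E) //.
  exact: integrableD.
rewrite (eq_Rintegral mu intE) sumint.2 n0 mulr_suml [X in _ + X]big_mkcond -big_split /=.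
apply: eq_bigr => a _; rewrite /kappa; case: (eqVneq a 0) => _; last by rewrite addr0.
by rewrite mulr0 add0r.
Qed.

Lemma pole_seq f r : meromorphic f -> exists s : seq C, uniq s /\
  forall z, cmod z <= r -> z \notin s -> pole_order f z = 0%N.
Proof.
move=> mf.
have : finite_set ([set z : C | cmod z <= r] `\` [set z | pole_order f z = 0%N]).
  apply: finite_compact_exceptions; first exact: compact_disc.
  move=> z _; have [f0|[m fm]] := mero_zero_or_order z mf.
    have := dnbhs_near f0; apply: filterS => w fw.
    exact: pole_order_zero (nbhs_dnbhs fw).
  have := local_order_near fm; apply: filterS => w [hw fw].
  by rewrite /= (pole_order_local (local_order0 hw fw)).
move=> /finite_seqP [s Hs]; exists (undup s); split; first exact: undup_uniq.
move=> z zr; rewrite mem_undup => zs; apply: contrapT => h.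
move/negP : zs; apply; have : ([set z : C | cmod z <= r] `\` [set z | pole_order f z = 0%N]) z by [].
by rewrite Hs.
Qed.

(** At the origin the weight is [ln r], negative for [r < 1]; this is the source of the condition
    [1 <= r] in the inequalities for [N] and [T]. *)
Lemma kappa_ge0 r a : 1 <= r -> 0 <= kappa r a.
Proof.
move=> r1; rewrite /kappa; case: (eqVneq a 0) => [_|a0]; first exact: ln_ge0.
case: (leP (cmod a) r) => // ar; apply: ln_ge0.
by rewrite ler_pdivlMr ?mul1r // cmod_gt0.
Qed.

Lemma N_poles_le f g h r : 1 <= r -> meromorphic f -> meromorphic g -> meromorphic h ->
  (forall z, (pole_order f z <= pole_order g z + pole_order h z)%N) ->
  N_poles r f <= N_poles r g + N_poles r h.
Proof.
move=> r1 mf mg mh fgh; have r0 : 0 < r by lra.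
have [s1 [u1 H1]] := pole_seq r mg; have [s2 [u2 H2]] := pole_seq r mh.
pose s := undup (s1 ++ s2).
have us : uniq s by exact: undup_uniq.
have sg z : cmod z <= r -> z \notin s -> pole_order g z = 0%N.
  by move=> zr; rewrite mem_undup mem_cat negb_or => /andP[/H1 -> //].
have sh z : cmod z <= r -> z \notin s -> pole_order h z = 0%N.
  by move=> zr; rewrite mem_undup mem_cat negb_or => /andP[_ /H2 -> //].
have sf z : cmod z <= r -> z \notin s -> pole_order f z = 0%N.
  move=> zr zs; apply/eqP; rewrite -leqn0; apply: leq_trans (fgh z) _.
  by rewrite sg // sh.
rewrite (N_poles_kappa r0 us sf) (N_poles_kappa r0 us sg) (N_poles_kappa r0 us sh).
rewrite -big_split /=; apply: ler_sum => a _; rewrite -mulrDl ler_wpM2r ?kappa_ge0 //.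
by rewrite -natrD ler_nat.
Qed.

End Counting.

(** * Proximity functions and the first main theorem *)

Section FirstMainTheorem.
Context {R : realType}.
Local Notation C := (Cplx R).
Local Notation mu := (@lebesgue_measure R).
Local Notation I2pi := (`[0, 2 * pi]%classic : set R).
Implicit Types (z w a : C) (f g h : C -> C) (s : seq C) (r t x y : R).

Lemma logp_ge0 x : 0 <= logp x.
Proof. by rewrite /logp le_max lexx orbT. Qed.

(** In this form inequalities for [logp] reduce, by monotonicity of [ln], to polynomial ones between
    maxima. *)
Lemma logpE x : 0 <= x -> logp x = ln (Num.max x 1).
Proof.
move=> x0; rewrite /logp; case: (leP x 1) => x1.
  rewrite ln1; apply/max_idPr; have [->|xn0] := eqVneq x 0; first by rewrite ln0.
  by rewrite -(@ln1 R) ler_ln ?posrE // lt_def xn0.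
by apply/max_idPl; apply: ln_ge0; exact: ltW.
Qed.

Lemma logp_le x y : 0 <= x -> x <= y -> logp x <= logp y.
Proof.
move=> x0 xy; rewrite !logpE ?(le_trans x0) // ler_ln ?posrE ?lt_max ?ltr01 ?orbT //.
by rewrite ge_max !le_max xy lexx !orbT.
Qed.

Lemma logpM x y : 0 <= x -> 0 <= y -> logp (x * y) <= logp x + logp y.
Proof.
move=> x0 y0; rewrite !logpE ?mulr_ge0 // -lnM ?posrE ?lt_max ?ltr01 ?orbT //.
rewrite ler_ln ?posrE ?mulr_gt0 ?lt_max ?ltr01 ?orbT //.
by case: (leP x 1); case: (leP y 1); case: (leP (x * y) 1); nra.
Qed.

Lemma logpD x y : 0 <= x -> 0 <= y -> logp (x + y) <= logp x + logp y + ln 2.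
Proof.
move=> x0 y0; rewrite !logpE ?addr_ge0 // -!lnM ?posrE ?mulr_gt0 ?lt_max ?ltr01 ?orbT //.
rewrite ler_ln ?posrE ?mulr_gt0 ?lt_max ?ltr01 ?orbT //.
by case: (leP x 1); case: (leP y 1); case: (leP (x + y) 1); nra.
Qed.

Lemma logp_sum (I : Type) (s : seq I) (F : I -> R) : (forall i, 0 <= F i) ->
  logp (\sum_(i <- s) F i) <= \sum_(i <- s) logp (F i) + (size s)%:R * ln 2.
Proof.
move=> F0; elim: s => [|i s IH].
  by rewrite !big_nil mul0r addr0 /logp ln0 // maxxx.
rewrite !big_cons /= -natr1 mulrDl mul1r.
apply: le_trans (logpD (F0 i) _) _; first exact: sumr_ge0.
lra.
Qed.

Lemma logpV x : 0 <= x -> logp x - logp x^-1 = ln x.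
Proof.
move=> xge0; have [->|xn0] := eqVneq x 0; first by rewrite invr0 subrr ln0.
have x0 : 0 < x by rewrite lt_def xn0.
rewrite /logp lnV ?posrE //.
by case: (leP (ln x) 0); case: (leP (- ln x) 0); lra.
Qed.

Definition lp f r t : R := logp (cmod (f (circle_point r t))).

Lemma proximityE r f : proximity r f = (2 * pi)^-1 * cint (lp f r).
Proof. by []. Qed.

(** [logp] is half of [ln + |ln|], so Jensen's formula supplies integrability even when the circle
    passes through poles. *)
Lemma lp_integrable f r : 0 < r -> meromorphic f -> cintegrable (lp f r).
Proof.
move=> r0 mf; have [f0|nz] := pselect (mero_eq f (fun=> 0)).
  have fF := circle_exceptions r0 (fun w (_ : cmod w = r) => f0 w).
  have i0 : cintegrable (fun=> 0 : R) by apply: continuous_cintegrable; exact: cst_continuous.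
  have [] // := @cint_eq_off R (fun=> 0) (lp f r) _ fF _ i0.
  move=> t It nF; rewrite /lp.
  have -> : f (circle_point r t) = 0 by apply: contrapT => h; apply: nF.
  by rewrite cmod0 /logp ln0 // maxxx.
have [s [_ _ i1 _]] := jensen r0 mf nz.
have i2 : cintegrable (fun t => `|ln (cmod (f (circle_point r t)))|) by exact: integrable_norm i1.
have -> : lp f r = (fun t => 2^-1 * (ln (cmod (f (circle_point r t))) + `|ln (cmod (f (circle_point r t)))|)).
  apply/funext => t; rewrite /lp /logp; move: (ln _) => x.
  by case: (leP x 0) => x0; [rewrite ler0_norm //; lra|rewrite gtr0_norm //; lra].
by exact: (cintegrableZ 2^-1 (cintegrableD i1 i2)).
Qed.

Lemma cint_le (h1 h2 : R -> R) : cintegrable h1 -> cintegrable h2 ->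
  (forall t, h1 t <= h2 t) -> cint h1 <= cint h2.
Proof. by move=> i1 i2 h12; apply: le_Rintegral => // t _; exact: h12. Qed.

Lemma twopi_neq0 : (2 * pi : R) != 0.
Proof. by rewrite gt_eqF // twopi_gt0. Qed.

Lemma twopiV_ge0 : 0 <= (2 * pi)^-1 :> R.
Proof. by rewrite invr_ge0 ltW // twopi_gt0. Qed.

Lemma proximity_ge0 r f : 0 <= proximity r f.
Proof.
by rewrite mulr_ge0 ?twopiV_ge0 //; apply: Rintegral_ge0 => t _; exact: logp_ge0.
Qed.

Lemma cint_le_off (P : C -> Prop) (h1 h2 : R -> R) r : 0 < r ->
  (forall z, \forall w \near z^', P w) -> cintegrable h1 -> cintegrable h2 ->
  (forall t, P (circle_point r t) -> h1 t <= h2 t) -> cint h1 <= cint h2.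
Proof.
move=> r0 HP i1 i2 h12.
have fF := circle_exceptions r0 (fun w (_ : cmod w = r) => HP w).
(* Replacing [h2] by [h1] at the exceptional angles makes the inequality hold everywhere without
   changing the integral. *)
pose h3 t := if pselect (P (circle_point r t)) then h2 t else h1 t.
have [i3 <-] : cintegrable h3 /\ cint h3 = cint h2.
  apply: (cint_eq_off fF _ i2) => t It nF; rewrite /h3.
  by case: pselect => // nP; case: nF.
by apply: cint_le => // t; rewrite /h3; case: pselect => // Pt; exact: h12.
Qed.

Lemma cintegrable_cst (k : R) : cintegrable (fun=> k).
Proof. by apply: continuous_cintegrable; exact: cst_continuous. Qed.

Lemma proximity_eq f g r : 0 < r -> meromorphic f -> meromorphic g -> mero_eq f g ->
  proximity r f = proximity r g.
Proof.
move=> r0 mf mg fg; rewrite !proximityE; congr (_ * _).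
have i1 := lp_integrable r0 mf; have i2 := lp_integrable r0 mg.
apply/eqP; rewrite eq_le; apply/andP; split; apply: (cint_le_off r0 fg) => // t;
  by rewrite /lp => ->.
Qed.

Lemma proximityB f g r : 0 < r -> meromorphic f -> meromorphic g ->
  proximity r (fun z => f z - g z) <= proximity r f + proximity r g + ln 2.
Proof.
move=> r0 mf mg; rewrite !proximityE.
have i1 := lp_integrable r0 mf; have i2 := lp_integrable r0 mg.
have i3 := lp_integrable r0 (meromorphicB mf mg).
have ic := cintegrable_cst (ln 2).
have -> : (2 * pi)^-1 * cint (lp f r) + (2 * pi)^-1 * cint (lp g r) + ln 2 =
    (2 * pi)^-1 * cint (fun t => lp f r t + lp g r t + ln 2).
  rewrite cintD //; last exact: cintegrableD.
  rewrite cintD // cint_cst; have := twopi_neq0.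
  by move: (2 * pi : R) => P P0; field.
apply: ler_wpM2l; first exact: twopiV_ge0.
apply: cint_le => //; first by apply: cintegrableD => //; exact: cintegrableD.
move=> t; rewrite /lp; apply: le_trans (logpD (cmod_ge0 _) (cmod_ge0 _)).
by apply: logp_le; [exact: cmod_ge0|rewrite -(cmodN (g _)); exact: cmodD].
Qed.

Lemma pole_orderN f z0 : meromorphic f -> pole_order (fun z => - f z) z0 = pole_order f z0.
Proof.
move=> mf.
have le g : meromorphic g -> (pole_order (fun z => (- g z)%R) z0 <= pole_order g z0)%N.
  move=> mg; have [u [hu gu]] := pole_order_rep z0 mg.
  apply: (pole_order_le (holomorphicN hu)).
  by apply: filterS gu => z ->; rewrite mulNr.
apply/eqP; rewrite eqn_leq le //=.
have := le (fun z => - f z).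
rewrite (_ : (fun z => - - f z) = f); last by apply/funext => z; rewrite opprK.
apply; have := meromorphicB (meromorphic_cst 0) mf.
by rewrite (_ : (fun z => 0 - f z) = (fun z => - f z)) //; apply/funext => z; rewrite sub0r.
Qed.

Lemma N_polesB f g r : 1 <= r -> meromorphic f -> meromorphic g ->
  N_poles r (fun z => f z - g z) <= N_poles r f + N_poles r g.
Proof.
move=> r1 mf mg.
have mNg : meromorphic (fun z => - g z).
  have := meromorphicB (meromorphic_cst 0) mg.
  by rewrite (_ : (fun z => 0 - g z) = (fun z => - g z)) //; apply/funext => z; rewrite sub0r.
apply: N_poles_le => //; first exact: meromorphicB.
move=> z; rewrite -(pole_orderN z mg); exact: (pole_orderD z mf mNg).
Qed.

Lemma characteristicB f g r : 1 <= r -> meromorphic f -> meromorphic g ->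
  characteristic r (fun z => f z - g z) <= characteristic r f + characteristic r g + ln 2.
Proof.
move=> r1 mf mg; have r0 : 0 < r by lra.
have := proximityB r0 mf mg; have := N_polesB r1 mf mg.
rewrite /characteristic; lra.
Qed.

Lemma N_poles_ge0 f r : 1 <= r -> meromorphic f -> 0 <= N_poles r f.
Proof.
move=> r1 mf; have r0 : 0 < r by lra.
have [s [us sE]] := pole_seq r mf; rewrite (N_poles_kappa r0 us sE).
by apply: sumr_ge0 => a _; rewrite mulr_ge0 // kappa_ge0.
Qed.

(** In Jensen's formula [ln x] is split into [logp x - logp x^-1], and the signed order into the
    pole order of [1/f] minus that of [f]. The bounded term is thus an explicit constant. *)
Lemma characteristicV f r : 0 < r -> meromorphic f -> ~ mero_eq f (fun=> 0) ->
  characteristic r (fun z => (f z)^-1) = characteristic r f - ln (cmod (lead f)).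
Proof.
move=> r0 mf nz; have [s [us sE i1 e1]] := jensen r0 mf nz.
have o z : local_order f z (ord f z) by exact: ordP.
have p1 z : cmod z <= r -> z \notin s -> pole_order f z = 0%N.
  by move=> zr zs; rewrite (pole_order_local (o z)) (sE z zr zs).
have p2 z : cmod z <= r -> z \notin s -> pole_order (fun z => (f z)^-1) z = 0%N.
  by move=> zr zs; rewrite (pole_order_local (local_orderV (o z))) (sE z zr zs).
rewrite /characteristic (N_poles_kappa r0 us p1) (N_poles_kappa r0 us p2) !proximityE.
have il := lp_integrable r0 mf; have ilV := lp_integrable r0 (meromorphicV mf).
have e2 : cint (lp f r) = cint (lp (fun z => (f z)^-1) r) + cint (fun t => ln (cmod (f (circle_point r t)))).
  rewrite -cintD //; congr cint; apply/funext => t.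
  by rewrite /lp cmodV -(logpV (cmod_ge0 (f (circle_point r t)))); ring.
have e3 : \sum_(a <- s) (pole_order (fun z => (f z)^-1) a)%:R * kappa r a =
    \sum_(a <- s) (pole_order f a)%:R * kappa r a + \sum_(a <- s) (ord f a)%:~R * kappa r a.
  rewrite -big_split /=; apply: eq_bigr => a _; rewrite -mulrDl; congr (_ * _).
  rewrite (pole_order_local (o a)) (pole_order_local (local_orderV (o a))).
  case: (ord f a) => n; last by rewrite NegzE opprK mulrNz addrN.
  by case: n => [|n]; rewrite ?oppr0 -?NegzE add0r.
rewrite e2 e3 e1; have := twopi_neq0.
by move: (2 * pi : R) => P P0; field.
Qed.

End FirstMainTheorem.

(** * Growth of the characteristic and sums of inverses *)

Section Growth.
Context {R : realType}.
Local Notation C := (Cplx R).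
Implicit Types (z w a : C) (f g h : C -> C) (s : seq C) (r t x y : R).

Lemma characteristicN f r : meromorphic f ->
  characteristic r (fun z => - f z) = characteristic r f.
Proof.
move=> mf; rewrite /characteristic; congr (_ + _).
  rewrite !proximityE; congr (_ * cint _); apply/funext => t.
  by rewrite /lp cmodN.
have e t : n_poles t (fun z => - f z) = n_poles t f.
  by rewrite /n_poles; apply: eq_fsbigr => z _; rewrite pole_orderN.
by rewrite /N_poles; under eq_Rintegral do rewrite !e; rewrite e.
Qed.

Lemma characteristicD_le f g r : 1 <= r -> meromorphic f -> meromorphic g ->
  characteristic r f <= characteristic r (fun z => f z - g z) + characteristic r g + ln 2.
Proof.
move=> r1 mf mg; rewrite -(characteristicN r mg).
have mNg : meromorphic (fun z => - g z).
  have := meromorphicB (meromorphic_cst 0) mg.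
  by rewrite (_ : (fun z => 0 - g z) = (fun z => - g z)) //; apply/funext => z; rewrite sub0r.
have := characteristicB r1 (meromorphicB mf mg) mNg.
rewrite (_ : (fun z => f z - g z - - g z) = f) //.
by apply/funext => z; rewrite opprK subrK.
Qed.

Lemma characteristic_ge0 f r : 1 <= r -> meromorphic f -> 0 <= characteristic r f.
Proof. by move=> r1 mf; rewrite addr_ge0 ?proximity_ge0 ?N_poles_ge0. Qed.

Lemma characteristic_cst (c : C) r : 0 < r -> characteristic r (fun=> c) = logp (cmod c).
Proof.
move=> r0; rewrite /characteristic proximityE.
have pc z : pole_order (fun=> c) z = 0%N.
  apply/eqP; rewrite -leqn0; apply: (pole_order_le (holomorphic_cst c z)).
  by apply: nearW => w; rewrite expr0 divr1.
rewrite (@N_poles_kappa _ _ _ [::]) // big_nil addr0.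
rewrite (_ : lp _ r = fun=> logp (cmod c)) // cint_cst mulKf //.
exact: twopi_neq0.
Qed.

Lemma nonconstant_neq0 f : nonconstant f -> ~ mero_eq f (fun=> 0).
Proof. by move=> nf h; apply: nf; exists 0. Qed.

(* Some value [f z1] is assumed at a point [z1 != 0], so [N(r, 1/(f - f z1))]
   is at least [ln (r / |z1|)]. *)
Lemma characteristic_unbounded f (M : R) : meromorphic f -> nonconstant f ->
  \forall r \near +oo, M <= characteristic r f.
Proof.
move=> mf nf; have nz := nonconstant_neq0 nf.
have [z1 [hf1 z10]] : exists z1 : C, holomorphic_at f z1 /\ z1 != 0.
  apply: (@filter_ex _ (0 : C)^').
  apply: filterS2 (local_order_near (ordP 0 mf nz)) (@nbhs_dnbhs_neq C 0).
  by move=> z [].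
pose c := f z1; pose F z := f z - c.
have mF : meromorphic F := meromorphicB mf (meromorphic_cst c).
have nzF : ~ mero_eq F (fun=> 0).
  move=> h; apply: nf; exists c => z0; apply: filterS (h z0) => z /eqP.
  by rewrite subr_eq0 => /eqP.
have hF : holomorphic_at F z1 := holomorphicB hf1 (holomorphic_cst c z1).
have [m m0 Fm] : exists2 m : nat, (0 < m)%N & local_order F z1 m%:Z.
  have [F0|[m [g [hg g0 Fg]]]] := holomorphic_zero_or_order hF.
    by case: nzF; exact: meromorphic_identity mF (nbhs_dnbhs F0).
  exists m; last by exists g; split => //; exact: nbhs_dnbhs Fg.
  have := nbhs_singleton Fg; rewrite /F subrr subrr.
  by case: m {Fg} => // /esym /eqP; rewrite expr0 mul1r (negbTE g0).
have pF : (0 < pole_order (fun z => (F z)^-1) z1)%N.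
  rewrite (pole_order_local (local_orderV Fm)).
  by case: m m0 {Fm} => // n _; rewrite -NegzE.
have mFV := meromorphicV mF.
have low r : 1 <= r -> cmod z1 <= r -> ln r - ln (cmod z1) <= N_poles r (fun z => (F z)^-1).
  move=> r1 z1r; have r0 : 0 < r by lra.
  have [s [us sE]] := pole_seq r mFV; rewrite (N_poles_kappa r0 us sE).
  have z1s : z1 \in s.
    by apply: contraT => /(sE z1 z1r) e; rewrite e in pF.
  rewrite (bigD1_seq z1) //=.
  have k0 : 0 <= kappa r z1 by exact: kappa_ge0.
  have e1 : kappa r z1 = ln r - ln (cmod z1).
    by rewrite /kappa (negbTE z10) z1r lnM ?posrE ?invr_gt0 ?cmod_gt0 // lnV ?posrE ?cmod_gt0.
  have h1 : kappa r z1 <= (pole_order (fun z => (F z)^-1) z1)%:R * kappa r z1.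
    by rewrite ler_peMl // ler1n.
  have h2 : 0 <= \sum_(i <- s | i != z1) (pole_order (fun z => (F z)^-1) i)%:R * kappa r i.
    by apply: sumr_ge0 => a _; rewrite mulr_ge0 // kappa_ge0.
  lra.
(* Besides [M], these are the constants in [ln r - ln |z1| <= T(r, 1/F) <= T(r, f) + O(1)]. *)
pose K := M + logp (cmod c) + ln 2 - ln (cmod (lead F)) + ln (cmod z1).
near=> r.
have r1 : 1 <= r by near: r; apply: nbhs_pinfty_ge; rewrite num_real.
have r0 : 0 < r by lra.
have z1r : cmod z1 <= r by near: r; apply: nbhs_pinfty_ge; rewrite num_real.
have Kr : K <= ln r.
  have Kr : expR K <= r by near: r; apply: nbhs_pinfty_ge; rewrite num_real.
  by rewrite -[K]expRK ler_ln ?posrE ?expR_gt0.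
have e1 := characteristicV r0 mF nzF.
have e2 := characteristicB r1 mf (meromorphic_cst c).
have e3 := characteristic_cst c r0.
have e4 := low r r1 z1r.
have e5 : N_poles r (fun z => (F z)^-1) <= characteristic r (fun z => (F z)^-1).
  by rewrite /characteristic lerDr proximity_ge0.
move: e2; rewrite -/F e3; rewrite /K in Kr; lra.
Unshelve. all: end_near. Qed.

(* Let [B] be the sum on the right.  If some [1/|x_j|] exceeds [2 q B], the other
   [1/|x_i|] are at most [2 B], so that [1/x_j] dominates the sum of inverses. *)
Lemma sum_logp_inv (q : nat) (x : 'I_q -> C) :
  (forall j, x j != 0) -> (forall i j, i != j -> x i != x j) ->
  \sum_j logp (cmod (x j))^-1 <=
    logp (cmod (\sum_j (x j)^-1)) + logp q%:R +
    q%:R * logp (2 * q%:R * \sum_(p : 'I_q * 'I_q) (cmod (x p.1 - x p.2))^-1).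
Proof.
move=> x0 xx; set B := \sum_(p : _ * _) _; pose y j := (cmod (x j))^-1.
have y0 j : 0 < y j by rewrite invr_gt0 cmod_gt0.
have Bt p : 0 <= (cmod (x p.1 - x p.2))^-1 by rewrite invr_ge0 cmod_ge0.
have B0 : 0 <= B by apply: sumr_ge0.
have pairB i j : (cmod (x i - x j))^-1 <= B.
  rewrite /B (bigD1 (i, j)) //= lerDl; apply: sumr_ge0 => p _; exact: Bt.
have [all|] := pselect (forall j, y j <= 2 * q%:R * B).
  apply: (@le_trans _ _ (\sum_(j < q) logp (2 * q%:R * B))).
    by apply: ler_sum => j _; apply: logp_le (all j); exact: ltW.
  rewrite sumr_const card_ord -[leLHS]mulr_natl lerDr addr_ge0 ?logp_ge0 //.
move=> /existsNP [j /negP]; rewrite -ltNge => yj.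
have q1 : 1 <= q%:R :> R by rewrite ler1n (leq_ltn_trans _ (ltn_ord j)).
have others i : i != j -> y i <= 2 * B.
  move=> ij; have xij : 0 < cmod (x i - x j) by rewrite cmod_gt0 subr_eq0 xx.
  have Bpos : 0 < B by apply: lt_le_trans (pairB i j); rewrite invr_gt0.
  have h1 : B^-1 <= cmod (x i - x j).
    by rewrite -[leRHS]invrK lef_pV2 ?posrE ?invr_gt0.
  have h2 : cmod (x j) <= (2 * B)^-1.
    rewrite -[leLHS]invrK lef_pV2 ?posrE ?y0 ?mulr_gt0 //.
    apply: le_trans (ltW yj); rewrite -!mulrA ler_pM2l // ler_peMl //; exact: ltW.
  have h3 := cmodD (x i) (- x j); rewrite cmodN in h3.
  have h4 : B^-1 = (2 * B)^-1 + (2 * B)^-1 by field; rewrite gt_eqF.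
  have h5 : (2 * B)^-1 <= cmod (x i).
    by move: h4 h1 h2 h3; move: (2 * B)^-1 B^-1 => D1 D2 -> h1 h2 h3; lra.
  have B2 : 0 < (2 * B)^-1 by rewrite invr_gt0 mulr_gt0.
  have := h5; rewrite -lef_pV2 ?posrE ?cmod_gt0 // invrK; exact: id.
(* The other inverses sum to at most [(q - 1) 2 B], which is at most [(q - 1) / q] of [y j]; so at
   least [y j / q] survives. *)
have key : y j <= q%:R * cmod (\sum_j (x j)^-1).
  rewrite (bigD1 j) //=; set T := \sum_(i | i != j) _.
  have T1 : cmod T <= (q%:R - 1) * (2 * B).
    apply: le_trans (cmod_sum _ _ _) _.
    apply: (@le_trans _ _ (\sum_(i < q | i != j) (2 * B))).
      by apply: ler_sum => i ij; rewrite cmodV; exact: others.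
    rewrite sumr_const -[leLHS]mulr_natl cardC1 card_ord -subn1 natrB //.
    by rewrite (leq_ltn_trans _ (ltn_ord j)).
  have := cmodD ((x j)^-1 + T) (- T); rewrite addrK cmodN cmodV -/(y j).
  nra.
rewrite (bigD1 j) //=.
have h1 : logp (y j) <= logp (cmod (\sum_j (x j)^-1)) + logp q%:R.
  rewrite addrC; apply: le_trans (logpM _ (cmod_ge0 _)) => //.
  by apply: logp_le key; exact: ltW.
have h2 : \sum_(i < q | i != j) logp (y i) <= q%:R * logp (2 * q%:R * B).
  apply: (@le_trans _ _ (\sum_(i < q | i != j) logp (2 * q%:R * B))).
    apply: ler_sum => i ij; apply: logp_le; first exact: ltW.
    by apply: le_trans (others i ij) _; rewrite mulrAC ler_peMr // mulr_ge0.
  rewrite sumr_const -[leLHS]mulr_natl ler_wpM2r ?logp_ge0 // ler_nat.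
  by rewrite (leq_trans (max_card _)) // card_ord.
exact: lerD.
Qed.

End Growth.

(** * The estimate for several small functions *)

Section LittleO.
Context {R : realType}.
Implicit Types (E F : set R) (u v T : R -> R).

Lemma o_outside_sub E F u T : E `<=` F -> o_outside E u T -> o_outside F u T.
Proof.
move=> EF uT e e0; apply: filterS (uT e e0) => r h nF; apply: h.
by move=> /EF.
Qed.

Lemma o_outsideD E u v T : o_outside E u T -> o_outside E v T ->
  o_outside E (fun r => u r + v r) T.
Proof.
move=> uT vT e e0; have e20 : 0 < e / 2 by lra.
apply: filterS2 (uT _ e20) (vT _ e20) => r h1 h2 nE.
have := h1 nE; have := h2 nE; have := ler_normD (u r) (v r); lra.
Qed.

Lemma o_outsideZ E (k : R) u T : o_outside E u T -> o_outside E (fun r => k * u r) T.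
Proof.
move=> uT e e0; have k0 : 0 < `|k| + 1 by rewrite ltr_wpDl.
have ek : 0 < e / (`|k| + 1) by rewrite divr_gt0.
apply: filterS (uT _ ek) => r h nE; have := h nE.
rewrite normrM mulrAC ler_pdivlMr // => h1.
have := normr_ge0 (u r); nra.
Qed.

Lemma o_outside_sum (I : Type) (l : seq I) E (u : I -> R -> R) T :
  (forall i, o_outside E (u i) T) -> o_outside E (fun r => \sum_(i <- l) u i r) T.
Proof.
move=> uT; elim: l => [|i l IH].
  move=> e e0; apply: nearW => r _; rewrite big_nil normr0 mulr_ge0 //; exact: ltW.
under eq_fun do rewrite big_cons.
exact: o_outsideD.
Qed.

Lemma o_outside_cst E (k : R) T : (forall M, \forall r \near +oo, M <= T r) ->
  o_outside E (fun=> k) T.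
Proof.
move=> Toy e e0; apply: filterS (Toy (`|k| / e)) => r h _.
rewrite mulrC -ler_pdivrMr //; apply: le_trans h _; exact: ler_norm.
Qed.

Lemma o_outside_le E u v T : (\forall r \near +oo, ~ E r -> `|u r| <= `|v r|) ->
  o_outside E v T -> o_outside E u T.
Proof.
move=> uv vT e e0; apply: filterS2 uv (vT e e0) => r h1 h2 nE.
exact: le_trans (h1 nE) (h2 nE).
Qed.

(** This converts smallness relative to [T(r, f - a_j)] into smallness relative to [T(r, f)]. *)
Lemma o_outside_bigO E (k : R) u v T : 0 < k ->
  (\forall r \near +oo, ~ E r -> `|v r| <= k * `|T r|) ->
  o_outside E u v -> o_outside E u T.
Proof.
move=> k0 vT uv e e0; have ek : 0 < e / k by rewrite divr_gt0.
apply: filterS2 vT (uv _ ek) => r h1 h2 nE; apply: le_trans (h2 nE) _.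
apply: le_trans (ler_wpM2l (ltW ek) (h1 nE)) _.
by rewrite mulrA divfK // gt_eqF.
Qed.

(** Otherwise [F] would contain a half-line, which has infinite measure. *)
Lemma finite_measure_unbounded F (P : R -> Prop) : finite_linear_measure F ->
  (\forall r \near +oo, P r) -> exists r, P r /\ ~ F r.
Proof.
move=> [mF Ffin] [M [Mr MP]]; apply: contrapT => nex.
have sub : (`]M, +oo[%classic : set R) `<=` F.
  move=> r; rewrite /= in_itv /= andbT => Mr'; apply: contrapT => nF.
  by apply: nex; exists r; split => //; exact: MP.
have h : (lebesgue_measure (`]M, +oo[%classic : set R) <= lebesgue_measure F)%E.
  by apply: le_measure => //; rewrite inE //; exact: measurable_itv.
rewrite lebesgue_measure_itv /= in h.
by have := le_lt_trans h Ffin; rewrite ltry ltxx.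
Qed.

End LittleO.

Section SecondMainTheorem.
Context {R : realType}.
Local Notation C := (Cplx R).
Implicit Types (z w : C) (f g h : C -> C) (r : R).

Lemma mero_nonzero_near f : meromorphic f -> ~ mero_eq f (fun=> 0) ->
  forall z, \forall w \near z^', f w != 0.
Proof.
move=> mf nz z; apply: filterS (local_order_near (ordP z mf nz)) => w [].
by [].
Qed.

Lemma characteristic_eq f g r : 0 < r -> meromorphic f -> meromorphic g -> mero_eq f g ->
  characteristic r f = characteristic r g.
Proof.
move=> r0 mf mg fg; rewrite /characteristic (proximity_eq r0 mf mg fg); congr (_ + _).
have e t : n_poles t f = n_poles t g.
  by rewrite /n_poles; apply: eq_fsbigr => z _; rewrite (pole_order_eq (fg z)).
by rewrite /N_poles; under eq_Rintegral do rewrite !e; rewrite e.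
Qed.

Lemma proximity_factor f h r : 0 < r -> meromorphic h -> meromorphic f ->
  ~ mero_eq f (fun=> 0) ->
  proximity r h <= proximity r f + proximity r (fun z => h z / f z).
Proof.
move=> r0 mh mf nz; rewrite !proximityE -mulrDr.
have mq := meromorphicM mh (meromorphicV mf).
have i1 := lp_integrable r0 mf; have i2 := lp_integrable r0 mq.
rewrite -(cintD i1 i2); apply: ler_wpM2l; first exact: twopiV_ge0.
apply: (cint_le_off r0 (mero_nonzero_near mf nz)); [exact: lp_integrable|exact: cintegrableD|].
move=> t ft; rewrite /lp.
apply: le_trans (logpM (cmod_ge0 _) (cmod_ge0 _)); rewrite -cmodM.
by rewrite mulrC divfK.
Qed.

(** Factoring [l^-1] out of the sum of inverses produces the quotients [l / x j]; [l] will be the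
    common value of [L f] and all [L (g j)]. The constant is chosen before [x] and [l], so it
    depends neither on the angle nor on the radius. *)
Lemma pointwise_bound (q : nat) : exists K : R, forall (x : 'I_q -> C) (l : C),
  (forall j, x j != 0) -> (forall i j, i != j -> x i != x j) -> l != 0 ->
  \sum_j logp (cmod (x j)^-1) <= logp (cmod l^-1) + \sum_j logp (cmod (l / x j)) +
    q%:R * (\sum_(p : 'I_q * 'I_q) logp (cmod (x p.1 - x p.2)^-1)) + K.
Proof.
pose n1 := size (index_enum 'I_q); pose n2 := size (index_enum ('I_q * 'I_q)%type).
exists (n1%:R * ln 2 + logp q%:R + q%:R * (logp (2 * q%:R) + n2%:R * ln 2)).
move=> x l x0 xx l0.
have := sum_logp_inv x0 xx; set B := \sum_(p : _ * _) _ => h1.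
have B0 : 0 <= B by apply: sumr_ge0 => p _; rewrite invr_ge0 cmod_ge0.
have h2 : logp (2 * q%:R * B) <= logp (2 * q%:R) + logp B by apply: logpM => //; rewrite mulr_ge0.
have h3 : logp B <= \sum_(p : 'I_q * 'I_q) logp (cmod (x p.1 - x p.2)^-1) + n2%:R * ln 2.
  apply: le_trans (logp_sum _ _) _; first by move=> p; rewrite invr_ge0 cmod_ge0.
  by rewrite lerD2r; apply: ler_sum => p _; rewrite cmodV.
have h4 : logp (cmod (\sum_j (x j)^-1)) <= logp (cmod l^-1) + (\sum_j logp (cmod (l / x j)) + n1%:R * ln 2).
  have -> : \sum_j (x j)^-1 = l^-1 * \sum_j (l / x j).
    by rewrite mulr_sumr; apply: eq_bigr => j _; rewrite mulKf.
  rewrite cmodM; apply: le_trans (logpM (cmod_ge0 _) (cmod_ge0 _)) _; rewrite lerD2l.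
  apply: le_trans (logp_sum _ _); last by move=> j; exact: cmod_ge0.
  by apply: logp_le; [exact: cmod_ge0|exact: cmod_sum].
have h5 : \sum_j logp (cmod (x j)^-1) = \sum_j logp (cmod (x j))^-1.
  by apply: eq_bigr => j _; rewrite cmodV.
rewrite h5; apply: le_trans h1 _.
have := ler_wpM2l (ler0n R q) (le_trans h2 (lerD (lexx _) h3)); lra.
Qed.

End SecondMainTheorem.

Theorem theorem4p1 (R : realType)
    (N : set (Cplx R -> Cplx R)) (hN : subfield N)
    (L : (Cplx R -> Cplx R) -> (Cplx R -> Cplx R)) (hL : linear_operator L)
    (E : set R) (hE : forall r : R, E r -> 0 < r)
    (hLE : forall g : Cplx R -> Cplx R, N g -> ~ ker L g -> nonconstant g ->
       o_outside E (fun r => proximity r (fun z => L g z / g z))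
                   (fun r => characteristic r g))
    (f : Cplx R -> Cplx R) (hfN : N f) (hfL : ~ ker L f) (hf : nonconstant f)
    (q : nat) (hq : (1 <= q)%N)
    (a : 'I_q -> (Cplx R -> Cplx R))
    (ha_neq : forall i j : 'I_q, i <> j -> ~ mero_eq (a i) (a j))
    (haN : forall j : 'I_q, N (a j))
    (haL : forall j : 'I_q, ker L (a j))
    (haS : forall j : 'I_q, small_functions f (a j)) :
  exists S : R -> R,
    (forall r : R, 0 < r ->
       (q%:R - 1) * characteristic r f + N_ramification L r f
       <= N_poles r f
          + \sum_(j < q) N_poles r (fun z => (f z - a j z)^-1) + S r) /\
    (forall F : set R, (forall j : 'I_q, small_outside F f (a j)) ->
       o_outside (E `|` F) S (fun r => characteristic r f)).
Proof.
have [Nmero _ _ NB _] := hN; have [Lmero Leq Llin] := hL.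
have mf : meromorphic f := Nmero f hfN.
have ma j : meromorphic (a j) := Nmero _ (haN j).
pose g j z := f z - a j z.
have mg j : meromorphic (g j) := meromorphicB mf (ma j).
have mLf : meromorphic (L f) := Lmero f mf.
have mLg j : meromorphic (L (g j)) := Lmero _ (mg j).
have nzLf : ~ mero_eq (L f) (fun=> 0) by move=> h; apply: hfL.
have LgE j : mero_eq (L (g j)) (L f).
  move=> z; have h1 := Llin (-1) (a j) f (ma j) mf z.
  have [_ h2] := haL j.
  have gE : (fun z => -1 * a j z + f z) = g j by apply/funext => w; rewrite /g mulN1r addrC.
  rewrite gE in h1.
  by apply: filterS2 h1 (h2 z) => w -> ->; rewrite mulr0 add0r.
have Tpos M : \forall r \near +oo, M <= characteristic r f.
  exact: characteristic_unbounded.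
have near1 : \forall r \near +oo, (1 : R) <= r.
  by apply: nbhs_pinfty_ge; rewrite num_real.
(* Otherwise [T(r, f) <= T(r, a_j) + O(1)], contradicting the smallness of [a_j]
   at the arbitrarily large [r] outside a set of finite measure. *)
have gnc j : nonconstant (g j).
  move=> [c gc]; have [_ [F0 F0fin F0small]] := haS j.
  pose K := logp (cmod c) + ln 2.
  have e2 : 0 < (1 / 2 : R) by lra.
  (* Smallness with factor 1/2 gives [T <= K + T/2], hence [T <= 2 K], against the choice of [r]. *)
  have [r [[Kr [r1 sm]] nF]] := finite_measure_unbounded F0fin
    (filterI (Tpos (2 * K + 1)) (filterI near1 (F0small _ e2))).
  have r0 : 0 < r by lra.
  have h1 := characteristicD_le r1 mf (ma j).
  have h2 := characteristic_eq r0 (mg j) (meromorphic_cst c) gc.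
  rewrite -/(g j) h2 (characteristic_cst c r0) in h1.
  have T0 := characteristic_ge0 r1 mf.
  have := sm nF; rewrite (ger0_norm T0) => h3.
  have := ler_norm (characteristic r (a j)).
  rewrite /K in Kr; lra.
have gker j : ~ ker L (g j).
  move=> [_ h]; apply: nzLf => z.
  by apply: filterS2 (LgE j z) (h z) => w <-.
have gnz j : ~ mero_eq (g j) (fun=> 0) := nonconstant_neq0 (gnc j).
(* [S] has to satisfy the inequality for every [r > 0], so the error is defined
   by it and only estimated for large [r]. *)
pose S r := Num.max 0 ((q%:R - 1) * characteristic r f + N_ramification L r f
  - (N_poles r f + \sum_(j < q) N_poles r (fun z => (f z - a j z)^-1))).
exists S; split; first by move=> r _; rewrite -lerBlDl /S le_max lexx orbT.
move=> F Fsmall.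
pose T r := characteristic r f.
have EEF : E `<=` E `|` F by move=> r; left.
have FEF : F `<=` E `|` F by move=> r; right.
have oa j : o_outside (E `|` F) (characteristic ^~ (a j)) T.
  exact: o_outside_sub FEF (Fsmall j).
pose m0 r := proximity r (fun z => L f z / f z).
have om0 : o_outside (E `|` F) m0 T by exact: o_outside_sub EEF (hLE f hfN hfL hf).
pose mj j r := proximity r (fun z => L (g j) z / g j z).
have omj j : o_outside (E `|` F) (mj j) T.
  have h := o_outside_sub EEF (hLE (g j) (NB _ _ hfN (haN j)) (gker j) (gnc j)).
  (* In [T(r, g_j) <= T(r, f) + T(r, a_j) + ln 2] each of the last two terms is eventually at most
     [T(r, f)] off the exceptional set. *)
  apply: (@o_outside_bigO _ _ 3 _ _ _ _ _ h) => //.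
  apply: filterS3 near1 (Tpos (ln 2)) (oa j 1 ltr01) => r r1 Tln h1 nEF.
  have T0 := characteristic_ge0 r1 mf.
  have := h1 nEF; rewrite (ger0_norm T0) (ger0_norm (characteristic_ge0 r1 (mg j))).
  have := characteristicB r1 mf (ma j); rewrite -/(g j).
  have := ler_norm (characteristic r (a j)); rewrite /T mul1r; lra.
pose pr (p : 'I_q * 'I_q) r := proximity r (fun z => (a p.1 z - a p.2 z)^-1).
have opr p : o_outside (E `|` F) (pr p) T.
  have ic M := o_outside_cst (E `|` F) M Tpos.
  (* The sum runs over all pairs; a diagonal one gives the function [0^-1 = 0]. *)
  have [e|/eqP ne] := eqVneq p.1 p.2.
    apply: (o_outside_le _ (ic 0)); apply: filterS near1 => r r1 _.
    have r0 : 0 < r by lra.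
    have : characteristic r (fun=> (0 : Cplx R)) = 0.
      by rewrite characteristic_cst // cmod0 /logp ln0 // maxxx.
    have := N_poles_ge0 r1 (@meromorphic_cst R 0).
    have := proximity_ge0 r (fun=> (0 : Cplx R)).
    rewrite /pr e (_ : (fun z => _) = fun=> 0); last by apply/funext => z; rewrite subrr invr0.
    rewrite /characteristic => h1 h2 h3.
    by rewrite normr0 normr_le0; apply/eqP; lra.
  have nz : ~ mero_eq (fun z => a p.1 z - a p.2 z) (fun=> 0).
    move=> h; apply: (ha_neq _ _ ne) => z; apply: filterS (h z) => w /eqP.
    by rewrite subr_eq0 => /eqP.
  have md := meromorphicB (ma p.1) (ma p.2).
  (* By the first main theorem the proximity is at most [T(r, a_i) + T(r, a_j)] plus this
     constant. *)
  pose k := ln 2 - ln (cmod (lead (fun z => a p.1 z - a p.2 z))).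
  apply: (o_outside_le _ (o_outsideD (o_outsideD (oa p.1) (oa p.2)) (ic k))).
  apply: filterS near1 => r r1 _; have r0 : 0 < r by lra.
  rewrite ger0_norm ?proximity_ge0 //; apply: le_trans (ler_norm _).
  have h1 := characteristicB r1 (ma p.1) (ma p.2).
  have h2 := characteristicV r0 md nz.
  have h3 := N_poles_ge0 r1 (meromorphicV md).
  have : pr p r + N_poles r (fun z => (a p.1 z - a p.2 z)^-1) =
    characteristic r (fun z => (a p.1 z - a p.2 z)^-1) by [].
  rewrite /k; lra.
have [K HK] := pointwise_bound (R := R) q.
have prox_ineq r : 0 < r -> \sum_j proximity r (fun z => (g j z)^-1) <=
    proximity r (fun z => (L f z)^-1) + \sum_j mj j r + q%:R * (\sum_p pr p r) + K.
  move=> r0.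
  (* What [pointwise_bound] needs at [z], together with the identity that turns [l / x j] into
     [L (g j) z / g j z]. Each condition fails only on a discrete set. *)
  pose P z := [/\ L f z != 0, forall j, L (g j) z = L f z, forall j, g j z != 0 &
    forall i j, i != j -> g i z != g j z].
  have HP z : \forall w \near z^', P w.
    have n1 := mero_nonzero_near mLf nzLf z.
    have n2 : \forall w \near z^', forall j, L (g j) w = L f w.
      by apply: filter_forall => j; exact: LgE.
    have n3 : \forall w \near z^', forall j, g j w != 0.
      by apply: filter_forall => j; exact: mero_nonzero_near.
    have n4 : \forall w \near z^', forall p : 'I_q * 'I_q, p.1 != p.2 -> g p.1 w != g p.2 w.
      apply: filter_forall => p; have [->|/eqP ne] := eqVneq p.1 p.2.
        by apply: filterE.
      have nz : ~ mero_eq (fun z => a p.1 z - a p.2 z) (fun=> 0).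
        move=> h; apply: (ha_neq _ _ ne) => y; apply: filterS (h y) => w /eqP.
        by rewrite subr_eq0 => /eqP.
      have := mero_nonzero_near (meromorphicB (ma p.1) (ma p.2)) nz z.
      apply: filterS => w; rewrite subr_eq0 => h _; apply: contra h => /eqP.
      by rewrite /g => /addrI /oppr_inj ->.
    apply: filterS2 (filterI n1 n2) (filterI n3 n4) => w [w1 w2] [w3 w4]; split => //.
    by move=> i j; exact: (w4 (i, j)).
  have mV j := meromorphicV (mg j).
  have mq j : meromorphic (fun z => L (g j) z / g j z) := meromorphicM (mLg j) (mV j).
  have mp (p : 'I_q * 'I_q) := meromorphicV (meromorphicB (ma p.1) (ma p.2)).
  have [i1 e1] := cint_sum (index_enum 'I_q) (fun j => lp_integrable r0 (mV j)).
  have [i2 e2] := cint_sum (index_enum 'I_q) (fun j => lp_integrable r0 (mq j)).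
  have [i3 e3] := cint_sum (index_enum ('I_q * 'I_q)%type) (fun p => lp_integrable r0 (mp p)).
  have i0 := lp_integrable r0 (meromorphicV mLf).
  have i4 := cintegrableD (cintegrableD (cintegrableD i0 i2) (cintegrableZ q%:R i3)) (cintegrable_cst K).
  have le := cint_le_off r0 HP i1 i4.
  have pE : forall (I : Type) (s : seq I) (h : I -> Cplx R -> Cplx R),
      \sum_(i <- s) proximity r (h i) = (2 * pi)^-1 * \sum_(i <- s) cint (lp (h i) r).
    by move=> I s h; rewrite mulr_sumr; apply: eq_bigr => i _; exact: proximityE.
  have point t : P (circle_point r t) ->
      \sum_j lp (fun z => (g j z)^-1) r t <= lp (fun z => (L f z)^-1) r t +
      \sum_j lp (fun z => L (g j) z / g j z) r t +
      q%:R * (\sum_(p : 'I_q * 'I_q) lp (fun z => (a p.1 z - a p.2 z)^-1) r t) + K.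
    rewrite /lp; move: (circle_point r t) => z [l0 Lg x0 xx].
    apply: le_trans (HK (g ^~ z) (L f z) x0 xx l0) _.
    have -> : \sum_j logp (cmod (L f z / g j z)) = \sum_j logp (cmod (L (g j) z / g j z)).
      by apply: eq_bigr => j _; rewrite Lg.
    rewrite lerD2r lerD2l ler_wpM2l // ler_sum // => p _.
    have -> : g p.1 z - g p.2 z = - (a p.1 z - a p.2 z) by rewrite /g; ring.
    by rewrite !cmodV cmodN.
  have {point} := le point.
  have i5 := cintegrableD i0 i2; have i6 := cintegrableZ q%:R i3.
  rewrite (cintD (cintegrableD i5 i6) (cintegrable_cst K)) (cintD i5 i6) (cintD i0 i2).
  rewrite (cintZ q%:R i3) cint_cst e1 e2 e3 /mj /pr proximityE !pE.
  move/(ler_wpM2l twopiV_ge0) => /le_trans; apply.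
  have := @twopi_neq0 R; move: (2 * pi) => k k0; rewrite le_eqVlt; apply/orP; left; apply/eqP.
  by field.
pose K' := K + \sum_j (ln 2 + ln (cmod (lead (g j)))) - ln (cmod (lead (L f))).
pose err r := m0 r + \sum_j mj j r + q%:R * (\sum_p pr p r) + \sum_j characteristic r (a j) + K'.
have oerr : o_outside (E `|` F) err T.
  apply: o_outsideD; last exact: o_outside_cst.
  apply: o_outsideD; last by apply: o_outside_sum.
  apply: o_outsideD; last by apply: o_outsideZ; apply: o_outside_sum.
  by apply: o_outsideD => //; apply: o_outside_sum.
apply: o_outside_le oerr; apply: filterS near1 => r r1 _.
have r0 : 0 < r by lra.
have S0 : 0 <= S r by rewrite /S le_max lexx.
rewrite (ger0_norm S0) /S ge_max normr_ge0 /=; apply: le_trans (ler_norm (err r)).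
(* For each [j], the first main theorem for [g j] is combined with
   [T(r, f) <= T(r, g_j) + T(r, a_j) + ln 2]. *)
have sum1 : q%:R * T r - \sum_j characteristic r (a j)
    - \sum_j (ln 2 + ln (cmod (lead (g j)))) - \sum_(j < q) N_poles r (fun z => (f z - a j z)^-1)
    <= \sum_j proximity r (fun z => (g j z)^-1).
  have -> : q%:R * T r = \sum_(j < q) T r by rewrite sumr_const card_ord mulr_natl.
  rewrite -!sumrB; apply: ler_sum => j _.
  have h1 := characteristicV r0 (mg j) (gnz j).
  have h2 := characteristicD_le r1 mf (ma j); rewrite -/(g j) in h2.
  have h3 : proximity r (fun z => (g j z)^-1) + N_poles r (fun z => (f z - a j z)^-1) =
    characteristic r (fun z => (g j z)^-1) by [].
  rewrite /T; lra.
(* In the final count, one [N(r, f)] of the ramification term comes from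
   [m(r, f) = T(r, f) - N(r, f)], which also lowers [q] to [q - 1]; the other is added to both
   sides. *)
have h1 := characteristicV r0 mLf nzLf.
have h2 : proximity r (fun z => (L f z)^-1) + N_poles r (fun z => (L f z)^-1) =
  characteristic r (fun z => (L f z)^-1) by [].
have h3 : proximity r (L f) + N_poles r (L f) = characteristic r (L f) by [].
have h4 : proximity r f + N_poles r f = T r by [].
have h5 := proximity_factor r0 mLf mf (nonconstant_neq0 hf).
have h6 := prox_ineq r r0.
rewrite -/(m0 r) in h5; rewrite -/(T r) /N_ramification /err /K'; lra.
Qed.
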